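(* Let $0<\alpha\le1$, let $\{\mathcal{S}^\alpha(t)\}_{t\ge0}$ be the generalized fractional Skellam process, and let $\{D_f(t)\}_{t\ge0}$ be an independent Lévy subordinator with $\mathbb{E}(D_f^r(t))<\infty$ for all $r>0$ such that, as $t\to\infty$, $$\mathbb{E}(D_f^{i\alpha}(t))\sim k_i t^{i\rho},\qquad i=1,2,$$ for some $0<\rho<1$, $k_1>0$ and $k_2\ge k_1^2$. Then the process $\mathcal{Z}_f^\alpha(t)=\mathcal{S}^\alpha(D_f(t))$, $t\ge0$, exhibits the long-range dependence property.
   Context: Fix an integer $k\ge1$ and positive rates $\lambda_1,\dots,\lambda_k,\mu_1,\dots,\mu_k$. The generalized counting process (GCP) with rates $\lambda_1,\dots,\lambda_k$ is a Lévy process started at $0$ performing jumps of size $j\in\{1,\dots,k\}$ at rate $\lambda_j$. The generalized Skellam process (GSP) is $\mathcal{S}(t)=M_1(t)-M_2(t)$, with $M_1,M_2$ independent GCPs with rates $\lambda_j$ and $\mu_j$, respectively. For $0<\alpha<1$, the inverse stable subordinator is $Y_\alpha(t)=\inf\{x\ge0: D_\alpha(x)>t\}$, where $D_\alpha$ is the stable subordinator, $\mathbb{E}(e^{-sD_\alpha(t)})=e^{-ts^\alpha}$. The generalized fractional Skellam process (GFSP) is $\mathcal{S}^\alpha(t)=\mathcal{S}(Y_\alpha(t))$ for $0<\alpha<1$ with $\mathcal{S}$ and $Y_\alpha$ independent, and $\mathcal{S}^1(t)=\mathcal{S}(t)$. A Lévy subordinator $\{D_f(t)\}_{t\ge0}$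 is a one-dimensional Lévy process with non-decreasing sample paths, $D_f(0)=0$ a.s., and $\mathbb{E}(e^{-sD_f(t)})=e^{-tf(s)}$, $s>0$, where $f$ is its Bernštein function. The process $\mathcal{Z}_f^\alpha$ is called the time-changed generalized fractional Skellam process-I (TCGFSP-I). $f(t)\sim g(t)$ means $f(t)/g(t)\to1$ as $t\to\infty$. Long-range dependence (LRD): a non-stationary process $\{X(t)\}_{t\ge0}$ has the LRD property if there is $\gamma\in(0,1)$ such that for each fixed $s>0$, $\operatorname{Corr}(X(s),X(t))\sim c(s)t^{-\gamma}$ as $t\to\infty$ for some $c(s)>0$. *)

(* Defs.v *)
From HB Require Import structures.
From mathcomp Require Import all_boot all_order all_algebra.
From mathcomp Require Import all_classical all_reals all_analysis.

Set Implicit Arguments.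
Unset Strict Implicit.
Unset Printing Implicit Defensive.

Import Order.TTheory GRing.Theory Num.Theory.
Import numFieldNormedType.Exports.

Local Open Scope classical_set_scope.
Local Open Scope ring_scope.

(* A real process indexed by [0, +oo[ is a map [X : R -> T -> R]; the values of
   [X t] for [t < 0] are irrelevant and no definition depends on them. *)

Definition asymp_equiv (R : realType) (f g : R -> R) : Prop :=
  f t / g t @[t --> +oo] --> (1 : R).

Section processes.
Context (d : measure_display) (T : measurableType d) (R : realType)
  (P : probability T R).
Implicit Types X Y D M S : R -> T -> R.

(* The events are arbitrary, so taking some [B i := setT] gives the product
   rule for every subfamily. *)
Definition mutually_independent (n : nat) (X : 'I_n -> T -> R) : Prop :=
  forall B : 'I_n -> set R, (forall i, measurable (B i)) ->
    P (\bigcap_i (X i @^-1` B i)) = (\prod_(i < n) P (X i @^-1` B i))%E.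

Definition process_sigma_algebra X : set (set T) :=
  <<s [set A | exists (t : R) (B : set R), [/\ 0 <= t, measurable B & A = X t @^-1` B]] >>.

Definition independent_processes X Y : Prop :=
  forall A B, process_sigma_algebra X A -> process_sigma_algebra Y B ->
    P (A `&` B) = (P A * P B)%E.

Definition cadlag (x : R -> R) : Prop :=
  (forall t : R, 0 <= t -> x u @[u --> t^'+] --> x t) /\
  (forall t : R, 0 < t -> cvg (x u @[u --> t^'-])).

Record levy_process X : Prop := {
  levy_measurable : forall t : R, 0 <= t -> measurable_fun setT (X t) ;
  levy_start : {ae P, forall w, X 0 w = 0} ;
  levy_independent_increments : forall (n : nat) (t : nat -> R),
    0 <= t 0%N -> (forall i, t i <= t i.+1) ->
    mutually_independent (fun (i : 'I_n) w => X (t i.+1) w - X (t i) w) ;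
  levy_stationary_increments : forall (s h : R) (B : set R),
    0 <= s -> 0 <= h -> measurable B ->
    P [set w | B (X (s + h) w - X s w)] = P [set w | B (X h w - X 0 w)] ;
  levy_cadlag : forall w, cadlag (X ^~ w) }.

(* The subordinator takes its values in [0, +oo[ on the whole sample space, so
   that it can be used as a random time although [D 0 = 0] is only required
   almost surely. *)
Record levy_subordinator (f : R -> R) D : Prop := {
  subordinator_levy : levy_process D ;
  subordinator_ge0 : forall (t : R) w, 0 <= t -> 0 <= D t w ;
  subordinator_nondecreasing : forall (s t : R) w, 0 <= s -> s <= t ->
    D s w <= D t w ;
  subordinator_laplace : forall s t : R, 0 < s -> 0 <= t ->
    'E_P[fun w => expR (- (s * D t w))%R]%E = (expR (- (t * f s)))%:E }.

Definition stable_subordinator (alpha : R) D : Prop :=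
  levy_subordinator (fun s => s `^ alpha) D.

(* [inf set0 = 0]; for a stable subordinator the set is almost surely
   nonempty. *)
Definition inverse_subordinator D : R -> T -> R :=
  fun t w => inf [set x | 0 <= x /\ t < D x w].

Definition time_change X D : R -> T -> R := fun t w => X (D t w) w.

(* The rates of the jumps: as [h] decreases to 0,
   P (M h = j) = lambda_j * h + o(h) for j = 1, ..., k, and
   P (M h \notin {0, ..., k}) = o(h). Jumps of size j have rate [lam i] with
   i = j - 1. *)
Record generalized_counting_process (k : nat) (lam : 'I_k -> R) M : Prop := {
  gcp_levy : levy_process M ;
  gcp_jump : forall j : 'I_k,
    fine (P [set w | M h w = j.+1%:R]) / h @[h --> 0^'+] --> lam j ;
  gcp_no_other_jump :
    fine (P [set w | forall j : nat, (j <= k)%N -> M h w != j%:R]) / h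
      @[h --> 0^'+] --> (0 : R) }.

Definition generalized_skellam_process (k : nat) (lam mu : 'I_k -> R) S : Prop :=
  exists M1 M2, [/\ generalized_counting_process lam M1,
    generalized_counting_process mu M2,
    independent_processes M1 M2 &
    forall (t : R) w, 0 <= t -> S t w = M1 t w - M2 t w].

Definition generalized_fractional_skellam_process
    (k : nat) (lam mu : 'I_k -> R) (alpha : R) X : Prop :=
  (alpha = 1 /\ generalized_skellam_process lam mu X) \/
  (0 < alpha < 1 /\
   exists S D, [/\ generalized_skellam_process lam mu S,
     stable_subordinator alpha D,
     independent_processes S (inverse_subordinator D) &
     forall (t : R) w, 0 <= t ->
       X t w = time_change S (inverse_subordinator D) t w]).

Definition correlation (X Y : T -> R) : R :=
  fine (covariance P X Y) /
  (Num.sqrt (fine (variance P X)) * Num.sqrt (fine (variance P Y))).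

Definition stationary_process X : Prop :=
  forall (n : nat) (t : 'I_n -> R) (h : R) (B : 'I_n -> set R),
    (forall i, 0 <= t i) -> 0 <= h -> (forall i, measurable (B i)) ->
    P (\bigcap_i (X (t i + h) @^-1` B i)) = P (\bigcap_i (X (t i) @^-1` B i)).

Definition long_range_dependent X : Prop :=
  ~ stationary_process X /\
  exists gamma : R, 0 < gamma < 1 /\
    forall s : R, 0 < s -> exists c : R, 0 < c /\
      asymp_equiv (fun t => correlation (X s) (X t))
                  (fun t => c * t `^ (- gamma)).

End processes.

(* Main.v *)
(* The process [X = S (Y_alpha)] has E (X t) = m q t^alpha and second moments
   determined by those of [Y_alpha], because S has linear mean and variance.
   Everything about the inverse stable subordinator Y that is needed follows from
     E Y_u E Y_(r-u) <= E (Y_u Y_r) - E Y_u^2 / 2 <= E Y_u E Y_r    (u <= r),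
   which comes from integrating the expectation of
   [\int_0^(Y_u) (Y_r - z) dz] by Fubini and using the independent stationary
   increments of the stable subordinator, together with the scaling
   Y_t ~ t^alpha Y_1 (in law), obtained from the uniqueness of Laplace transforms.
   Conditioning on D_f, the covariance of [Z = X (D_f)] at s and t is squeezed
   between two quantities with the common limit
     v q E D_s^alpha + m^2 (c / 2) E D_s^(2 alpha) > 0   as t -> oo,
   because D_t^alpha - (D_t - D_s)^alpha tends to 0 dominatedly, whereas
   Var Z_t grows like t^(2 rho) if m <> 0 and like t^rho if m = 0. Hence the
   correlation decays like t^(-rho), respectively t^(-rho / 2). For alpha = 1 the
   hypotheses are contradictory: E D_t is linear in t, so rho would be 1. *)

From HB Require Import structures.
Require Import Defs.
From mathcomp Require Import all_boot all_order all_algebra.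
From mathcomp Require Import all_classical all_reals all_analysis.
From mathcomp Require Import measurable_realfun ring lra.

Import Order.TTheory GRing.Theory Num.Theory.
Import numFieldNormedType.Exports.

Set Implicit Arguments.
Unset Strict Implicit.
Unset Printing Implicit Defensive.

Local Open Scope classical_set_scope.
Local Open Scope ring_scope.

(** * Independence and time changes *)

(** The exact value of E (Y_u Y_r) is an incomplete beta integral; it is never computed. The two
    bounds for it differ by q^2 u^alpha (r^alpha - (r-u)^alpha), and this gap disappears in the
    limit once u and r become D_s and D_t, so a squeeze is enough. The counting processes are
    specified only by their jump rates at 0+, hence even the finiteness of their moments has to be
    derived: truncated moments satisfy a doubling inequality, and halving the time repeatedly
    carries the rates at 0+ to every t. Since [k2 = k1 ^+ 2] is allowed, the leading variance
    coefficient m^2 (c k2 - q^2 k1^2) is positive only because q^2 < c is strict, that is, because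
    Y_1 is not deterministic. Bounded paths of a subordinator, for which the first passage time
    takes a default value, form a null set as soon as [0 < f 1]; for D_f this inequality is
    extracted from the asymptotics of the moments. *)

Section independent_maps.
Context d d1 d2 (T : measurableType d) (T1 : measurableType d1)
  (T2 : measurableType d2) (R : realType) (P : probability T R).
Variables (f1 : T -> T1) (f2 : T -> T2).
Hypotheses (mf1 : measurable_fun setT f1) (mf2 : measurable_fun setT f2).
Hypothesis indep : forall A B, measurable A -> measurable B ->
  P (f1 @^-1` A `&` f2 @^-1` B) = (P (f1 @^-1` A) * P (f2 @^-1` B))%E.

Let X1 : {mfun T >-> T1} := HB.pack f1 (isMeasurableFun.Build _ _ _ _ _ mf1).
Let X2 : {mfun T >-> T2} := HB.pack f2 (isMeasurableFun.Build _ _ _ _ _ mf2).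

Let pairing w := (f1 w, f2 w).

Let mpairing : measurable_fun setT pairing.
Proof. exact: measurable_fun_pair. Qed.

Let X12 : {mfun T >-> (T1 * T2)%type} :=
  HB.pack pairing (isMeasurableFun.Build _ _ _ _ _ mpairing).

(** Independence makes the joint law of (f1, f2) agree with the product of the two laws on
    rectangles, hence everywhere; the rest is Tonelli. *)
Lemma ge0_integral_independent (h : T1 * T2 -> \bar R) :
  measurable_fun setT h -> (forall x, 0 <= h x)%E ->
  (\int[P]_w h (f1 w, f2 w) = \int[P]_w2 \int[P]_w1 h (f1 w1, f2 w2))%E.
Proof.
move=> mh h0.
transitivity (\int[distribution P X12]_z h z)%E.
  by rewrite ge0_integral_distribution.
transitivity (\int[distribution P X1 \x distribution P X2]_z h z)%E.
  apply: eq_measure_integral => A mA _.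
  by apply/esym; exact: product_measure_unique.
rewrite fubini_tonelli2// ge0_integral_distribution//=.
- apply: eq_integral => w _; rewrite /= /fubini_G.
  by rewrite ge0_integral_distribution//; exact: measurableT_comp.
- exact: measurable_fun_fubini_tonelli_G.
- by move=> y; exact: integral_ge0.
Qed.

(** Signed version. Integrability under the joint law passes to the product law because both give
    the same integral of |h|; after Fubini the inner integrals are transported back by positive and
    negative parts. *)
Lemma integral_independent (h : T1 * T2 -> R) :
  measurable_fun setT h ->
  P.-integrable setT (fun w => (h (f1 w, f2 w))%:E) ->
  (\int[P]_w (h (f1 w, f2 w))%:E =
   \int[P]_w2 \int[P]_w1 (h (f1 w1, f2 w2))%:E)%E.
Proof.
move=> mh ih.
have mh' : measurable_fun setT (EFin \o h) by exact/measurable_EFinP.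
transitivity (\int[distribution P X12]_z (h z)%:E)%E.
  by rewrite integral_distribution.
have E A : measurable A -> distribution P X12 A =
    ((distribution P X1) \x (distribution P X2))%E A.
  by move=> mA; apply/esym; exact: product_measure_unique.
have i12 : (distribution P X1 \x distribution P X2)%E.-integrable setT (EFin \o h).
  apply/integrableP; split=> //.
  have <- : (\int[distribution P X12]_x `|(EFin \o h) x| =
      \int[distribution P X1 \x distribution P X2]_x `|(EFin \o h) x|)%E.
    by apply: eq_measure_integral => A mA _; exact: E.
  by have /integrableP[] := integrable_pushforward mpairing mh' ih measurableT.
transitivity (\int[distribution P X1 \x distribution P X2]_z (h z)%:E)%E.
  by apply: eq_measure_integral => A mA _; exact: E.
rewrite -integral21_prod_meas1// /fubini_G.
pose G y := (\int[P]_w1 (h (f1 w1, y))%:E)%E.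
have GE : (fun y => \int[distribution P X1]_x (EFin \o h) (x, y))%E = G.
  apply/funext => y; rewrite /G.
  have mhy : measurable_fun setT (fun x => (EFin \o h) (x, y)).
    exact: (measurableT_comp mh' (measurable_pair2 _)).
  rewrite integralE [RHS]integralE; congr (_ - _)%E.
  - by rewrite ge0_integral_distribution// -?funepos_comp//; exact: measurable_funepos.
  - by rewrite ge0_integral_distribution// -?funeneg_comp//; exact: measurable_funeneg.
have mG : measurable_fun setT G.
  rewrite -GE; exact: (measurable_fubini_G i12).
rewrite GE integralE [RHS]integralE; congr (_ - _)%E.
- by rewrite ge0_integral_distribution// -?funepos_comp//; exact: measurable_funepos.
- by rewrite ge0_integral_distribution// -?funeneg_comp//; exact: measurable_funeneg.
Qed.

Lemma measurable_integral_section (h : T1 * T2 -> R) : measurable_fun setT h ->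
  measurable_fun setT (fun y => \int[P]_w1 (h (f1 w1, y))%:E)%E.
Proof.
move=> mh; pose k (p : T * T2) := (h (f1 p.1, p.2))%:E.
have mk : measurable_fun setT k.
  apply/measurable_EFinP; apply: (measurableT_comp mh).
  by apply: measurable_fun_pair => //; exact: measurableT_comp mf1 measurable_fst.
rewrite (_ : (fun y => _) = (fun y => \int[P]_w1 k^\+ (w1, y) - \int[P]_w1 k^\- (w1, y))%E).
  have mp := measurable_funepos mk; have mn := measurable_funeneg mk.
  have p0 x : (0 <= k^\+ x)%E by exact: funepos_ge0.
  have n0 x : (0 <= k^\- x)%E by exact: funeneg_ge0.
  apply: emeasurable_funB.
    exact: (@measurable_fun_fubini_tonelli_G _ _ _ _ _ P _ mp p0).
  exact: (@measurable_fun_fubini_tonelli_G _ _ _ _ _ P _ mn n0).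
apply/funext => y; rewrite integralE; congr (_ - _)%E.
  have -> : (fun w => (h (f1 w, y))%:E) = k \o (fun w => (w, y)) by [].
  by rewrite funepos_comp.
have -> : (fun w => (h (f1 w, y))%:E) = k \o (fun w => (w, y)) by [].
by rewrite funeneg_comp.
Qed.

End independent_maps.

Section right_continuous_process.
Context d (T : measurableType d) (R : realType).

(** Joint measurability: rounding the time up to a grid gives countably many strips on which the
    process depends on the sample point only, and right continuity makes these approximations
    converge pointwise. The [Num.max] discards the unspecified negative times. *)
Lemma measurable_right_continuous (X : R -> T -> R) :
  (forall t, 0 <= t -> measurable_fun setT (X t)) ->
  (forall w t, 0 <= t -> X u w @[u --> t^'+] --> X t w) ->
  measurable_fun setT (fun p : R * T => X (Num.max p.1 0) p.2).
Proof.
move=> mX cX.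
pose k (n : nat) (x : R) := Num.truncn (n.+1%:R * Num.max x 0).
(* The successor rounds strictly upwards even at grid points, as the limit along [t^'+] only sees
   times larger than t. *)
pose r (n : nat) (x : R) : R := (k n x).+1%:R / n.+1%:R.
have mk n i : measurable [set p : R * T | k n p.1 = i].
  rewrite (_ : [set _ | _] = (fun p : R * T => n.+1%:R * Num.max p.1 0) @^-1`
     `[i%:R, i.+1%:R[%classic); last first.
    apply/seteqP; split => p /=; rewrite in_itv/=.
      by move=> <-; rewrite truncn_le ?truncnS_gt// mulr_ge0// le_max lexx orbT.
    by move=> /truncn_def.
  rewrite -[_ @^-1` _]setTI.
  apply: (measurable_funM (measurable_cst _) _) => //.
  exact: measurable_maxr.
apply: (@measurable_fun_cvg _ _ _ _ (fun n p => X (r n p.1) p.2)) => [n|p _].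
- move=> _ B mB; rewrite setTI.
  rewrite (_ : _ @^-1` B = \bigcup_i ([set p : R * T | k n p.1 = i] `&`
      (fun p : R * T => X (i.+1%:R / n.+1%:R) p.2) @^-1` B)); last first.
    apply/seteqP; split => p /=; first by move=> Bp; exists (k n p.1).
    by move=> [i _ [/= <-]].
  apply: bigcup_measurable => i _; apply: measurableI => //.
  rewrite -[_ @^-1` _]setTI.
  have t0 : 0 <= i.+1%:R / n.+1%:R :> R by rewrite divr_ge0.
  exact: (measurableT_comp (mX _ t0) measurable_snd).
- have m0 : 0 <= Num.max p.1 0 by rewrite le_max lexx orbT.
  have /cvg_at_rightP := cX p.2 _ m0; apply; split.
    move=> n; rewrite /r ltr_pdivlMr// mulrC truncnS_gt//.
  rewrite /r; set m := Num.max _ _ in m0 *.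
  apply/cvgrPdist_lt => e e0; near=> n.
  have lo : m < (k n p.1).+1%:R / n.+1%:R by rewrite ltr_pdivlMr// mulrC truncnS_gt.
  have up : (k n p.1).+1%:R / n.+1%:R <= m + n.+1%:R^-1.
    rewrite -natr1 mulrDl mul1r lerD2r ler_pdivrMr// mulrC.
    by rewrite truncn_le// mulr_ge0.
  have ne : n.+1%:R^-1 < e.
    by near: n; exact: near_infty_natSinv_lt (PosNum e0).
  move: lo up ne; set q := _ / _; set i := _^-1 => lo up ne.
  rewrite ltr_distl; apply/andP; split; lra.
Unshelve. all: end_near. Qed.

End right_continuous_process.

Section time_change.
Context d (T : measurableType d) (R : realType) (P : probability T R).
Implicit Types X D : R -> T -> R.

Definition process_generators X : set (set T) :=
  [set A | exists (t : R) (B : set R), [/\ 0 <= t, measurable B & A = X t @^-1` B]].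

Lemma measurable_process_sigma_algebra X :
  (forall t, 0 <= t -> measurable_fun setT (X t)) ->
  process_sigma_algebra X `<=` measurable.
Proof.
move=> mX; apply: smallest_sub; first exact: sigma_algebra_measurable.
by move=> _ [t [B [t0 mB ->]]]; rewrite -[_ @^-1` _]setTI; exact: mX.
Qed.

Let measurable_generator X t : 0 <= t ->
  measurable_fun (setT : set (g_sigma_algebraType (process_generators X))) (X t).
Proof.
move=> t0 _ B mB; rewrite setTI; apply: sub_sigma_algebra.
by exists t, B.
Qed.

Variables X D : R -> T -> R.
Hypothesis mX : forall t, 0 <= t -> measurable_fun setT (X t).
Hypothesis mD : forall t, 0 <= t -> measurable_fun setT (D t).
Hypothesis cX : forall w t, 0 <= t -> X u w @[u --> t^'+] --> X t w.
Hypothesis D0 : forall t w, 0 <= t -> 0 <= D t w.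

Lemma measurable_time_change t : 0 <= t ->
  measurable_fun setT (time_change X D t).
Proof.
move=> t0; rewrite /time_change.
rewrite (_ : (fun w => _) = (fun p => X (Num.max p.1 0) p.2) \o
   (fun w => (D t w, w))); last first.
  by apply/funext => w /=; rewrite max_l// D0.
apply: measurableT_comp; first exact: measurable_right_continuous.
exact: measurable_fun_pair (mD _) _.
Qed.

Hypothesis XD : independent_processes P X D.

(** Independence of two processes is independence of the two identity maps from T to T equipped with
    the sigma-algebra of each process. In this form the lemmas on independent maps apply to whole
    paths, hence to a random time inserted into a random path. *)
Let T1 := g_sigma_algebraType (process_generators X).
Let T2 := g_sigma_algebraType (process_generators D).

Let m1 : measurable_fun setT (id : T -> T1).
Proof.
by move=> _ A mA; rewrite setTI; exact: (measurable_process_sigma_algebra mX).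
Qed.

Let m2 : measurable_fun setT (id : T -> T2).
Proof.
by move=> _ A mA; rewrite setTI; exact: (measurable_process_sigma_algebra mD).
Qed.

Let mXD t : 0 <= t ->
  measurable_fun setT (fun p : T1 * T2 => X (Num.max (D t p.2) 0) p.1).
Proof.
move=> t0.
apply: (@measurableT_comp _ _ _ _ _ _
  (fun p : R * T1 => X (Num.max p.1 0) p.2) _ (fun p : T1 * T2 => (D t p.2, p.1))).
  apply: (@measurable_right_continuous _ T1) => //; exact: measurable_generator.
apply: measurable_fun_pair => //.
exact: measurableT_comp (measurable_generator _) _.
Qed.

Lemma ge0_integral_time_change (s t : R) (h : R * R -> \bar R) :
  0 <= s -> 0 <= t -> measurable_fun setT h -> (forall x, 0 <= h x)%E ->
  (\int[P]_w h (time_change X D s w, time_change X D t w) =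
   \int[P]_w2 \int[P]_w1 h (X (D s w2) w1, X (D t w2) w1))%E.
Proof.
move=> s0 t0 mh h0.
pose H (p : T1 * T2) :=
  h (X (Num.max (D s p.2) 0) p.1, X (Num.max (D t p.2) 0) p.1).
have mH : measurable_fun setT H.
  by apply: measurableT_comp => //; apply: measurable_fun_pair; exact: mXD.
transitivity (\int[P]_w H (w, w))%E.
  by apply: eq_integral => w _; rewrite /H /= !max_l// D0.
rewrite (@ge0_integral_independent _ _ _ T T1 T2 R P id id m1 m2 XD H mH (fun=> h0 _)).
by apply: eq_integral => w2 _; apply: eq_integral => w1 _; rewrite /H /= !max_l// D0.
Qed.

Lemma integral_time_change (s t : R) (h : R * R -> R) :
  0 <= s -> 0 <= t -> measurable_fun setT h ->
  P.-integrable setT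
    (fun w => (h (time_change X D s w, time_change X D t w))%:E) ->
  (\int[P]_w (h (time_change X D s w, time_change X D t w))%:E =
   \int[P]_w2 \int[P]_w1 (h (X (D s w2) w1, X (D t w2) w1))%:E)%E.
Proof.
move=> s0 t0 mh ih.
pose H (p : T1 * T2) :=
  h (X (Num.max (D s p.2) 0) p.1, X (Num.max (D t p.2) 0) p.1).
have HE w : H (w, w) = h (time_change X D s w, time_change X D t w).
  by rewrite /H /= !max_l// D0.
have mH : measurable_fun setT H.
  by apply: measurableT_comp => //; apply: measurable_fun_pair; exact: mXD.
have iH : P.-integrable setT (fun w => (H (w, w))%:E).
  by apply: eq_integrable ih => //= w _; rewrite HE.
transitivity (\int[P]_w (H (w, w))%:E)%E.
  by apply: eq_integral => w _; rewrite HE.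
rewrite (@integral_independent _ _ _ T T1 T2 R P id id m1 m2 XD H mH iH).
by apply: eq_integral => w2 _; apply: eq_integral => w1 _; rewrite /H/= !max_l// D0.
Qed.

Lemma measurable_time_change_section (s t : R) (h : R * R -> R) :
  0 <= s -> 0 <= t -> measurable_fun setT h ->
  measurable_fun setT
    (fun w2 => \int[P]_w1 (h (X (D s w2) w1, X (D t w2) w1))%:E)%E.
Proof.
move=> s0 t0 mh.
pose H (p : T1 * T2) :=
  h (X (Num.max (D s p.2) 0) p.1, X (Num.max (D t p.2) 0) p.1).
have mH : measurable_fun setT H.
  by apply: measurableT_comp => //; apply: measurable_fun_pair; exact: mXD.
have := measurableT_comp (@measurable_integral_section _ _ _ _ _ _ _ P _ m1 H mH) m2.
congr measurable_fun.
by apply/funext => w2; apply: eq_integral => w1 _; rewrite /H /= !max_l// D0.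
Qed.

End time_change.

(** * Square-integrable variables, equality in law, products of independent variables *)

Section square_integrability.
Context d (T : measurableType d) (R : realType) (P : probability T R).
Implicit Types f g h : T -> R.
Local Notation E f := (\int[P]_w f w)%R.
Local Notation Int f := (P.-integrable setT (EFin \o f)).

Lemma integral_Rintegral f : Int f -> (\int[P]_w (f w)%:E = (E f)%:E)%E.
Proof. by move=> fi; rewrite fineK//; exact: integrable_fin_num. Qed.

Lemma integrable_measurable f : Int f -> measurable_fun setT f.
Proof. by move=> /measurable_int/measurable_EFinP. Qed.

Lemma integrable_dominated f g : measurable_fun setT f -> Int g ->
  (forall w, `|f w| <= g w) -> Int f.
Proof.
move=> mf gi fg; apply: le_integrable gi => //; first exact/measurable_EFinP.
by move=> w _ /=; rewrite lee_fin (le_trans (fg w))// ler_norm.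
Qed.

Lemma bounded_integrable f (c : R) : measurable_fun setT f ->
  (forall w, `|f w| <= c) -> Int f.
Proof.
move=> mf fc; apply: (@integrable_dominated _ (cst c)) => //.
exact: finite_measure_integrable_cst.
Qed.

Lemma ge0_integrable f : measurable_fun setT f -> (forall w, 0 <= f w) ->
  (\int[P]_w (f w)%:E < +oo)%E -> Int f.
Proof.
move=> mf f0 foo; apply/integrableP; split; first exact/measurable_EFinP.
by under eq_integral => w _ do rewrite /= ger0_norm//.
Qed.

Lemma Rintegral_sqr f : E (fun w => f w * f w) = E (fun w => f w ^+ 2).
Proof. by apply: eq_Rintegral => w _; rewrite expr2. Qed.

Lemma Rintegral_probability_cst (c : R) : E (fun=> c) = c.
Proof. rewrite Rintegral_cst//.
by have -> : fine (P setT) = 1; [rewrite probability_setT|rewrite mulr1]. Qed.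

Lemma integrable_cst (c : R) : Int (fun=> c).
Proof. exact: finite_measure_integrable_cst. Qed.

Lemma integrable_addr f g : Int f -> Int g -> Int (fun w => f w + g w).
Proof.
move=> fi gi; have := integrableD measurableT fi gi.
by apply: eq_integrable.
Qed.

Lemma integrable_subr f g : Int f -> Int g -> Int (fun w => f w - g w).
Proof.
move=> fi gi; have := integrableB measurableT fi gi.
by apply: eq_integrable.
Qed.

Lemma integrable_mull c f : Int f -> Int (fun w => c * f w).
Proof.
move=> fi; have := integrableZl measurableT c fi.
by apply: eq_integrable.
Qed.

Lemma Rintegral_ae_eq f g : measurable_fun setT f -> measurable_fun setT g ->
  {ae P, forall w, f w = g w} -> E f = E g.
Proof.
move=> mf mg fg; congr fine; apply: ae_eq_integral => //; try exact/measurable_EFinP.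
by apply: filterS fg => w /= ->.
Qed.

Lemma integrable_ae_eq f g : measurable_fun setT f -> measurable_fun setT g ->
  {ae P, forall w, f w = g w} -> Int g -> Int f.
Proof.
move=> mf mg fg /integrableP[_ gi]; apply/integrableP; split.
  exact/measurable_EFinP.
rewrite (ae_eq_integral (fun w => `|(EFin \o g) w|)%E)//.
- by apply: measurableT_comp => //; exact/measurable_EFinP.
- by apply: measurableT_comp => //; exact/measurable_EFinP.
- by apply: filterS fg => w /= ->.
Qed.

Lemma ae_iff_probability (A B : set T) : measurable A -> measurable B ->
  {ae P, forall w, A w <-> B w} -> P A = P B.
Proof.
move=> mA mB AB.
rewrite -[A]setIT -[B]setIT -!integral_indic//.
apply: ae_eq_integral => //; try exact/measurable_EFinP/measurable_indic.
apply: filterS AB => w /= AB _; rewrite !indicE.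
by have -> : w \in A = (w \in B) by apply/idP/idP; rewrite !inE => /AB.
Qed.

Definition square_integrable f :=
  measurable_fun setT f /\ Int (fun w => f w ^+ 2).

Lemma square_integrable_mul f g : square_integrable f -> square_integrable g ->
  Int (fun w => f w * g w).
Proof.
move=> [mf fi] [mg gi].
apply: (@integrable_dominated _ (fun w => f w ^+ 2 + g w ^+ 2)).
- exact: measurable_funM.
- exact: integrable_addr.
- move=> w; rewrite ler_norml; apply/andP; split.
    by have := sqr_ge0 (f w + g w); have := sqr_ge0 (f w);
      have := sqr_ge0 (g w); rewrite !expr2; lra.
  by have := sqr_ge0 (f w - g w); have := sqr_ge0 (f w);
    have := sqr_ge0 (g w); rewrite !expr2; lra.
Qed.

Lemma square_integrable_integrable f : square_integrable f -> Int f.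
Proof.
move=> fi; have ci : square_integrable (fun=> 1).
  by split => //; exact: integrable_cst.
have := square_integrable_mul fi ci.
by apply: eq_integrable => //= w _; rewrite mulr1.
Qed.

Lemma square_integrableB f g : square_integrable f -> square_integrable g ->
  square_integrable (fun w => f w - g w).
Proof.
move=> fi gi; have [[mf f2] [mg g2]] := (fi, gi); split.
  exact: measurable_funB.
have := integrable_addr (integrable_subr f2 (integrable_mull 2
  (square_integrable_mul fi gi))) g2.
by apply: eq_integrable => //= w _; congr EFin; ring.
Qed.

Lemma ler_Rintegral_sqr f : square_integrable f -> (E f) ^+ 2 <= E (fun w => f w ^+ 2).
Proof.
move=> fi; have [mf f2] := fi; have f1 := square_integrable_integrable fi.
set m := E f.
have : 0 <= E (fun w => f w ^+ 2 - (2 * m) * f w + m ^+ 2).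
  apply: Rintegral_ge0 => w _.
  by rewrite (_ : _ + _ = (f w - m) ^+ 2) ?sqr_ge0//; ring.
rewrite RintegralD//; last 2 first.
- by apply: integrable_subr => //; exact: integrable_mull.
- exact: integrable_cst.
rewrite RintegralB//; last exact: integrable_mull.
rewrite RintegralZl// Rintegral_probability_cst -/m => h.
by rewrite -subr_ge0 (le_trans h)// le_eqVlt; apply/orP; left; apply/eqP; ring.
Qed.

Lemma ae_eq0_Rintegral f : Int f -> (forall w, 0 <= f w) -> E f = 0 ->
  {ae P, forall w, f w = 0}.
Proof.
move=> fi f0 Ef.
have [|+ _] := @ae_eq_integral_abs _ _ _ P setT measurableT (EFin \o f).
  by apply/measurable_EFinP; exact: integrable_measurable.
have -> : (\int[P]_x `|(EFin \o f) x| = 0)%E.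
  rewrite -[RHS](_ : (E f)%:E = 0%E) ?Ef// -Ef -integral_Rintegral//.
  by apply: eq_integral => w _ /=; rewrite ger0_norm.
by move=> /(_ erefl); apply: filterS => w /= /(_ I) [].
Qed.

(** Equality case of the preceding inequality: E (f - E f)^2 = 0. It serves to exclude degenerate
    variances, both for the counting processes and for Y_1. *)
Lemma ae_eq_Rintegral f : square_integrable f ->
  E (fun w => f w ^+ 2) = (E f) ^+ 2 -> {ae P, forall w, f w = E f}.
Proof.
move=> fi h; have [mf f2] := fi; have f1 := square_integrable_integrable fi.
set m := E f.
have i0 : Int (fun w => (f w - m) ^+ 2).
  have := integrable_addr (integrable_subr f2 (integrable_mull (2 * m) f1))
    (integrable_cst (m ^+ 2)).
  by apply: eq_integrable => //= w _; congr EFin; ring.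
have E0 : E (fun w => (f w - m) ^+ 2) = 0.
  transitivity (E (fun w => f w ^+ 2 - (2 * m) * f w + m ^+ 2)).
    by apply: eq_Rintegral => w _; ring.
  rewrite RintegralD//; last 2 first.
  - by apply: integrable_subr => //; exact: integrable_mull.
  - exact: integrable_cst.
  rewrite RintegralB//; last exact: integrable_mull.
  by rewrite RintegralZl// Rintegral_probability_cst -/m h -/m; ring.
have := ae_eq0_Rintegral i0 (fun w => sqr_ge0 _) E0.
by apply: filterS => w /eqP; rewrite sqrf_eq0 subr_eq0 => /eqP.
Qed.

Lemma ge0_integral_equal_law f g (h : R -> \bar R) :
  measurable_fun setT f -> measurable_fun setT g -> measurable_fun setT h ->
  (forall x, 0 <= h x)%E ->
  (forall B, measurable B -> P (f @^-1` B) = P (g @^-1` B)) ->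
  (\int[P]_w h (f w) = \int[P]_w h (g w))%E.
Proof.
move=> mf mg mh h0 fg.
pose f' : {mfun T >-> R} := HB.pack f (isMeasurableFun.Build _ _ _ _ _ mf).
pose g' : {mfun T >-> R} := HB.pack g (isMeasurableFun.Build _ _ _ _ _ mg).
transitivity (\int[distribution P f']_x h x)%E.
  by rewrite ge0_integral_distribution.
transitivity (\int[distribution P g']_x h x)%E.
  by apply: eq_measure_integral => A mA _; exact: fg.
by rewrite ge0_integral_distribution.
Qed.

Lemma integral_equal_law f g (h : R -> R) :
  measurable_fun setT f -> measurable_fun setT g -> measurable_fun setT h ->
  (forall B, measurable B -> P (f @^-1` B) = P (g @^-1` B)) ->
  Int (h \o f) -> Int (h \o g) /\ E (h \o f) = E (h \o g).
Proof.
move=> mf mg mh fg fi.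
have mh' : measurable_fun setT (EFin \o h) by exact/measurable_EFinP.
split.
  apply/integrableP; split; first exact: (measurableT_comp mh' mg).
  have /integrableP[_] := fi.
  rewrite (@ge0_integral_equal_law f g (fun x => `|(EFin \o h) x|)%E)//.
  exact: measurableT_comp.
rewrite /Rintegral; congr fine.
rewrite integralE [RHS]integralE; congr (_ - _)%E.
  rewrite (_ : (fun w => (( h \o f) w)%:E) = (EFin \o h) \o f)//.
  rewrite (_ : (fun w => (( h \o g) w)%:E) = (EFin \o h) \o g)//.
  rewrite (funepos_comp (EFin \o h) f) (funepos_comp (EFin \o h) g) (@ge0_integral_equal_law f g)//.
  exact: measurable_funepos.
rewrite (_ : (fun w => (( h \o f) w)%:E) = (EFin \o h) \o f)//.
rewrite (_ : (fun w => (( h \o g) w)%:E) = (EFin \o h) \o g)//.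
rewrite (funeneg_comp (EFin \o h) f) (funeneg_comp (EFin \o h) g) (@ge0_integral_equal_law f g)//.
exact: measurable_funeneg.
Qed.

Lemma integral_independent_mul f g :
  (forall A B, measurable A -> measurable B ->
    P (f @^-1` A `&` g @^-1` B) = (P (f @^-1` A) * P (g @^-1` B))%E) ->
  Int f -> Int g ->
  Int (fun w => f w * g w) /\ E (fun w => f w * g w) = E f * E g.
Proof.
move=> fg fi gi.
have [mf mg] := (integrable_measurable fi, integrable_measurable gi).
have mx (k : R * R -> R) : measurable_fun setT k ->
    measurable_fun setT (EFin \o k) by move=> ?; exact/measurable_EFinP.
have mM : measurable_fun setT (fun p : R * R => p.1 * p.2).
  exact: measurable_funM.
have ng : Int (fun w => `|g w|) by exact: integrable_norm.
have nf : Int (fun w => `|f w|) by exact: integrable_norm.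
have fgi : Int (fun w => f w * g w).
  apply/integrableP; split; first exact/measurable_EFinP/measurable_funM.
  rewrite (_ : (\int[P]_w _)%E = (\int[P]_w `|f w * g w|%R%:E)%E)//.
  rewrite (ge0_integral_independent mf mg fg (h := fun p => `|p.1 * p.2|%R%:E))//=.
    under eq_integral => w2 _.
      under eq_integral => w1 _ do rewrite normrM mulrC EFinM.
      rewrite integralZl// integral_Rintegral//.
      over.
    rewrite integralZr// integral_Rintegral//.
    exact: ltry.
  by apply: mx; exact: measurableT_comp.
split=> //; apply: EFin_inj.
rewrite -integral_Rintegral//.
rewrite (integral_independent mf mg fg (h := fun p => p.1 * p.2))//=.
under eq_integral => w2 _.
  under eq_integral => w1 _ do rewrite mulrC EFinM.
  rewrite integralZl// integral_Rintegral//.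
  over.
by rewrite integralZr// integral_Rintegral// -EFinM mulrC.
Qed.

(** A limit at +oo is tested along sequences, each handled by the usual theorem. The bound is
    required at every t, not only at large t. *)
Lemma dominated_cvg_pinfty (f : R -> T -> R) g h :
  (forall t, measurable_fun setT (f t)) -> measurable_fun setT g ->
  {ae P, forall w, f t w @[t --> +oo] --> g w} ->
  Int h -> (forall t w, `|f t w| <= h w) ->
  E (f t) @[t --> +oo] --> E g.
Proof.
move=> mf mg fg hi fh.
apply/cvg_pinftyP => u uoo.
have [| | | | |gi _] := @dominated_convergence _ _ _ P setT measurableT
  (fun n w => (f (u n) w)%:E) (EFin \o g) (EFin \o h).
- by move=> n; exact/measurable_EFinP.
- exact/measurable_EFinP.
- apply: filterS fg => w fgw _.
  apply: cvg_EFin; first exact: nearW.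
  by move/cvg_pinftyP: fgw; apply.
- exact: hi.
- by apply: aeW => w n _; rewrite lee_fin.
- rewrite integral_Rintegral// => /fine_cvgP[_].
  by apply: cvg_trans; apply: near_eq_cvg; exact: nearW.
Qed.

End square_integrability.

(** * Moments of counting and Skellam processes *)

Section additive_functions.
Context (R : realType).

(** Iteration gives g t <= 2^n g (t / 2^n), and with h = t / 2^n the majorant 2^n u(h) is t (u(h) /
    h), which tends to t L. Thus an infinitesimal rate controls g at all times. *)
Lemma subdouble_bound (g u : R -> R) (L t : R) :
  (forall h, 0 < h -> g (h + h) <= 2 * g h) ->
  (forall h, 0 < h -> g h <= u h) ->
  u h / h @[h --> 0^'+] --> L -> 0 < t -> g t <= t * L.
Proof.
move=> g2 gu uL t0.
have gn n : g t <= 2 ^+ n * g (t / 2 ^+ n).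
  elim: n => [|n IH]; first by rewrite expr0 mul1r divr1.
  apply: (le_trans IH); rewrite exprSr -mulrA ler_pM2l ?exprn_gt0//.
  have -> : t / 2 ^+ n = t / (2 ^+ n * 2) + t / (2 ^+ n * 2).
    have : 2 ^+ n != 0 :> R by rewrite expf_neq0.
    by move: (2 ^+ n) => q q0; field.
  by apply: g2; rewrite divr_gt0// mulr_gt0// exprn_gt0.
pose h n : R := t / 2 ^+ n.
have h0 n : 0 < h n by rewrite divr_gt0// exprn_gt0.
have hc : h n @[n --> \oo] --> 0.
  rewrite -[0](mulr0 t); apply: cvgM; first exact: cvg_cst.
  under eq_fun do rewrite -exprVn; apply: cvg_expr.
  by rewrite ger0_norm ?invr_ge0// invf_lt1// ltr1n.
move/cvg_at_rightP : uL => /(_ h) uL.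
have {}uL := uL (conj h0 hc).
have c : t * (u (h n) / h n) @[n --> \oo] --> t * L by apply: cvgM => //; exact: cvg_cst.
apply: (cvgr_to_ge c); apply: nearW => n.
apply: (le_trans (gn n)).
have -> : t * (u (h n) / h n) = 2 ^+ n * u (h n).
  rewrite /h; have : 2 ^+ n != 0 :> R by rewrite expf_neq0.
  have := lt0r_neq0 t0.
  move: (2 ^+ n) => q t1 q0; field. by rewrite q0 t1.
by rewrite ler_pM2l ?exprn_gt0//; exact: gu _ (h0 n).
Qed.

(** Nonnegativity makes f monotone, which rules out the wild solutions of Cauchy's equation. *)
Lemma additive_ge0_linear (f : R -> R) :
  (forall t, 0 <= t -> 0 <= f t) ->
  (forall s t, 0 <= s -> 0 <= t -> f (s + t) = f s + f t) ->
  forall t, 0 <= t -> f t = f 1 * t.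
Proof.
move=> f0 fD.
have f00 : f 0 = 0 by have := fD 0 0 (lexx _) (lexx _); rewrite addr0; lra.
have fn t n : 0 <= t -> f (n%:R * t) = n%:R * f t.
  move=> t0; elim: n => [|n IH]; first by rewrite !mul0r f00.
  by rewrite -natr1 !mulrDl !mul1r fD ?mulr_ge0// IH.
have fle s t : 0 <= s -> s <= t -> f s <= f t.
  move=> s0 st; rewrite -(subrKC s t) fD ?subr_ge0//.
  by rewrite lerDl f0 ?subr_ge0.
move=> t t0; apply/eqP; rewrite -subr_eq0; apply: contraT => ft.
have f1 : 0 <= f 1 by exact: f0.
set e := f t - f 1 * t in ft *; have e0 : 0 < `|e| by rewrite normr_gt0.
(* This n makes n |e| exceed f 1, whereas comparing n t with the integers k and k + 1 around it
   gives n |e| <= f 1 for every n. *)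
set n := (Num.truncn (f 1 / `|e|)).+1.
have ne : f 1 < n%:R * `|e| by rewrite -ltr_pdivrMr// truncnS_gt.
suff : n%:R * `|e| <= f 1 by rewrite leNgt ne.
have n0 : 0 <= n%:R * t by rewrite mulr_ge0.
set k := Num.truncn (n%:R * t).
have k1 : n%:R * t < k.+1%:R by exact: truncnS_gt.
have k2 : k%:R <= n%:R * t by rewrite truncn_le.
have a1 : k%:R * f 1 <= n%:R * f t.
  by rewrite -!fn//; apply: fle; rewrite ?mulr1.
have a2 : n%:R * f t <= k.+1%:R * f 1.
  by rewrite -!fn//; apply: fle; rewrite ?mulr1// ltW.
have b1 : k%:R * f 1 <= n%:R * t * f 1 by rewrite ler_wpM2r.
have b2 : n%:R * t * f 1 <= k.+1%:R * f 1 by rewrite ler_wpM2r// ltW.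
rewrite -[n%:R * _](ger0_norm)// ?mulr_ge0//.
have -> : `|n%:R * `|e| | = `|n%:R * e| :> R by rewrite !normrM normr_id.
move: a2 b2; rewrite -natr1 !mulrDl !mul1r => a2 b2.
rewrite ler_norml /e; apply/andP; split; lra.
Qed.

End additive_functions.

Section levy_processes.
Context d (T : measurableType d) (R : realType) (P : probability T R).
Local Notation E f := (\int[P]_w f w)%R.
Local Notation Int f := (P.-integrable setT (EFin \o f)).

Section increments.
Variable X : R -> T -> R.
Hypothesis LX : levy_process P X.

Let mX t : 0 <= t -> measurable_fun setT (X t).
Proof. by move=> t0; exact: levy_measurable LX t t0. Qed.

Lemma levy_measurable_increment (s t : R) : 0 <= s -> 0 <= t ->
  measurable_fun setT (fun w => X t w - X s w).
Proof. by move=> s0 t0; apply: measurable_funB; exact: mX. Qed.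

(** Stationarity speaks of X_h - X_0, and X_0 vanishes only almost surely, so X_0 is removed up to a
    null set. *)
Lemma levy_increment_law (s h : R) B : 0 <= s -> 0 <= h -> measurable B ->
  P ((fun w => X (s + h) w - X s w) @^-1` B) = P (X h @^-1` B).
Proof.
move=> s0 h0 mB.
rewrite [LHS](levy_stationary_increments LX s0 h0 mB).
apply: ae_iff_probability.
- rewrite -[X in measurable X]setTI.
  exact: (levy_measurable_increment (lexx 0) h0).
- by rewrite -[_ @^-1` _]setTI; exact: mX.
- by apply: filterS (levy_start LX) => w /= ->; rewrite subr0.
Qed.

Lemma levy_increment_independent (s h : R) A B : 0 <= s -> 0 <= h ->
  measurable A -> measurable B ->
  P (X s @^-1` A `&` (fun w => X (s + h) w - X s w) @^-1` B) =
  (P (X s @^-1` A) * P ((fun w => X (s + h) w - X s w)%R @^-1` B))%E.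
Proof.
move=> s0 h0 mA mB.
(* The partition 0, s, s + h. Two increments read only these three times; the constant continuation
   keeps the sequence nondecreasing. *)
pose t i : R := if i is i'.+1 then if i' is _.+1 then s + h else s else 0.
have t0 : 0 <= t 0%N by [].
have tS i : t i <= t i.+1.
  by case: i => [|[|i]] //=; rewrite lerDl.
pose C (i : 'I_2) := if i == ord0 then A else B.
have mC i : measurable (C i) by rewrite /C; case: ifP.
have := @levy_independent_increments _ _ _ _ _ LX 2 t t0 tS C mC.
rewrite !big_ord_recl big_ord0 mule1.
have -> : \bigcap_i (fun w => X (t (nat_of_ord i).+1) w - X (t i) w) @^-1` C i =
  ((fun w => X s w - X 0 w) @^-1` A) `&` ((fun w => X (s + h) w - X s w) @^-1` B).
  apply/seteqP; split => [w wC|w [wA wB] i _] /=.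
    by split; [exact: (wC ord0 I)|exact: (wC (lift ord0 ord0) I)].
  by case: i => -[|[|//]] i /=.
move=> /= H.
have mS : measurable (X s @^-1` A) by rewrite -[_ @^-1` _]setTI; exact: mX.
have mS0 : measurable ((fun w => X s w - X 0 w) @^-1` A).
  by rewrite -[_ @^-1` _]setTI; exact: levy_measurable_increment.
have mI : measurable ((fun w => X (s + h) w - X s w) @^-1` B).
  by rewrite -[_ @^-1` _]setTI; apply: levy_measurable_increment => //; exact: addr_ge0.
transitivity (P (((fun w => X s w - X 0 w) @^-1` A) `&`
    ((fun w => X (s + h) w - X s w) @^-1` B))).
  apply: ae_iff_probability; [exact: measurableI|exact: measurableI|].
  by apply: filterS (levy_start LX) => w /= ->; rewrite subr0.
rewrite H; congr (_ * _)%E.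
apply: ae_iff_probability => //.
by apply: filterS (levy_start LX) => w /= ->; rewrite subr0.
Qed.

End increments.

(* The regularity hypothesis [E X t] of linear growth excludes the pathological
   additive functions. *)
Lemma levy_moments (X : R -> T -> R) (K : R) : levy_process P X ->
  (forall t, 0 <= t -> square_integrable P (X t)) ->
  (forall t, 0 <= t -> `|E (X t)| <= K * t) ->
  exists m v : R, 0 <= v /\
    (forall t, 0 <= t -> E (X t) = m * t) /\
    (forall s t, 0 <= s -> s <= t ->
      E (fun w => X s w * X t w) = v * s + m ^+ 2 * s * t).
Proof.
move=> LX X2 XK.
have X1 t : 0 <= t -> Int (X t) by move=> t0; exact: square_integrable_integrable (X2 _ t0).
have mX t : 0 <= t -> measurable_fun setT (X t).
  by move=> t0; exact: levy_measurable LX t t0.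
pose I s h w := X (s + h) w - X s w.
have mI s h : 0 <= s -> 0 <= h -> measurable_fun setT (I s h).
  by move=> s0 h0; apply: (levy_measurable_increment LX) => //; exact: addr_ge0.
have I2 s h : 0 <= s -> 0 <= h -> square_integrable P (I s h).
  by move=> s0 h0; apply: square_integrableB; apply: X2 => //; exact: addr_ge0.
have I1 s h : 0 <= s -> 0 <= h -> Int (I s h).
  by move=> s0 h0; exact: square_integrable_integrable (I2 _ _ s0 h0).
have IE s h : 0 <= s -> 0 <= h -> E (I s h) = E (X h).
  move=> s0 h0; have [_] := @integral_equal_law _ _ _ P (I s h) (X h) id
    (mI _ _ s0 h0) (mX _ h0) (@measurable_id _ _ setT) (fun B mB => levy_increment_law LX s0 h0 mB)
    (I1 _ _ s0 h0).
  by [].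
have mx2 : measurable_fun setT (fun x : R => x ^+ 2) by exact: measurable_funX.
have IE2 s h : 0 <= s -> 0 <= h ->
    E (fun w => I s h w ^+ 2) = E (fun w => X h w ^+ 2).
  move=> s0 h0; have [_] := @integral_equal_law _ _ _ P (I s h) (X h)
    (fun x => x ^+ 2) (mI _ _ s0 h0) (mX _ h0)
    mx2 (fun B mB => levy_increment_law LX s0 h0 mB)
    (I2 _ _ s0 h0).2.
  by [].
have XI s h : 0 <= s -> 0 <= h ->
    E (fun w => X s w * I s h w) = E (X s) * E (X h).
  move=> s0 h0; rewrite -(IE s h)//.
  have [_] := @integral_independent_mul _ _ _ P (X s) (I s h)
    (fun A B mA mB => levy_increment_independent LX s0 h0 mA mB) (X1 _ s0) (I1 _ _ s0 h0).
  by [].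
have ED s h : 0 <= s -> 0 <= h -> E (X (s + h)) = E (X s) + E (X h).
  move=> s0 h0; rewrite -(IE s h)// -RintegralD//; [|exact: X1|exact: I1].
  by apply: eq_Rintegral => w _; rewrite /I subrKC.
pose m := E (X 1).
have mE t : 0 <= t -> E (X t) = m * t.
  (* Adding K t keeps additivity and makes the function nonnegative, as [additive_ge0_linear]
     requires. *)
  pose g t := E (X t) + K * t.
  move=> t0; have := @additive_ge0_linear R g _ _ t t0.
  rewrite /g mulr1 mulrDl => h; apply: (addIr (K * t)); apply: h.
  - by move=> u u0; have := XK _ u0; rewrite ler_norml => /andP[]; lra.
  - by move=> u h u0 h0; rewrite ED//; ring.
have sqD s h : 0 <= s -> 0 <= h -> E (fun w => X (s + h) w ^+ 2) =
    E (fun w => X s w ^+ 2) + E (fun w => X h w ^+ 2) + 2 * (m * s * (m * h)).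
  move=> s0 h0; rewrite -(IE2 s h)// -!mE// -XI//.
  have xi := square_integrable_mul (X2 _ s0) (I2 _ _ s0 h0).
  rewrite -RintegralZl// -RintegralD//; [|exact: (X2 _ s0).2|exact: (I2 _ _ s0 h0).2].
  rewrite -RintegralD//; last 2 first.
  - apply: integrable_addr; [exact: (X2 _ s0).2|exact: (I2 _ _ s0 h0).2].
  - exact: integrable_mull.
  by apply: eq_Rintegral => w _; rewrite /I; ring.
(* The variance: the cross term of [sqD] is exactly that of (m (s + h))^2, so V is additive, and it
   is nonnegative. *)
pose V t := E (fun w => X t w ^+ 2) - (m * t) ^+ 2.
have V0 t : 0 <= t -> 0 <= V t.
  by move=> t0; rewrite subr_ge0 -mE//; exact: ler_Rintegral_sqr (X2 _ t0).
have VE t : 0 <= t -> V t = V 1 * t.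
  apply: additive_ge0_linear => // u h u0 h0.
  by rewrite /V sqD//; ring.
exists m, (V 1); split; first exact: V0.
split=> // s t s0 st.
have h0 : 0 <= t - s by rewrite subr_ge0.
have -> : E (fun w => X s w * X t w) =
    E (fun w => X s w ^+ 2) + E (fun w => X s w * I s (t - s) w).
  rewrite -RintegralD//; [|exact: (X2 _ s0).2|].
    by apply: eq_Rintegral => w _; rewrite /I subrKC; ring.
  exact: square_integrable_mul (X2 _ s0) (I2 _ _ s0 h0).
rewrite XI// !mE//.
have := VE _ s0; rewrite {1}/V => Vs.
have -> : E (fun w => X s w ^+ 2) = V 1 * s + (m * s) ^+ 2.
  by rewrite -Vs; ring.
by ring.
Qed.

End levy_processes.

(** * Finiteness of the moments of a counting process from its jump rates *)

Section generalized_counting_process.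
Context d (T : measurableType d) (R : realType) (P : probability T R).
Local Notation E f := (\int[P]_w f w)%R.
Local Notation Int f := (P.-integrable setT (EFin \o f)).

Lemma minr_le_add (x y z w c : R) :
  0 <= x -> 0 <= y -> 0 <= w -> 0 <= c -> z <= x + y + w ->
  Num.min z c <= Num.min x c + Num.min y c + w.
Proof.
move=> x0 y0 w0 c0 zxy; rewrite ge_min.
have [xc|cx] := leP x c; have [yc|cy] := leP y c; apply/orP; by [left|right; lra].
Qed.

Lemma integrable_sumr n (f : 'I_n -> T -> R) : (forall i, Int (f i)) ->
  Int (fun w => \sum_(i < n) f i w).
Proof.
elim: n f => [|n IH] f fi.
  by apply: eq_integrable (integrable_cst P 0) => //= w _; rewrite big_ord0.
have := integrable_addr (fi ord0) (IH _ (fun i => fi (lift ord0 i))).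
by apply: eq_integrable => //= w _; rewrite big_ord_recl.
Qed.

Lemma Rintegral_sum n (f : 'I_n -> T -> R) : (forall i, Int (f i)) ->
  E (fun w => \sum_(i < n) f i w) = \sum_(i < n) E (f i).
Proof.
elim: n f => [|n IH] f fi.
  by rewrite big_ord0 -[RHS](Rintegral_probability_cst P); apply: eq_Rintegral => w _; rewrite big_ord0.
rewrite big_ord_recl -IH// -RintegralD//; last exact: integrable_sumr.
by apply: eq_Rintegral => w _; rewrite big_ord_recl.
Qed.

Lemma integrable_indicator (A : set T) : measurable A -> Int (\1_A : T -> R).
Proof. by move=> mA; exact: integrable_indic. Qed.

Lemma Rintegral_indicator (A : set T) : measurable A -> E (\1_A : T -> R) = fine (P A).
Proof. by move=> mA; rewrite /Rintegral integral_indic// setIT. Qed.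

(** Monotone convergence. The bound K must not depend on the truncation level; this is how
    integrability is obtained when no moment is known to exist. *)
Lemma integrable_truncations (f : T -> R) (K : R) : measurable_fun setT f ->
  (forall w, 0 <= f w) ->
  (forall n, E (fun w => Num.min (f w) n%:R) <= K) -> Int f /\ E f <= K.
Proof.
move=> mf f0 fK.
have mt n : measurable_fun setT (fun w => Num.min (f w) n%:R).
  by apply: measurable_minr.
have t0 n w : 0 <= Num.min (f w) n%:R by rewrite le_min f0 ler0n.
have ti n : Int (fun w => Num.min (f w) n%:R).
  apply: (@bounded_integrable _ _ _ _ _ n%:R) => // w.
  by rewrite ger0_norm// ge_min lexx orbT.
have c := @cvg_monotone_convergence _ _ _ P setT measurableT
  (fun n w => (Num.min (f w) n%:R)%:E) .
have {}c : (\int[P]_w (Num.min (f w) n%:R)%:E @[n --> \oo] --> \int[P]_w (f w)%:E)%E.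
  have fE w : (f w)%:E = limn (fun n => (Num.min (f w) n%:R)%:E).
    apply/esym/cvg_lim => //; apply: cvg_EFin; first exact: nearW.
    apply: cvg_near_cst; near=> n; rewrite /= min_l//.
    near: n; exact: nbhs_infty_ger.
  under [X in _ --> X]eq_integral => w _ do rewrite fE.
  apply: c.
  - by move=> n; apply/measurable_EFinP; exact: mt.
  - by move=> n w _; rewrite lee_fin.
  - move=> w _ a b ab; rewrite lee_fin le_min !ge_min lexx/=.
    by apply/orP; right; rewrite ler_nat.
have le : (\int[P]_w (f w)%:E <= K%:E)%E.
  rewrite -(cvg_lim _ c)//; apply: lime_le; first by apply/cvg_ex; eexists; exact: c.
  by apply: nearW => n; rewrite integral_Rintegral// lee_fin.
have fi : Int f by apply: ge0_integrable => //; rewrite (le_lt_trans le)// ltry.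
split=> //; by rewrite -lee_fin -integral_Rintegral.
Unshelve. all: end_near. Qed.

Variables (k : nat) (lam : 'I_k -> R) (M : R -> T -> R).
Hypothesis GM : generalized_counting_process P lam M.

Let LM : levy_process P M. Proof. exact: gcp_levy GM. Qed.

Let mM (t : R) : 0 <= t -> measurable_fun setT (M t).
Proof. by move=> t0; exact: levy_measurable LM t t0. Qed.

Let mI (s h : R) : 0 <= s -> 0 <= h ->
  measurable_fun setT (fun w => M (s + h) w - M s w).
Proof.
by move=> s0 h0; apply: (levy_measurable_increment LM) => //; exact: addr_ge0.
Qed.

(** Truncated moments: they are always integrable, so the doubling inequality can be stated before M
    t is known to have any moment. *)
Let trunc (i : nat) (c x : R) := Num.min (`|x| ^+ i) c.

Let mtrunc i c : measurable_fun setT (trunc i c).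
Proof. by apply: measurable_minr => //; apply: measurable_funX; exact: normr_measurable. Qed.

Let trunc_ge0 i c x : 0 <= c -> 0 <= trunc i c x.
Proof. by move=> c0; rewrite le_min c0 exprn_ge0. Qed.

Let trunc_le i c x : trunc i c x <= c.
Proof. by rewrite ge_min lexx orbT. Qed.

Let itrunc i c (f : T -> R) : 0 <= c -> measurable_fun setT f ->
  Int (fun w => trunc i c (f w)).
Proof.
move=> c0 mf; apply: (@bounded_integrable _ _ _ _ _ c).
  exact: measurableT_comp.
by move=> w; rewrite ger0_norm ?trunc_ge0.
Qed.

Let other h := [set w | forall j : nat, (j <= k)%N -> M h w != j%:R].

Let mother h : 0 <= h -> measurable (other h).
Proof.
move=> h0; rewrite (_ : other h = \bigcap_(j in `I_k.+1) (M h @^-1` [set~ j%:R])).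
  apply: bigcap_measurable => [|j _]; first by exists 0%N.
  by rewrite -[_ @^-1` _]setTI; apply: mM => //; exact: measurableC.
apply/seteqP; split => w /= H j; first by move=> jk; apply/eqP; exact: H.
by move=> jk; apply/eqP; exact: H.
Qed.

Let mjump h (j : nat) : 0 <= h -> measurable [set w | M h w = j%:R].
Proof.
by move=> h0; rewrite -[X in measurable X]setTI; exact: (mM h0 measurableT (measurable_set1 _)).
Qed.

(** On the values 1, ..., k the power is at most k^i, and outside 0, ..., k the truncation level c
    is used. The event of the second term has probability o(h), so c disappears from the limit in
    [bound_cvg], which makes the final estimate uniform in c. *)
Let bound (i : nat) (c h : R) := k%:R ^+ i * (\sum_(j < k) fine (P [set w | M h w = j.+1%:R]))
  + c * fine (P (other h)).

Let trunc_bound i c h : (0 < i)%N -> 0 <= c -> 0 <= h ->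
  E (fun w => trunc i c (M h w)) <= bound i c h.
Proof.
move=> i0 c0 h0.
have iS : Int (fun w => \sum_(j < k) \1_[set w | M h w = j.+1%:R] w).
  by apply: integrable_sumr => j; apply: integrable_indicator; exact: mjump.
have iO : Int (\1_(other h) : T -> R) by apply: integrable_indicator; exact: mother.
have -> : bound i c h = E (fun w => k%:R ^+ i * (\sum_(j < k) \1_[set w | M h w = j.+1%:R] w)
    + c * \1_(other h) w).
  rewrite RintegralD//; [|exact: integrable_mull|exact: integrable_mull].
  rewrite !RintegralZl// Rintegral_indicator//; last exact: mother.
  rewrite Rintegral_sum; last by move=> j; apply: integrable_indicator; exact: mjump.
  congr (_ * _ + _); apply: eq_bigr => j _.
  by rewrite Rintegral_indicator//; exact: mjump.
apply: le_Rintegral => //.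
- by apply: itrunc => //; exact: mM.
- by apply: integrable_addr; exact: integrable_mull.
move=> w _.
have S0 : 0 <= \sum_(j < k) \1_[set w | M h w = j.+1%:R] w :> R.
  by apply: sumr_ge0 => j _; rewrite indicE.
have [wo|] := pselect (other h w).
  rewrite indicE mem_set// mulr1.
  by rewrite (le_trans (trunc_le _ _ _))// lerDr mulr_ge0// exprn_ge0.
move=> /existsNP[j /not_implyP[jk /negP]]; rewrite negbK => /eqP Mj.
have o0 : 0 <= c * \1_(other h) w by rewrite mulr_ge0// indicE.
rewrite /trunc Mj ge_min; apply/orP; left; rewrite -[leLHS]addr0 lerD//.
(* At the value 0 the power vanishes because i is positive; no jump term is needed there. *)
case: j jk Mj => [|j] jk Mj; first by rewrite normr0 expr0n (gtn_eqF i0)/= mulr_ge0// exprn_ge0.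
rewrite (bigD1 (Ordinal jk))//= indicE mem_set//= mulrDr mulr1.
rewrite ger0_norm// -[leLHS]addr0 lerD//.
  by rewrite lerXn2r ?nnegrE ?ler0n// ler_nat.
by rewrite mulr_ge0 ?exprn_ge0// sumr_ge0// => l _; rewrite indicE.
Qed.

Let Lam := \sum_(j < k) lam j.

Let bound_cvg i c : bound i c h / h @[h --> 0^'+] --> k%:R ^+ i * Lam.
Proof.
have -> : (fun h => bound i c h / h) = (fun h => k%:R ^+ i *
   (\sum_(j < k) (fine (P [set w | M h w = j.+1%:R]) / h)) + c * (fine (P (other h)) / h)).
  by apply/funext => h; rewrite /bound mulrDl -!mulrA mulr_suml.
rewrite -[X in _ --> X]addr0 -[X in _ --> _ + X](mulr0 c).
apply: cvgD; apply: cvgM; try exact: cvg_cst.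
  apply: cvg_big => //=; first exact: add_continuous.
  by move=> j _; exact: gcp_jump GM j.
exact: gcp_no_other_jump GM.
Qed.

(** By the triangle inequality and the equal laws of both halves, the truncated first moment at time
    2 h is at most twice that at time h. *)
Lemma gcp_integrable t : 0 < t -> Int (M t) /\ E (fun w => `|M t w|) <= t * (k%:R * Lam).
Proof.
move=> t0; have mMt := mM (ltW t0).
have [|||i ti] := @integrable_truncations (fun w => `|M t w|) (t * (k%:R * Lam)).
- exact: measurableT_comp.
- by [].
- move=> n.
  have -> : E (fun w => Num.min `|M t w| n%:R) = E (fun w => trunc 1 n%:R (M t w)) by [].
  apply: (@subdouble_bound _ (fun h => E (fun w => trunc 1 n%:R (M h w))) (bound 1 n%:R)) => //.
  + move=> h h0.
    have hI : E (fun w => trunc 1 n%:R (M (h + h) w - M h w)) =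
        E (fun w => trunc 1 n%:R (M h w)).
      have [_] := @integral_equal_law _ _ _ P _ (M h) (trunc 1 n%:R)
       (mI (ltW h0) (ltW h0)) (mM (ltW h0)) (@mtrunc 1 n%:R)
       (fun B mB => levy_increment_law LM (ltW h0) (ltW h0) mB)
       (itrunc _ (ler0n _ n) (mI (ltW h0) (ltW h0))).
      by [].
    rewrite mulr_natl mulr2n -{2}hI -RintegralD//; last 2 first.
    * by apply: itrunc => //; exact: mM (ltW h0).
    * by apply: itrunc => //; exact: mI (ltW h0) (ltW h0).
    apply: le_Rintegral => //.
    * by apply: itrunc => //; apply: mM; rewrite addr_ge0// ltW.
    * apply: integrable_addr; apply: itrunc => //; first exact: mM (ltW h0).
      exact: mI (ltW h0) (ltW h0).
    move=> w _; rewrite /trunc !expr1.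
    have := ler_normD (M h w) (M (h + h) w - M h w); rewrite subrKC.
    have := normr_ge0 (M h w); have := normr_ge0 (M (h + h) w - M h w).
    have := ler0n R n.
    move: (`|_|) (`|_|) (`|_|) (n%:R) => x y z c c0 x0 y0 zxy.
    by rewrite -[leRHS]addr0; apply: minr_le_add; rewrite ?addr0.
  + by move=> h h0; apply: trunc_bound => //; exact: ltW.
split=> //; apply: (integrable_dominated mMt i) => w; exact: lexx.
Qed.

(** Doubling the time now creates a cross term 2 E|M_h| E|I|, at most 2 K^2 h^2 by independence and
    the first-moment bound. Subtracting K^2 h^2 restores the doubling inequality, since 4 - 2 = 2:
    the correction grows fourfold under doubling. *)
Lemma gcp_square_integrable t : 0 < t -> square_integrable P (M t).
Proof.
move=> t0; have mMt := mM (ltW t0).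
set K := k%:R * Lam.
have [|||i ti] := @integrable_truncations (fun w => `|M t w| ^+ 2)
  (K ^+ 2 * t ^+ 2 + t * (k%:R ^+ 2 * Lam)).
- by apply: measurable_funX; exact: measurableT_comp.
- by move=> w; exact: exprn_ge0.
- move=> n.
  have -> : E (fun w => Num.min (`|M t w| ^+ 2) n%:R) = E (fun w => trunc 2 n%:R (M t w)) by [].
  rewrite -lerBlDl.
  apply: (@subdouble_bound _ (fun h => E (fun w => trunc 2 n%:R (M h w)) - K ^+ 2 * h ^+ 2)
    (bound 2 n%:R)) => //.
  + move=> h h0; set I := fun w => M (h + h) w - M h w.
    have mIh : measurable_fun setT I by exact: mI (ltW h0) (ltW h0).
    have mMh := mM (ltW h0).
    have law := fun B mB => @levy_increment_law _ _ _ _ _ LM h h B (ltW h0) (ltW h0) mB.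
    have hI : E (fun w => trunc 2 n%:R (I w)) = E (fun w => trunc 2 n%:R (M h w)).
      by have [_] := @integral_equal_law _ _ _ P I (M h) (trunc 2 n%:R)
       mIh mMh (@mtrunc 2 n%:R) law (itrunc _ (ler0n _ n) mIh).
    have [Mi MK] := gcp_integrable h0.
    have nMi : Int (fun w => `|M h w|) by exact: integrable_norm.
    have [nIi nIE] : Int (fun w => `|I w|) /\ E (fun w => `|M h w|) = E (fun w => `|I w|).
      have [] := @integral_equal_law _ _ _ P (M h) I (@Num.norm R R) mMh mIh
        (@normr_measurable _ setT) (fun B mB => esym (law B mB)) nMi.
      by [].
    have [iMI EMI] : Int (fun w => `|M h w| * `|I w|) /\
        E (fun w => `|M h w| * `|I w|) = E (fun w => `|M h w|) * E (fun w => `|I w|).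
      apply: integral_independent_mul => // A B mA mB.
      apply: (@levy_increment_independent _ _ _ _ _ LM h h (Num.norm @^-1` A) (Num.norm @^-1` B)
         (ltW h0) (ltW h0)).
        by rewrite -[_ @^-1` _]setTI; exact: normr_measurable.
      by rewrite -[_ @^-1` _]setTI; exact: normr_measurable.
    have MI2 : E (fun w => `|M h w| * `|I w|) <= K ^+ 2 * h ^+ 2.
      have le0 : 0 <= E (fun w => `|M h w|) by exact: Rintegral_ge0.
      have KE : E (fun w => `|M h w|) <= K * h by rewrite mulrC.
      by rewrite EMI -nIE -exprMn -expr2 lerXn2r ?nnegrE// (le_trans le0).
    have i1 : Int (fun w => trunc 2 n%:R (M h w)) by exact: itrunc.
    have i2 : Int (fun w => trunc 2 n%:R (I w)) by exact: itrunc.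
    have le : E (fun w => trunc 2 n%:R (M (h + h) w)) <=
        E (fun w => trunc 2 n%:R (M h w)) + E (fun w => trunc 2 n%:R (I w)) +
        2 * E (fun w => `|M h w| * `|I w|).
      rewrite -RintegralD// -RintegralZl// -RintegralD//; last 2 first.
      * exact: integrable_addr.
      * exact: integrable_mull.
      apply: le_Rintegral => //.
      * by apply: itrunc => //; apply: mM; rewrite addr_ge0// ltW.
      * by apply: integrable_addr; [exact: integrable_addr|exact: integrable_mull].
      move=> w _; rewrite /trunc.
      have := ler_normD (M h w) (I w); rewrite {1}/I subrKC.
      have := normr_ge0 (M h w); have := normr_ge0 (I w); have := normr_ge0 (M (h + h) w).
      have := ler0n R n.
      move: (`|_|) (`|_|) (`|_|) (n%:R) => x y z c c0 z0 y0 x0 zxy.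
      have : z ^+ 2 <= (x + y) ^+ 2 by rewrite lerXn2r ?nnegrE ?addr_ge0.
      rewrite sqrrD mulr2n => zz; have xy : 0 <= x * y by rewrite mulr_ge0.
      have := sqr_ge0 x; have := sqr_ge0 y.
      move: (x ^+ 2) (y ^+ 2) (z ^+ 2) (x * y) zz xy => X Y Z W zz W0 Y0 X0.
      by apply: minr_le_add => //; [rewrite mulr_ge0|lra].
    rewrite hI in le.
    have -> : (h + h) ^+ 2 = 4 * h ^+ 2 by ring.
    move: le MI2; set u := Rintegral _ _ _; set v := Rintegral _ _ _;
      set e := Rintegral _ _ _ => le MI2; lra.
  + move=> h h0; rewrite (le_trans _ (trunc_bound _ _ (ltW h0)))//.
    by rewrite lerBlDr lerDl mulr_ge0// sqr_ge0.
split=> //; apply: eq_integrable i => //= w _.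
by rewrite real_normK// num_real.
Qed.

End generalized_counting_process.

Section skellam.
Context d (T : measurableType d) (R : realType) (P : probability T R).
Local Notation E f := (\int[P]_w f w)%R.
Local Notation Int f := (P.-integrable setT (EFin \o f)).

(* The moments of a process with stationary independent increments, mean [m] and
   variance [v] per unit of time. *)
Definition linear_moments (X : R -> T -> R) (m v : R) : Prop :=
  [/\ forall t, 0 <= t -> square_integrable P (X t),
      forall t, 0 <= t -> E (X t) = m * t &
      forall s t, 0 <= s -> s <= t ->
        E (fun w => X s w * X t w) = v * s + m ^+ 2 * s * t].

Lemma gcp_moments (k : nat) (lam : 'I_k -> R) (M : R -> T -> R) :
  (0 < k)%N -> (forall j, 0 < lam j) ->
  generalized_counting_process P lam M ->
  exists m v : R, 0 < v /\ linear_moments M m v.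
Proof.
move=> k0 lam0 GM; have LM := gcp_levy GM.
have mM t : 0 <= t -> measurable_fun setT (M t).
  by move=> t0; exact: levy_measurable LM t t0.
have M2 t : 0 <= t -> square_integrable P (M t).
  rewrite le_eqVlt => /predU1P[<-|/(gcp_square_integrable GM)//].
  split; first exact: mM.
  apply: (@integrable_ae_eq _ _ _ P _ (fun=> 0)).
  - by apply: measurable_funX; exact: mM.
  - exact: measurable_cst.
  - by apply: filterS (levy_start LM) => w ->; rewrite expr0n.
  - exact: integrable_cst.
have M0 : E (M 0) = 0.
  rewrite -[RHS](Rintegral_probability_cst P); apply: Rintegral_ae_eq.
  - exact: mM.
  - exact: measurable_cst.
  - exact: levy_start LM.
have MK t : 0 <= t -> `|E (M t)| <= k%:R * (\sum_(j < k) lam j) * t.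
  rewrite le_eqVlt => /predU1P[<-|t0]; first by rewrite M0 normr0 mulr0.
  have [Mi Mle] := gcp_integrable GM t0.
  rewrite mulrC (le_trans _ Mle)//.
  exact: le_normr_Rintegral.
have [m [v [v0 [mE vE]]]] := levy_moments LM M2 MK.
exists m, v; split; last by split.
(* If v = 0 then M_t = m t almost surely for each t. Jumps of size 1 have positive rate, so M_h = 1
   has positive probability for all small h, whence m h = 1; two different values of h are
   contradictory. *)
rewrite lt_neqAle v0 andbT; apply/eqP => v00.
have aeM t : 0 <= t -> {ae P, forall w, M t w = m * t}.
  move=> t0; rewrite -mE//; apply: ae_eq_Rintegral; first exact: M2.
  transitivity (E (fun w => M t w * M t w)).
    by apply: eq_Rintegral => w _; rewrite expr2.
  by rewrite vE// mE// -v00; ring.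
have jump t : 0 < t -> (0 < P [set w | M t w = 1%R])%E -> m * t = 1.
  move=> t0; apply: contraPeq => mt.
  have mj : measurable [set w | M t w = 1%R].
    have := mM _ (ltW t0) measurableT [set 1%R] (measurable_set1 _).
    by rewrite setTI.
  rewrite (@ae_iff_probability _ _ _ P _ set0)// ?measure0 ?ltxx//.
  apply: filterS (aeM _ (ltW t0)) => w /= ->; split=> //.
  by move/eqP; rewrite (negPf mt).
have := @gcp_jump _ _ _ _ _ _ _ GM (Ordinal k0) => /=.
move/cvgr_gt => /(_ 0 (lam0 _)) [e /= e0 He].
have pos h : 0 < h -> h < e -> (0 < P [set w | M h w = 1%R])%E.
  move=> h0 he; have := He h; rewrite /ball_ /= sub0r normrN gtr0_norm// => /(_ he h0).
  rewrite pmulr_lgt0 ?invr_gt0// => Ph; rewrite lt0e measure_ge0 andbT.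
  by apply/eqP => P0; move: Ph; rewrite P0 ltxx.
have h2 : m * (e / 2) = 1.
  apply: jump; first by lra.
  by apply: pos; lra.
have h3 : m * (e / 3) = 1.
  apply: jump; first by lra.
  by apply: pos; lra.
nra.
Qed.

Lemma independent_processes_preimage (X Y : R -> T -> R) (s t : R) A B :
  independent_processes P X Y -> 0 <= s -> 0 <= t -> measurable A -> measurable B ->
  P (X s @^-1` A `&` Y t @^-1` B) = (P (X s @^-1` A) * P (Y t @^-1` B))%E.
Proof.
move=> XY s0 t0 mA mB; apply: XY.
- by apply: sub_sigma_algebra; exists s, A.
- by apply: sub_sigma_algebra; exists t, B.
Qed.

(** Means subtract and variances add, since the mixed moments of the independent parts factor. The
    mean m1 - m2 may vanish while v stays positive, which is the source of the two decay rates in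
    the end. *)
Lemma skellam_moments (k : nat) (lam mu : 'I_k -> R) (S : R -> T -> R) :
  (0 < k)%N -> (forall j, 0 < lam j) -> (forall j, 0 < mu j) ->
  generalized_skellam_process P lam mu S ->
  exists m v : R, 0 < v /\ linear_moments S m v.
Proof.
move=> k0 lam0 mu0 [M1 [M2 [G1 G2 M12 SE]]].
have [m1 [v1 [v10 [q1 e1 c1]]]] := gcp_moments k0 lam0 G1.
have [m2 [v2 [v20 [q2 e2 c2]]]] := gcp_moments k0 mu0 G2.
have SE' t : 0 <= t -> S t = (fun w => M1 t w - M2 t w).
  by move=> t0; apply/funext => w; rewrite SE.
have i1 t : 0 <= t -> Int (M1 t) by move=> t0; exact: square_integrable_integrable (q1 _ t0).
have i2 t : 0 <= t -> Int (M2 t) by move=> t0; exact: square_integrable_integrable (q2 _ t0).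
have c12 s t : 0 <= s -> 0 <= t -> E (fun w => M1 s w * M2 t w) = m1 * s * (m2 * t).
  move=> s0 t0; rewrite -e1// -e2//.
  have [] // := @integral_independent_mul _ _ _ P (M1 s) (M2 t) _ (i1 _ s0) (i2 _ t0).
  by move=> A B mA mB; exact: independent_processes_preimage.
exists (m1 - m2), (v1 + v2); split; first exact: addr_gt0.
split.
- by move=> t t0; rewrite SE'//; apply: square_integrableB; [exact: q1|exact: q2].
- move=> t t0; rewrite SE'// RintegralB//; [|exact: i1|exact: i2].
  by rewrite e1// e2//; ring.
- move=> s t s0 st; have t0 := le_trans s0 st; rewrite !SE'//.
  have j1 := square_integrable_mul (q1 _ s0) (q1 _ t0).
  have j2 := square_integrable_mul (q2 _ s0) (q2 _ t0).
  have j3 := square_integrable_mul (q1 _ s0) (q2 _ t0).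
  have j4 := square_integrable_mul (q1 _ t0) (q2 _ s0).
  transitivity (E (fun w => (M1 s w * M1 t w + M2 s w * M2 t w) -
     (M1 s w * M2 t w + M1 t w * M2 s w))).
    by apply: eq_Rintegral => w _; ring.
  rewrite RintegralB//; [|exact: integrable_addr|exact: integrable_addr].
  rewrite !RintegralD// c1// c2// !c12//; ring.
Qed.

Lemma skellam_right_continuous (k : nat) (lam mu : 'I_k -> R) (S : R -> T -> R) :
  generalized_skellam_process P lam mu S ->
  forall w t, 0 <= t -> S u w @[u --> t^'+] --> S t w.
Proof.
move=> [M1 [M2 [G1 G2 M12 SE]]] w t t0; rewrite SE//.
have [c1 _] := levy_cadlag (gcp_levy G1) w.
have [c2 _] := levy_cadlag (gcp_levy G2) w.
apply: (@cvg_trans _ ((fun u => M1 u w - M2 u w) @ t^'+)).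
  by apply: near_eq_cvg; near=> u; rewrite SE//; apply: (le_trans t0); apply: ltW; near: u; exact: nbhs_right_gt.
exact: cvgB (c1 _ t0) (c2 _ t0).
Unshelve. all: end_near. Qed.

End skellam.

(** * The inverse stable subordinator *)

Section tails.
Context d (T : measurableType d) (R : realType) (P : probability T R).
Local Notation E f := (\int[P]_w f w)%R.
Local Notation Int f := (P.-integrable setT (EFin \o f)).
Implicit Types X Y : T -> R.

Lemma measurable_gt X (x : R) : measurable_fun setT X -> measurable [set w | x < X w].
Proof.
move=> mX; have := mX measurableT `]x, +oo[%classic (measurable_itv _).
by rewrite setTI; congr measurable; apply/seteqP; split => w /=; rewrite in_itv/= andbT.
Qed.

Lemma measurable_le X (x : R) : measurable_fun setT X -> measurable [set w | X w <= x].
Proof.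
move=> mX; have := mX measurableT `]-oo, x]%classic (measurable_itv _).
by rewrite setTI; congr measurable; apply/seteqP; split => w /=; rewrite in_itv/=.
Qed.

Lemma measurable_ge X (x : R) : measurable_fun setT X -> measurable [set w | x <= X w].
Proof.
move=> mX; have := mX measurableT `[x, +oo[%classic (measurable_itv _).
by rewrite setTI; congr measurable; apply/seteqP; split => w /=; rewrite in_itv/= andbT.
Qed.

Let ccdfE (X : {mfun T >-> R}) (x : R) : ccdf (X : {RV P >-> R}) x = P [set w | x < X w].
Proof.
rewrite /ccdf /distribution /pushforward; congr (P _).
by apply/seteqP; split => w /=; rewrite in_itv/= andbT.
Qed.

Lemma tail_le X (x : R) (q : \bar R) : measurable_fun setT X ->
  (forall y, x < y -> (P [set w | (y < X w)%R] <= q)%E) -> (P [set w | (x < X w)%R] <= q)%E.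
Proof.
move=> mX XY.
pose X' : {mfun T >-> R} := HB.pack X (isMeasurableFun.Build _ _ _ _ _ mX).
have c := @ccdf_right_continuous _ _ _ P X' x.
rewrite -(ccdfE X').
apply: (cvge_to_le c); near=> y.
rewrite ccdfE; apply: XY; near: y; exact: nbhs_right_gt.
Unshelve. all: end_near. Qed.

(** Tails are right continuous, so comparisons with a gap between the two levels already force
    equality. This allows strict and weak inequalities to be confused in what follows. *)
Lemma tail_eq X Y : measurable_fun setT X -> measurable_fun setT Y ->
  (forall x y, 0 <= x -> x < y -> (P [set w | (y < X w)%R] <= P [set w | (x < Y w)%R])%E) ->
  (forall x y, 0 <= x -> x < y -> (P [set w | (y < Y w)%R] <= P [set w | (x < X w)%R])%E) ->
  forall x, 0 <= x -> P [set w | (x < X w)%R] = P [set w | (x < Y w)%R].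
Proof.
move=> mX mY XY YX x x0; apply/eqP; rewrite eq_le; apply/andP; split.
  by apply: tail_le => // y xy; exact: XY.
by apply: tail_le => // y xy; exact: YX.
Qed.

Lemma ge0_integral_tail_eq X Y : measurable_fun setT X -> measurable_fun setT Y ->
  (forall w, 0 <= X w) -> (forall w, 0 <= Y w) ->
  (forall x, 0 <= x -> P [set w | (x < X w)%R] = P [set w | (x < Y w)%R]) ->
  (\int[P]_w (X w)%:E = \int[P]_w (Y w)%:E)%E.
Proof.
move=> mX mY X0 Y0 XY.
pose X' : {RV P >-> R} := HB.pack X (isMeasurableFun.Build _ _ _ _ _ mX).
pose Y' : {RV P >-> R} := HB.pack Y (isMeasurableFun.Build _ _ _ _ _ mY).
have := @ge0_expectation_ccdf _ _ _ P X' X0.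
have := @ge0_expectation_ccdf _ _ _ P Y' Y0.
rewrite unlock /= => -> ->.
apply: eq_integral => x; rewrite inE/= in_itv/= andbT => x0.
by rewrite !ccdfE XY.
Qed.

Lemma ge0_integral_sqr_tail_eq X Y : measurable_fun setT X -> measurable_fun setT Y ->
  (forall w, 0 <= X w) -> (forall w, 0 <= Y w) ->
  (forall x, 0 <= x -> P [set w | (x < X w)%R] = P [set w | (x < Y w)%R]) ->
  (\int[P]_w (X w ^+ 2)%R%:E = \int[P]_w (Y w ^+ 2)%R%:E)%E.
Proof.
move=> mX mY X0 Y0 XY.
apply: ge0_integral_tail_eq => [||w|w|x x0].
- exact: measurable_funX.
- exact: measurable_funX.
- exact: sqr_ge0.
- exact: sqr_ge0.
have sq (Z : T -> R) : (forall w, 0 <= Z w) ->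
    [set w | x < Z w ^+ 2] = [set w | Num.sqrt x < Z w].
  move=> Z0; apply/seteqP; split => w /=.
    by rewrite -{1}(sqr_sqrtr x0) ltr_pXn2r// ?nnegrE ?sqrtr_ge0.
  by rewrite -{2}(sqr_sqrtr x0) ltr_pXn2r// ?nnegrE ?sqrtr_ge0.
by rewrite !sq// XY.
Qed.

Lemma bernoulli_ge (y : R) n : 0 <= y <= 1 -> 1 - n%:R * y <= (1 - y) ^+ n.
Proof.
move=> /andP[y0 y1]; elim: n => [|n IH]; first by rewrite mul0r subr0.
rewrite exprS.
have h : 0 <= 1 - y by lra.
apply: (le_trans _ (ler_wpM2l h IH)).
rewrite -natr1; have := ler0n R n; move: (n%:R) => N N0; nra.
Qed.

Lemma bernoulli_le (y : R) n : 0 <= y <= 1 -> (1 - y) ^+ n * (1 + n%:R * y) <= 1.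
Proof.
move=> /andP[y0 y1]; elim: n => [|n IH]; first by rewrite mul0r addr0 mulr1.
apply: (le_trans _ IH); rewrite exprSr -mulrA ler_wpM2l//.
  by rewrite exprn_ge0//; lra.
rewrite -natr1; have := ler0n R n; move: (n%:R) => N N0; nra.
Qed.

(* [(1 - x ^ n) ^ 2 ^ n] tends to 1 for [0 <= x < 1/2] and to 0 for
   [1/2 < x <= 1], so that a Laplace transform determines the tails. *)
Lemma laplace_tail_le X Y (u1 u2 : R) :
  measurable_fun setT X -> measurable_fun setT Y ->
  (forall w, 0 <= X w) -> (forall w, 0 <= Y w) ->
  (forall s, 0 < s -> E (fun w => expR (- (s * X w))) = E (fun w => expR (- (s * Y w)))) ->
  0 <= u2 -> u2 < u1 ->
  (P [set w | (u1 <= X w)%R] <= P [set w | (u2 < Y w)%R])%E.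
Proof.
move=> mX mY X0 Y0 L u20 u21.
(* A separating level: s is chosen so that exp (- s u) = 1/2, which turns the threshold 1/2 of the
   polynomials into the level u of X and Y. *)
pose u := (u1 + u2) / 2; have u0 : 0 < u by rewrite /u; lra.
pose s := ln 2 / u.
have s0 : 0 < s by rewrite divr_gt0// ln_gt0// ltr1n.
pose e (Z : T -> R) w := expR (- (s * Z w)).
have me (Z : T -> R) : measurable_fun setT Z -> measurable_fun setT (e Z).
  by move=> mZ; apply: measurableT_comp => //; apply: measurableT_comp => //; exact: measurable_funM.
have e01 (Z : T -> R) w : (forall w, 0 <= Z w) -> 0 <= e Z w <= 1.
  by move=> Z0; rewrite expR_ge0/= -expR0 ler_expR oppr_le0 mulr_ge0// ltW.
have ie (Z : T -> R) (i : nat) : measurable_fun setT Z -> (forall w, 0 <= Z w) -> Int (fun w => e Z w ^+ i).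
  move=> mZ Z0; apply: (@bounded_integrable _ _ _ _ _ 1).
    by apply: measurable_funX; exact: me.
  move=> w; have /andP[a b] := e01 _ w Z0.
  by rewrite ger0_norm ?exprn_ge0// exprn_ile1.
(* The i-th power of exp (- s X) is the Laplace variable at i s, so equal transforms give equal
   expectations to every polynomial in it. *)
have Lpoly (p : {poly R}) : E (fun w => p.[e X w]) = E (fun w => p.[e Y w]).
  have H (Z : T -> R) : measurable_fun setT Z -> (forall w, 0 <= Z w) ->
      E (fun w => p.[e Z w]) = \sum_(i < size p) p`_i * E (fun w => e Z w ^+ i).
    move=> mZ Z0.
    under eq_Rintegral => w _ do rewrite horner_coef.
    rewrite Rintegral_sum; last by move=> i; apply: integrable_mull; exact: ie.
    by apply: eq_bigr => i _; rewrite RintegralZl//; exact: ie.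
  rewrite (H X mX X0) (H Y mY Y0); apply: eq_bigr => i _; congr (_ * _).
  have [i0|i0] := posnP i; first by apply: eq_Rintegral => w _; rewrite i0 !expr0.
  have i1 : 0 < i%:R :> R by rewrite ltr0n.
  have h := L _ (mulr_gt0 i1 s0).
  transitivity (E (fun w => expR (- (i%:R * s * X w)))).
    by apply: eq_Rintegral => w _; rewrite /e -expRM_natl; congr expR; ring.
  by rewrite h; apply: eq_Rintegral => w _; rewrite /e -expRM_natl; congr expR; ring.
pose p n : {poly R} := (1 - 'X^n) ^+ (2 ^ n).
have pE n x : (p n).[x] = (1 - x ^+ n) ^+ (2 ^ n).
  by rewrite /p horner_exp !hornerE.
pose a := 2 * expR (- (s * u1)); pose b := 2 * expR (- (s * u2)).
have su : expR (s * u) = 2 by rewrite /s divfK ?gt_eqF// lnK// posrE.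
have a1 : a < 1.
  rewrite /a -su -expRD -expR0 ltr_expR; have : s * u < s * u1 by rewrite ltr_pM2l// /u; lra.
  lra.
have a0 : 0 <= a by rewrite mulr_ge0// expR_ge0.
have b1 : 1 < b.
  rewrite /b -su -expRD -expR0 ltr_expR; have : s * u2 < s * u by rewrite ltr_pM2l// /u; lra.
  lra.
have mA : measurable [set w | u1 <= X w] by exact: measurable_ge.
have mB : measurable [set w | u2 < Y w] by exact: measurable_gt.
have y01 (Z : T -> R) w n : (forall w, 0 <= Z w) -> 0 <= e Z w ^+ n <= 1.
  move=> Z0; have /andP[c1 c2] := e01 _ w Z0.
  by rewrite exprn_ge0//= exprn_ile1.
have pint (Z : T -> R) n : measurable_fun setT Z -> (forall w, 0 <= Z w) -> Int (fun w => (p n).[e Z w]).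
  move=> mZ Z0; apply: (@bounded_integrable _ _ _ _ _ 1).
    under eq_fun do rewrite pE.
    by apply: measurable_funX; apply: measurable_funB => //; apply: measurable_funX; exact: me.
  move=> w; rewrite pE; have /andP[c1 c2] := y01 _ w n Z0.
  by rewrite ger0_norm ?exprn_ge0 ?exprn_ile1//; lra.
(* With y = exp (- s X)^n, the product 2^n y is at most a^n where u1 <= X, so the first Bernoulli
   bound gives at least 1 - a^n there. With Y in place of X it is at least b^n where Y <= u2, so the
   second bound gives at most 1 / b^n there. As a < 1 < b, both errors vanish. *)
have le n : (1 - a ^+ n) * fine (P [set w | u1 <= X w]) <=
    fine (P [set w | u2 < Y w]) + (b ^+ n)^-1.
  rewrite -!Rintegral_indicator// -(Rintegral_probability_cst P (b ^+ n)^-1).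
  rewrite -RintegralZl//; last exact: integrable_indicator.
  rewrite -RintegralD//; [|exact: integrable_indicator|exact: integrable_cst].
  apply: (@le_trans _ _ (E (fun w => (p n).[e X w]))).
    apply: le_Rintegral => //.
    - by apply: integrable_mull; exact: integrable_indicator.
    - exact: pint.
    move=> w _; rewrite pE indicE; have y1 := y01 _ w n X0.
    have [|_] := boolP (w \in _).
      rewrite inE /= mulr1 => uX; apply: (le_trans _ (bernoulli_ge _ y1)).
      rewrite lerD2l lerN2 natrX -exprMn lerXn2r ?nnegrE//.
        by rewrite mulr_ge0// expR_ge0.
      by rewrite /a ler_pM2l// ler_expR lerN2 ler_pM2l.
    by rewrite mulr0 exprn_ge0//; have /andP[] := y1; lra.
  rewrite Lpoly; apply: le_Rintegral => //.
  - exact: pint.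
  - by apply: integrable_addr; [exact: integrable_indicator|exact: integrable_cst].
  move=> w _; rewrite pE indicE; have y1 := y01 _ w n Y0.
  have bn : 0 < b ^+ n by rewrite exprn_gt0//; lra.
  have [_|] := boolP (w \in _).
    rewrite -[leLHS]addr0 lerD// ?invr_ge0 ?(ltW bn)//.
    by rewrite exprn_ile1//; have /andP[] := y1; lra.
  rewrite notin_setE /= => /negP; rewrite -leNgt => Yu; rewrite add0r.
  rewrite -[leRHS]mul1r ler_pdivlMr//.
  apply: (le_trans _ (bernoulli_le (2 ^ n) y1)); rewrite ler_wpM2l//.
    by rewrite exprn_ge0//; have /andP[] := y1; lra.
  rewrite natrX -exprMn -[leLHS]add0r lerD//.
  rewrite lerXn2r ?nnegrE//; [by lra|by rewrite mulr_ge0// expR_ge0|].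
  by rewrite /b ler_pM2l// ler_expR lerN2 ler_pM2l.
rewrite -(@fineK _ (P [set w | u1 <= X w])) ?fin_num_measure//.
rewrite -(@fineK _ (P [set w | u2 < Y w])) ?fin_num_measure// lee_fin.
have c1 : (1 - a ^+ n) * fine (P [set w | u1 <= X w]) @[n --> \oo] -->
    (1 - 0) * fine (P [set w | u1 <= X w]).
  apply: cvgM; last exact: cvg_cst.
  by apply: cvgB; [exact: cvg_cst|apply: cvg_expr; rewrite ger0_norm].
have c2 : fine (P [set w | u2 < Y w]) + (b ^+ n)^-1 @[n --> \oo] -->
    fine (P [set w | u2 < Y w]) + 0.
  apply: cvgD; first exact: cvg_cst.
  under eq_fun do rewrite -exprVn.
  by apply: cvg_expr; rewrite ger0_norm ?invf_lt1 ?invr_ge0//; lra.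
have := ler_cvg_to c1 c2; rewrite subr0 mul1r addr0; apply.
exact: nearW.
Qed.

End tails.

(** * First passage times of one fixed nondecreasing path *)

Section inverse_function.
Context (R : realType).
Notation mu := (@lebesgue_measure R).
Variable g : R -> R.
Hypothesis g_nd : forall x y, 0 <= x -> x <= y -> g x <= g y.

(** Pathwise form of the inverse: [inverse_subordinator D t w] is convertible to
    [first_passage (D ^~ w) t], so statements about a path apply directly. *)
Definition first_passage (t : R) : R := inf [set x | 0 <= x /\ t < g x].

Let lb t : lbound [set x | 0 <= x /\ t < g x] 0.
Proof. by move=> x [/= ->]. Qed.

Lemma first_passage_empty t : ~ (exists y, 0 <= y /\ t < g y) -> first_passage t = 0.
Proof.
move=> e; rewrite /first_passage (_ : [set _ | _] = set0) ?inf0//.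
by rewrite -subset0 => y ?; apply: e; exists y.
Qed.

Lemma first_passage_ge0 t : 0 <= first_passage t.
Proof.
have [ne|/first_passage_empty->//] := pselect (exists y, 0 <= y /\ t < g y).
by apply: lb_le_inf.
Qed.

Lemma first_passage_le t x : 0 <= x -> t < g x -> first_passage t <= x.
Proof. by move=> x0 tx; apply: ge_inf; [exists 0; exact: lb|split]. Qed.

Lemma first_passage_ge t x : (exists y, 0 <= y /\ t < g y) -> 0 <= x -> g x <= t ->
  x <= first_passage t.
Proof.
move=> ne x0 gx; apply: lb_le_inf => // y [y0 ty].
rewrite leNgt; apply/negP => yx; have := g_nd y0 (ltW yx).
by move=> /(lt_le_trans ty); rewrite ltNge gx.
Qed.

Lemma first_passage_le_mono t u : (exists y, 0 <= y /\ u < g y) -> t <= u ->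
  first_passage t <= first_passage u.
Proof.
move=> ne tu; apply: lb_le_inf => // y [y0 uy].
by apply: first_passage_le => //; exact: le_lt_trans uy.
Qed.

Lemma first_passage_right_continuous t : first_passage u @[u --> t^'+] --> first_passage t.
Proof.
have [ne|e] := pselect (exists y, 0 <= y /\ t < g y); last first.
  rewrite first_passage_empty//; apply: cvg_near_cst; near=> u.
  rewrite first_passage_empty// => -[y [y0 uy]]; apply: e; exists y; split=> //.
  by apply: le_lt_trans uy; near: u; exact: nbhs_right_ge.
apply/cvgrPdist_lt => e e0.
have hi : has_inf [set x | 0 <= x /\ t < g x] by split=> //; exists 0; exact: lb.
have [x [x0 tx] xe] := inf_adherent e0 hi.
near=> u.
have h1 : first_passage u <= x by exact: first_passage_le.
have h2 : first_passage t <= first_passage u by apply: first_passage_le_mono => //; exists x.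
rewrite distrC ger0_norm ?subr_ge0// ltrBlDl.
exact: le_lt_trans h1 xe.
Unshelve. all: end_near. Qed.

(** The value of g at the first passage time may lie on either side of t; the boolean records
    whether the right end point belongs to the interval. *)
Lemma first_passage_itv t x : (exists y, 0 <= y /\ t < g y) -> 0 <= x ->
  x <= first_passage t -> exists b,
  [set z | 0 <= z /\ g (x + z) <= t] =
  [set` Interval (BLeft 0) (BSide b (first_passage t - x))].
Proof.
move=> ne x0 xt; set y := first_passage t in xt *.
have le z : 0 <= z -> g (x + z) <= t -> z <= y - x.
  by move=> z0 gz; rewrite lerBrDl; apply: first_passage_ge => //; exact: addr_ge0.
have lt z : 0 <= z -> z < y - x -> g (x + z) <= t.
  move=> z0; rewrite ltrBrDl => zy; rewrite leNgt; apply/negP => tz.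
  by have := first_passage_le (addr_ge0 x0 z0) tz; rewrite leNgt zy.
have [gy|gy] := leP (g y) t.
  exists false; apply/seteqP; split => z /=; rewrite in_itv/=.
    by move=> [z0 gz]; rewrite z0 le.
  move=> /andP[z0]; rewrite le_eqVlt => /predU1P[->|]; last by move=> /lt ->.
  by rewrite subrKC subr_ge0.
exists true; apply/seteqP; split => z /=; rewrite in_itv/=.
  move=> [z0 gz]; rewrite z0/= lt_neqAle le// andbT; apply/eqP => zy.
  by move: gz; rewrite zy subrKC leNgt gy.
by move=> /andP[z0 zy]; split=> //; exact: lt.
Qed.

Lemma first_passage_measure t x : (exists y, 0 <= y /\ t < g y) -> 0 <= x ->
  x <= first_passage t ->
  mu [set z | 0 <= z /\ g (x + z) <= t] = (first_passage t - x)%:E.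
Proof.
move=> ne x0 xt; have [b ->] := first_passage_itv ne x0 xt.
rewrite lebesgue_measure_itv/= lte_fin.
case: ltP => [_|h]; rewrite ?oppr0 ?adde0//; congr EFin; apply/eqP.
by rewrite eq_le h subr_ge0 xt.
Qed.

(** Valid for every path: if g never exceeds t the sublevel set is a half-line, and [fine +oo = 0]
    agrees with [inf set0 = 0]. Hence measurability of the inverse follows without an exceptional
    set. *)
Lemma first_passage_measure0 t :
  first_passage t = fine (mu [set z | 0 <= z /\ g z <= t]).
Proof.
have [ne|e] := pselect (exists y, 0 <= y /\ t < g y).
  have := first_passage_measure ne (lexx 0) (first_passage_ge0 t).
  by under eq_set do rewrite add0r; move=> ->; rewrite subr0.
rewrite first_passage_empty//.
rewrite (_ : [set _ | _] = `[0, +oo[%classic); first by rewrite lebesgue_measure_itv/= ltry.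
apply/seteqP; split => z /=; rewrite in_itv/= ?andbT; first by case.
move=> z0; split=> //; rewrite leNgt; apply/negP => tz.
by apply: e; exists z.
Qed.

End inverse_function.

Lemma integral_affine_itv (R : realType) (r y : R) : 0 <= y ->
  (\int[lebesgue_measure]_(x in `[0%R, y]) (r - x)%R%:E = (r * y - y ^+ 2 / 2)%R%:E)%E.
Proof.
rewrite le_eqVlt => /predU1P[<-|y0].
  by rewrite set_itv1 integral_set1 expr0n mul0r mulr0 subr0.
pose F : R -> R := (r \*: (id : R -> R)) - (2^-1 \*: (id ^+ 2 : R -> R)).
have FE (x : R) : F x = r * x - x ^+ 2 / 2 by rewrite /F !fctE /= [_ / 2]mulrC.
have dF (x : R) : is_derive x (1 : R) F (r - x).
  apply: is_derive_eq => /=.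
  by rewrite /GRing.scale/= expr1 !mulr1 mulrA mulVf// mul1r.
have cF (x : R) : {for x, continuous F}.
  by apply: differentiable_continuous; apply/derivable1_diffP.
rewrite (@continuous_FTC2 _ (fun x => r - x) F)//.
- by rewrite !FE expr0n mul0r mulr0 subr0 sube0.
- by apply: continuous_subspaceT => x; apply: cvgB; [exact: cvg_cst|exact: cvg_id].
- split.
  + by move=> x _.
  + by apply: cvg_at_right_filter; exact: cF.
  + by apply: cvg_at_left_filter; exact: cF.
- by move=> x _; rewrite derive1E; have [_] := dF x.
Qed.

Section inverse_subordinators.
Context d (T : measurableType d) (R : realType) (P : probability T R).
Local Notation E f := (\int[P]_w f w)%R.
Local Notation Int f := (P.-integrable setT (EFin \o f)).
Notation mu := (@lebesgue_measure R).

(** Markov's inequality for exp (- s X). *)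
Lemma chernoff_le (X : T -> R) (s K : R) : measurable_fun setT X -> (forall w, 0 <= X w) ->
  0 < s -> fine (P [set w | X w <= K]) <= expR (s * K) * E (fun w => expR (- (s * X w))).
Proof.
move=> mX X0 s0; have mA : measurable [set w | X w <= K] by exact: measurable_le.
have ie : Int (fun w => expR (- (s * X w))).
  apply: (@bounded_integrable _ _ _ _ _ 1).
    apply: measurableT_comp => //; apply: measurableT_comp => //.
    exact: measurable_funM.
  move=> w; rewrite ger0_norm ?expR_ge0// -expR0 ler_expR oppr_le0.
  by rewrite mulr_ge0// ltW.
rewrite -Rintegral_indicator// -RintegralZl//; apply: le_Rintegral => //.
- exact: integrable_indicator.
- exact: integrable_mull.
move=> w _; rewrite indicE; have [|_] := boolP (w \in _); last first.
  by rewrite mulr_ge0 ?expR_ge0.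
rewrite inE /= => XK; rewrite -expRD -[leLHS]expR0 ler_expR subr_ge0.
by rewrite ler_pM2l.
Qed.

Variables (f : R -> R) (D : R -> T -> R).
Hypothesis SD : levy_subordinator P f D.

Let LD : levy_process P D. Proof. exact: subordinator_levy SD. Qed.

Let mD (t : R) : 0 <= t -> measurable_fun setT (D t).
Proof. by move=> t0; exact: levy_measurable LD t t0. Qed.

Let D0 (t : R) w : 0 <= t -> 0 <= D t w.
Proof. exact: subordinator_ge0 SD t w. Qed.

Let Dnd w : forall x y : R, 0 <= x -> x <= y -> D x w <= D y w.
Proof. by move=> x y; exact: subordinator_nondecreasing SD x y w. Qed.

Lemma subordinator_laplaceR (s t : R) : 0 < s -> 0 <= t ->
  E (fun w => expR (- (s * D t w))) = expR (- (t * f s)).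
Proof.
by move=> s0 t0; have := subordinator_laplace SD s0 t0; rewrite unlock /Rintegral => ->.
Qed.

(** The Chernoff bound with s = 1 gives P (D_n <= K) <= e^K e^(- n f(1)), which tends to 0;
    countably many levels K suffice. *)
Lemma subordinator_unbounded : 0 < f 1 ->
  {ae P, forall w, forall t, exists x : R, 0 <= x /\ t < D x w}.
Proof.
move=> f10.
have H (K : nat) : {ae P, forall w, exists n : nat, K%:R < D n%:R w}.
  pose N := \bigcap_n [set w | D n%:R w <= K%:R].
  have mN : measurable N.
    by apply: bigcap_measurable => [|n _]; [exists 0%N|apply: measurable_le; exact: mD].
  have PN : P N = 0%E.
    apply/eqP; rewrite eq_le measure_ge0 andbT.
    have c : (expR K%:R * expR (- f 1) ^+ n)%:E @[n --> \oo] --> (0 : R)%:E.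
      apply: cvg_EFin; first exact: nearW.
      rewrite -[X in _ --> X](mulr0 (expR K%:R)).
      apply: cvgM; first exact: cvg_cst.
      by apply: cvg_expr; rewrite ger0_norm ?expR_ge0// expR_lt1 oppr_lt0.
    apply: (cvge_to_ge c); apply: nearW => n.
    apply: (@le_trans _ _ (P [set w | D n%:R w <= K%:R])).
      apply: le_measure; rewrite ?inE//; first by apply: measurable_le; exact: mD.
      by move=> w /(_ n I).
    rewrite -(@fineK _ (P _)) ?fin_num_measure//; last by apply: measurable_le; exact: mD.
    rewrite lee_fin (le_trans (chernoff_le _ (mD (ler0n _ n)) _ ltr01))//.
      by move=> w; exact: D0.
    by rewrite mul1r subordinator_laplaceR// -expRM_natl mulrN.
  exists N; split => // w /= h n _ /=; rewrite leNgt; apply/negP => Kn.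
  by apply: h; exists n.
have {}H := ae_foralln H.
apply: filterS H => w H t.
have [n Hn] := H (Num.truncn t).+1.
exists n%:R; split=> //; apply: lt_trans Hn; exact: truncnS_gt.
Qed.

Let Y := inverse_subordinator D.

Let YE t w : Y t w = first_passage (D ^~ w) t. Proof. by []. Qed.

Lemma inverse_ge0 t w : 0 <= Y t w.
Proof. exact: first_passage_ge0. Qed.

Lemma inverse_right_continuous w t : Y u w @[u --> t^'+] --> Y t w.
Proof. exact: first_passage_right_continuous. Qed.

Let Dc : forall w t, 0 <= t -> D u w @[u --> t^'+] --> D t w.
Proof. by move=> w; have [] := levy_cadlag LD w. Qed.

Let mF : measurable_fun setT (fun p : R * T => D (Num.max p.1 0) p.2).
Proof. exact: measurable_right_continuous. Qed.

(** The region below the inverse process: its section at w has length Y_t (when the path is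
    unbounded), its section at z has probability P (D_z <= t). *)
Let G t : set (R * T) := [set p | 0 <= p.1 /\ D (Num.max p.1 0) p.2 <= t].

Let mG t : measurable (G t).
Proof.
rewrite (_ : G t = [set p | 0 <= p.1] `&` [set p | D (Num.max p.1 0) p.2 <= t]); last by [].
apply: measurableI; last exact: measurable_le.
exact: measurable_ge.
Qed.

Let GE t w : [set z | G t (z, w)] = [set z | 0 <= z /\ D z w <= t].
Proof.
by apply/seteqP; split => z /= [z0]; rewrite /G /= max_l.
Qed.

Lemma measurable_inverse t : measurable_fun setT (Y t).
Proof.
have -> : Y t = fine \o (mu \o ysection (G t)).
  apply/funext => w; rewrite YE first_passage_measure0; last exact: Dnd.
  by rewrite /= -GE; congr (fine (mu _)); apply/seteqP; split => z /=;
    rewrite /ysection/= inE.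
have m1 : measurable_fun setT (@fine R) by exact: fine_measurable.
have m2 := measurable_fun_ysection mu (mG t).
exact: (measurableT_comp m1 m2).
Qed.

Let pG t z := P [set w | G t (z, w)].

Let mpG t : measurable_fun setT (pG t).
Proof.
have := @measurable_fun_xsection _ _ _ _ _ P (G t) (mG t).
congr measurable_fun; apply/funext => z /=; rewrite /pG; congr (P _).
by apply/seteqP; split => w; rewrite /xsection/= inE.
Qed.

Let mGw t z : measurable [set w | G t (z, w)].
Proof.
have := measurable_xsection z (mG t); congr measurable.
by apply/seteqP; split => w; rewrite /xsection/= inE.
Qed.

Let mGz t w : measurable [set z | G t (z, w)].
Proof.
have := measurable_ysection w (mG t); congr measurable.
by apply/seteqP; split => z; rewrite /ysection/= inE.
Qed.

(** The renewal (potential) function of the subordinator, which turns out to be E Y_t. It stays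
    extended-real until [renewal_lty] shows that it is finite. *)
Definition renewal t := (\int[mu]_z pG t z)%E.

Hypothesis f1_gt0 : 0 < f 1.

Let ne := subordinator_unbounded f1_gt0.

Let intGw t z : (\int[P]_w (\1_(G t) (z, w) : R)%:E = pG t z)%E.
Proof.
by rewrite /pG -[X in P X]setIT -integral_indic.
Qed.

Let intGz t w : (\int[mu]_z (\1_(G t) (z, w) : R)%:E = mu [set z | G t (z, w)])%E.
Proof.
rewrite -[X in _ = mu X]setIT -integral_indic//; first exact: mGz.
Qed.

Lemma inverse_renewal t : (\int[P]_w (Y t w)%:E = renewal t)%E.
Proof.
have mI : measurable_fun setT (fun p : R * T => (\1_(G t) p : R)%:E).
  by apply/measurable_EFinP; exact: measurable_indic.
transitivity (\int[mu]_z \int[P]_w (\1_(G t) (z, w) : R)%:E)%E; last first.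
  by apply: eq_integral => z _; rewrite intGw.
have I0 p : (0 <= (\1_(G t) p : R)%:E)%E by rewrite lee_fin.
transitivity (\int[P]_w \int[mu]_z (\1_(G t) (z, w) : R)%:E)%E; last first.
  apply: esym; exact: (@fubini_tonelli _ _ _ _ _ mu P (fun p => (\1_(G t) p : R)%:E) mI I0).
apply: ae_eq_integral => //.
- by apply/measurable_EFinP; exact: measurable_inverse.
- exact: (@measurable_fun_fubini_tonelli_G _ _ _ _ _ mu (fun p => (\1_(G t) p : R)%:E) mI I0).
apply: filterS ne => w new _.
rewrite intGz GE.
have := first_passage_measure (@Dnd w) (new t) (lexx 0) (first_passage_ge0 _ _).
by under eq_set do rewrite add0r; move=> ->; rewrite subr0.
Qed.

(* Fubini's theorem for the indicator of [G3], the triples (z, w, y) with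
   [D z w <= u] and [D (z + y) w <= r], computes the expectation of the integral of
   [Y r - z] for z in [0, Y u]. *)
Section second_moments.
Variables u r : R.
Hypothesis ur : u <= r.

Let G3 : set ((R * T) * R) :=
  [set q | [/\ G u q.1, 0 <= q.2 & G r (q.1.1 + q.2, q.1.2)]].

Let mG3 : measurable G3.
Proof.
rewrite (_ : G3 = (fst @^-1` G u `&` [set q | 0 <= q.2]) `&`
    ((fun q : (R * T) * R => (q.1.1 + q.2, q.1.2)) @^-1` G r)); last first.
  by apply/seteqP; split => q /= [] //; case.
apply: measurableI; first apply: measurableI.
- by rewrite -[X in measurable X]setTI; exact: measurable_fst.
- exact: (measurable_ge 0 measurable_snd).
- rewrite -[X in measurable X]setTI.
  have m : measurable_fun setT (fun q : (R * T) * R => (q.1.1 + q.2, q.1.2)).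
    apply: measurable_fun_pair; last exact: measurableT_comp measurable_snd measurable_fst.
    apply: measurable_funD => //.
    exact: measurableT_comp measurable_fst measurable_fst.
  exact: m.
Qed.

Let h3 q : \bar R := (\1_G3 q : R)%:E.

Let h30 q : (0 <= h3 q)%E. Proof. by rewrite lee_fin. Qed.

Let mh3 : measurable_fun setT h3.
Proof. by apply/measurable_EFinP; exact: measurable_indic. Qed.

Let W p : \bar R := (\int[mu]_y h3 (p, y))%E.

Let mW : measurable_fun setT W.
Proof. exact: (@measurable_fun_fubini_tonelli_F _ _ _ _ _ mu h3 mh3 h30). Qed.

Let W0 p : (0 <= W p)%E. Proof. exact: integral_ge0. Qed.

Let G30 p : ~ G u p -> forall y, h3 (p, y) = 0%E.
Proof.
by move=> Gp y; rewrite /h3 indicE memNset// => -[].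
Qed.

Let WE z w : (forall t, exists x : R, 0 <= x /\ t < D x w) -> G u (z, w) ->
  W (z, w) = (Y r w - z)%:E.
Proof.
move=> new Gz; have [/= z0] := Gz; rewrite max_l// => Dz.
have zY : z <= Y r w.
  apply: (@le_trans _ _ (Y u w)).
    by apply: first_passage_ge => //; exact: Dnd.
  by apply: first_passage_le_mono => //; exact: Dnd.
rewrite YE -(first_passage_measure (@Dnd w) (new r) z0)//.
transitivity (\int[mu]_y (\1_[set y | 0 <= y /\ D (z + y) w <= r] y : R)%:E)%E.
  apply: eq_integral => y _; rewrite /h3 !indicE; congr ((nat_of_bool _)%:R%:E).
  apply/idP/idP; rewrite !inE.
    by move=> [_ y0 [/= zy]]; rewrite max_l.
  move=> [y0 Dzy]; split => //; split => /=; first exact: addr_ge0.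
  by rewrite max_l// addr_ge0.
have [b Sb] := first_passage_itv (@Dnd w) (new r) z0 zY.
by rewrite integral_indic//= ?setIT// Sb.
Qed.

Let W_integral w : (forall t, exists x : R, 0 <= x /\ t < D x w) ->
  (\int[mu]_z W (z, w) = (Y u w * Y r w - Y u w ^+ 2 / 2)%R%:E)%E.
Proof.
move=> new.
transitivity (\int[mu]_(z in [set z | G u (z, w)]) (Y r w - z)%R%:E)%E.
  rewrite [RHS]integral_mkcond; apply: eq_integral => z _.
  rewrite patchE; have [|] := boolP (z \in _); rewrite ?inE ?notin_setE /= => Gz.
    exact: WE.
  by rewrite /W integral0_eq// => y _; exact: G30.
rewrite GE.
have [b] := first_passage_itv (@Dnd w) (new u) (lexx 0) (first_passage_ge0 _ _).
under eq_set do rewrite add0r.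
rewrite subr0 -/(Y u w) => ->.
rewrite [Y u w * _]mulrC -integral_affine_itv ?inverse_ge0//.
case: b => //; rewrite integral_itv_bndo_bndc//.
by apply/measurable_EFinP; apply: measurable_funB.
Qed.

Let pG3 z y := P [set w | G3 ((z, w), y)].

Let mG3w z y : measurable [set w | G3 ((z, w), y)].
Proof.
have m : measurable_fun setT (fun w : T => ((z, w), y) : (R * T) * R).
  by apply: measurable_fun_pair => //; exact: measurable_fun_pair.
by have := m measurableT _ mG3; rewrite setTI.
Qed.

Lemma inverse_pair_integral :
  (\int[P]_w (Y u w * Y r w - Y u w ^+ 2 / 2)%R%:E = \int[mu]_z \int[mu]_y pG3 z y)%E.
Proof.
transitivity (\int[P]_w \int[mu]_z W (z, w))%E.
  apply: ae_eq_integral => //.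
  - apply/measurable_EFinP; apply: measurable_funB.
      by apply: measurable_funM; exact: measurable_inverse.
    by apply: measurable_funM => //; apply: measurable_funX; exact: measurable_inverse.
  - exact: (@measurable_fun_fubini_tonelli_G _ _ _ _ _ mu W mW W0).
  - by apply: filterS ne => w new _; rewrite W_integral.
rewrite -(@fubini_tonelli _ _ _ _ _ mu P W mW W0).
apply: eq_integral => z _.
pose k (p : T * R) := h3 ((z, p.1), p.2).
have mk : measurable_fun setT k.
  apply: (measurableT_comp mh3); apply: measurable_fun_pair => //.
  exact: measurable_fun_pair.
have k0 p : (0 <= k p)%E by exact: h30.
transitivity (\int[mu]_y \int[P]_w k (w, y))%E.
  exact: (@fubini_tonelli _ _ _ _ _ P mu k mk k0).
apply: eq_integral => y _.
by rewrite /pG3 -[X in P X]setIT -integral_indic.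
Qed.

Let pG_lt0 (t z : R) : z < 0 -> pG t z = 0%E.
Proof.
move=> z0; rewrite /pG (_ : [set _ | _] = set0) ?measure0//.
by rewrite -subset0 => w [/= ]; rewrite leNgt z0.
Qed.

Let pGE (t z : R) : 0 <= z -> pG t z = P (D z @^-1` `]-oo, t]).
Proof.
move=> z0; rewrite /pG; congr (P _); apply/seteqP; split => w /=; rewrite in_itv/=.
  by move=> [_ /=]; rewrite max_l.
by move=> Dz; split => //=; rewrite max_l.
Qed.

(** Given D_z <= u, the condition D_(z+y) <= r holds if the increment over y is at most r - u, and
    implies that the increment is at most r because D_z >= 0. The increment is independent of D_z
    and has the law of D_y. *)
Let pG3_bounds (z y : R) : (pG u z * pG (r - u)%R y <= pG3 z y <= pG u z * pG r y)%E.
Proof.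
have [z0|z0] := ltP z 0.
  rewrite !(pG_lt0 _ z0) !mul0e /pG3 (_ : [set _ | _] = set0) ?measure0 ?lexx//.
  by rewrite -subset0 => w [] [/= ]; rewrite leNgt z0.
have [y0|y0] := ltP y 0.
  rewrite !(pG_lt0 _ y0) !mule0 /pG3 (_ : [set _ | _] = set0) ?measure0 ?lexx//.
  by rewrite -subset0 => w [] _ /= ; rewrite leNgt y0.
pose I w := D (z + y) w - D z w.
have zy : 0 <= z + y by exact: addr_ge0.
have ind t : (pG u z * pG t y = P (D z @^-1` `]-oo, u]%classic `&` I @^-1` `]-oo, t]%classic))%E.
  rewrite (levy_increment_independent LD z0 y0)// (levy_increment_law LD z0 y0)//.
  by rewrite !pGE.
have mI : measurable_fun setT I by apply: (levy_measurable_increment LD).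
have mB t : measurable (D z @^-1` `]-oo, u]%classic `&` I @^-1` `]-oo, t]%classic).
  apply: measurableI; rewrite -[X in measurable X]setTI; first exact: mD.
  exact: mI.
apply/andP; split; rewrite ind; apply: le_measure; rewrite ?inE//.
- move=> w /=; rewrite !in_itv/= /I => -[Dz Iy]; split => //=.
    by split => //=; rewrite max_l.
  split => //=; rewrite max_l//.
  by rewrite -(subrKC (D z w) (D (z + y) w)) -(subrKC u r) lerD.
- move=> w [[/= _ Dz] _ [/= _]]; rewrite !max_l// in Dz *.
  rewrite !in_itv/= /I => Dzy; split => //.
  by rewrite lerBlDr (le_trans Dzy)// lerDl D0.
Qed.

Let mpG3 z : measurable_fun setT (pG3 z).
Proof.
pose k (p : T * R) := h3 ((z, p.1), p.2).
have mk : measurable_fun setT k.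
  apply: (measurableT_comp mh3); apply: measurable_fun_pair => //.
  exact: measurable_fun_pair.
have k0 p : (0 <= k p)%E by exact: h30.
have := @measurable_fun_fubini_tonelli_G _ _ _ _ _ P k mk k0.
congr measurable_fun; apply/funext => y.
by rewrite /fubini_G /pG3 -[X in P X]setIT -integral_indic.
Qed.

Let mpG3' : measurable_fun setT (fun z => \int[mu]_y pG3 z y)%E.
Proof.
have mh3' : measurable_fun setT (fun q : (R * R) * T => h3 ((q.1.1, q.2), q.1.2)).
  apply: (measurableT_comp mh3); apply: measurable_fun_pair => //.
    apply: measurable_fun_pair => //.
    exact: measurableT_comp measurable_fst measurable_fst.
  exact: measurableT_comp measurable_snd measurable_fst.
have k0 (q : (R * R) * T) : (0 <= h3 ((q.1.1, q.2), q.1.2))%E by exact: h30.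
have m1 := @measurable_fun_fubini_tonelli_F _ _ _ _ _ P _ mh3' k0.
have k1 p : (0 <= fubini_F P (fun q : (R * R) * T => h3 ((q.1.1, q.2), q.1.2)) p)%E.
  exact: integral_ge0.
have := @measurable_fun_fubini_tonelli_F _ _ _ _ _ mu _ m1 k1.
congr measurable_fun; apply/funext => z; rewrite /fubini_F; apply: eq_integral => y _ /=.
by rewrite /pG3 -[X in P X]setIT -integral_indic.
Qed.

Let prod_integral t : (\int[mu]_z \int[mu]_y (pG u z * pG t y) = renewal u * renewal t)%E.
Proof.
transitivity (\int[mu]_z (pG u z * renewal t))%E.
  by apply: eq_integral => z _; rewrite ge0_integralZl//; exact: mpG.
by rewrite ge0_integralZr//; [exact: mpG|exact: integral_ge0].
Qed.

Lemma inverse_pair_bounds :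
  (renewal u * renewal (r - u)%R <=
   \int[P]_w (Y u w * Y r w - Y u w ^+ 2 / 2)%R%:E <= renewal u * renewal r)%E.
Proof.
rewrite inverse_pair_integral -!prod_integral.
have pG30 z y : (0 <= pG3 z y)%E by exact: measure_ge0.
have m t z : measurable_fun setT (fun y => pG u z * pG t y)%E.
  exact: measurable_funeM.
have m' t : measurable_fun setT (fun z => \int[mu]_y (pG u z * pG t y))%E.
  rewrite (_ : (fun _ => _) = fun z => pG u z * renewal t)%E.
    by apply: emeasurable_funM => //; exact: measurable_cst.
  by apply/funext => z; rewrite ge0_integralZl//; exact: mpG.
have nn t z : (0 <= \int[mu]_y (pG u z * pG t y))%E.
  by apply: integral_ge0 => y _; exact: mule_ge0.
have nn3 z : (0 <= \int[mu]_y pG3 z y)%E by exact: integral_ge0.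
have nnm t z y : (0 <= pG u z * pG t y)%E by exact: mule_ge0.
apply/andP; split; apply: ge0_le_integral.
- by [].
- by move=> z _; exact: nn.
- exact: m'.
- exact: mpG3'.
- move=> z _; apply: ge0_le_integral.
  + by [].
  + by move=> y _; exact: nnm.
  + exact: m.
  + exact: mpG3.
  + by move=> y _; have /andP[] := pG3_bounds z y.
- by [].
- by move=> z _; exact: nn3.
- exact: mpG3'.
- exact: m'.
- move=> z _; apply: ge0_le_integral.
  + by [].
  + by move=> y _; exact: pG30.
  + exact: mpG3.
  + exact: m.
  + by move=> y _; have /andP[] := pG3_bounds z y.
Qed.

End second_moments.

Lemma renewal_lty t : (renewal t < +oo)%E.
Proof.
(* The Chernoff majorant e^t e^(- z f(1)) of P (D_z <= t), written as a multiple of an exponential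
   density, whose integral is known to be 1. *)
pose k z := expR t / f 1 * exponential_pdf (f 1) z.
have k0 z : 0 <= k z.
  by rewrite mulr_ge0 ?exponential_pdf_ge0 ?divr_ge0 ?expR_ge0// ltW.
have mk : measurable_fun setT k.
  by apply: measurable_funM => //; exact: measurable_exponential_pdf.
apply: (@le_lt_trans _ _ (\int[mu]_z (k z)%:E)%E).
  apply: ge0_le_integral => //.
  - exact: mpG.
  - exact/measurable_EFinP.
  - move=> z _; have [z0|z0] := ltP z 0.
      rewrite /pG (_ : [set _ | _] = set0) ?measure0 ?lee_fin//.
      by rewrite -subset0 => w [/= ]; rewrite leNgt z0.
    have -> : pG t z = P [set w | D z w <= t].
      by rewrite /pG; congr (P _); apply/seteqP; split => w; rewrite /G /= max_l// => -[].
    have mz := mD z0.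
    rewrite -(@fineK _ (P _)) ?fin_num_measure//; last exact: measurable_le.
    rewrite lee_fin (le_trans (chernoff_le t mz (fun w => D0 w z0) ltr01))//.
    rewrite mul1r subordinator_laplaceR// /k /exponential_pdf patchE mem_set; last first.
      by rewrite /= in_itv/= z0.
    rewrite mulrA divfK ?gt_eqF// ler_pM2l ?expR_gt0// ler_expR mulNr mulrC.
    exact: lexx.
under eq_integral do rewrite /k EFinM.
rewrite ge0_integralZl//.
- by rewrite integral_exponential_pdf// mule1 ltry.
- by apply/measurable_EFinP; exact: measurable_exponential_pdf.
- by move=> z _; rewrite lee_fin exponential_pdf_ge0// ltW.
- by rewrite lee_fin divr_ge0// ?expR_ge0// ltW.
Qed.

Lemma inverse_integrable t : Int (Y t).
Proof.
apply: ge0_integrable; [exact: measurable_inverse|exact: inverse_ge0|].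
by rewrite inverse_renewal renewal_lty.
Qed.

Let renewalE t : renewal t = (E (Y t))%:E.
Proof. by rewrite -inverse_renewal integral_Rintegral//; exact: inverse_integrable. Qed.

(** For u = r = t the integrand of the pair bounds is Y_t^2 / 2, so the second moment is at most
    twice the square of the finite mean. *)
Lemma inverse_square_integrable t : square_integrable P (Y t).
Proof.
split; first exact: measurable_inverse.
have mY2 : measurable_fun setT (fun w => Y t w ^+ 2 / 2).
  by apply: measurable_funM => //; apply: measurable_funX; exact: measurable_inverse.
have i2 : Int (fun w => Y t w ^+ 2 / 2).
  apply: ge0_integrable => //; first by move=> w; rewrite divr_ge0// sqr_ge0.
  have /andP[_] := inverse_pair_bounds (lexx t).
  rewrite !renewalE -EFinM => h; apply: le_lt_trans (le_lt_trans h (ltry _)).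
  rewrite le_eqVlt; apply/orP; left; apply/eqP; apply: eq_integral => w _.
  by congr EFin; field.
have := integrable_mull 2 i2; apply: eq_integrable => //= w _.
by congr EFin; field.
Qed.

Lemma inverse_moment_bounds u r : u <= r ->
  E (Y u) * E (Y (r - u)) <= E (fun w => Y u w * Y r w) - E (fun w => Y u w ^+ 2) / 2
  <= E (Y u) * E (Y r).
Proof.
move=> ur.
have i1 := square_integrable_mul (inverse_square_integrable u) (inverse_square_integrable r).
have [mY i2] := inverse_square_integrable u.
have i2' : Int (fun w => Y u w ^+ 2 / 2).
  have := integrable_mull 2^-1 i2; apply: eq_integrable => //= w _.
  by rewrite mulrC.
have := inverse_pair_bounds ur.
rewrite (@integral_Rintegral _ _ _ _ (fun w => Y u w * Y r w - Y u w ^+ 2 / 2)); last first.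
  exact: integrable_subr.
rewrite RintegralB// (_ : E (fun w => _ / 2) = E (fun w => Y u w ^+ 2) / 2); last first.
  by rewrite -RintegralZr.
by rewrite !renewalE -!EFinM !lee_fin.
Qed.

End inverse_subordinators.

(** * Self-similarity and moments in the stable case *)

Section inverse_stable.
Context d (T : measurableType d) (R : realType) (P : probability T R).
Local Notation E f := (\int[P]_w f w)%R.
Local Notation Int f := (P.-integrable setT (EFin \o f)).
Variables (alpha : R) (D : R -> T -> R).
Hypothesis alpha01 : 0 < alpha < 1.
Hypothesis SD : stable_subordinator P alpha D.

Let a0 : 0 < alpha. Proof. by have /andP[] := alpha01. Qed.

Let Y := inverse_subordinator D.

Let f1 : 0 < (fun s : R => s `^ alpha) 1. Proof. by rewrite /= powR1. Qed.

Let mD (t : R) : 0 <= t -> measurable_fun setT (D t).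
Proof. by move=> t0; exact: levy_measurable (subordinator_levy SD) t t0. Qed.

Let D0 (t : R) w : 0 <= t -> 0 <= D t w.
Proof. exact: subordinator_ge0 SD t w. Qed.

Let Dnd w : forall x y : R, 0 <= x -> x <= y -> D x w <= D y w.
Proof. by move=> x y; exact: subordinator_nondecreasing SD x y w. Qed.

Let mY t : measurable_fun setT (Y t).
Proof. exact: measurable_inverse SD t. Qed.

Let Y0 t w : 0 <= Y t w. Proof. exact: inverse_ge0. Qed.

Let ne := subordinator_unbounded SD f1.

(** Both D_x and u D_(x / u^alpha) have Laplace transform exp (- x s^alpha). *)
Lemma stable_scaling (u x : R) : 0 < u -> 0 <= x ->
  P [set w | D x w <= u] = P [set w | D (x / u `^ alpha) w <= 1].
Proof.
move=> u0 x0; have ua : 0 < u `^ alpha by exact: powR_gt0.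
have xu : 0 <= x / u `^ alpha by rewrite divr_ge0// ltW.
pose X w := u * D (x / u `^ alpha) w.
have mX : measurable_fun setT X by apply: measurable_funM => //; exact: mD.
have X0 w : 0 <= X w by rewrite mulr_ge0// ?D0// ltW.
have L s : 0 < s -> E (fun w => expR (- (s * D x w))) = E (fun w => expR (- (s * X w))).
  move=> s0; rewrite (subordinator_laplaceR SD)//.
  transitivity (E (fun w => expR (- ((s * u) * D (x / u `^ alpha) w)))); last first.
    by apply: eq_Rintegral => w _; rewrite /X mulrA.
  rewrite (subordinator_laplaceR SD (mulr_gt0 s0 u0) xu) powRM ?ltW//.
  by congr (expR (- _)); field; rewrite gt_eqF.
have tail v : 0 <= v -> P [set w | (v < D x w)%R] = P [set w | (v < X w)%R].
  apply: tail_eq => //; first exact: mD.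
    move=> p q p0 pq; apply: (@le_trans _ _ (P [set w | q <= D x w])).
      by apply: le_measure; rewrite ?inE; [exact: measurable_gt (mD x0)|
        exact: measurable_ge (mD x0)|move=> w /=; exact: ltW].
    by apply: (laplace_tail_le (mD x0) mX) => // w; exact: D0.
  move=> p q p0 pq; apply: (@le_trans _ _ (P [set w | q <= X w])).
    by apply: le_measure; rewrite ?inE; [exact: measurable_gt|
      exact: measurable_ge|move=> w /=; exact: ltW].
  apply: (laplace_tail_le mX (mD x0) X0 (fun w => D0 w x0) _ p0 pq) => s s0.
  by rewrite L.
have compl (Z : T -> R) v : [set w | Z w <= v] = ~` [set w | v < Z w].
  by apply/seteqP; split => w /=; rewrite ltNge; [move=> ->|move/negP; rewrite negbK].
rewrite compl [in RHS]compl !probability_setC; [|exact: measurable_gt (mD xu)|exact: measurable_gt (mD x0)].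
rewrite tail ?ltW//; congr (_ - P _)%E; apply/seteqP; split => w /=.
  by rewrite /X -{1}[u]mulr1 ltr_pM2l.
by rewrite /X -{2}[u]mulr1 ltr_pM2l.
Qed.

(** Together with [Y_ge] this places P (D_x <= t) between the strict and the weak tail of Y_t at x.
    The boundary case is never resolved: [tail_eq] absorbs it. *)
Let Y_gt (t x : R) : 0 <= x -> (P [set w | (x < Y t w)%R] <= P [set w | (D x w <= t)%R])%E.
Proof.
move=> x0; apply: le_measure; rewrite ?inE.
- exact: measurable_gt.
- exact: measurable_le (mD x0).
- move=> w /= xY; rewrite leNgt; apply/negP => tD.
  have : Y t w <= x := @first_passage_le _ (D ^~ w) t x x0 tD.
  by rewrite leNgt xY.
Qed.

Let Y_ge (t x : R) : 0 <= x -> (P [set w | (D x w <= t)%R] <= P [set w | (x <= Y t w)%R])%E.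
Proof.
move=> x0; have mA : measurable [set w | D x w <= t] by exact: measurable_le (mD x0).
have mB : measurable [set w | x <= Y t w] by exact: measurable_ge.
rewrite (@ae_iff_probability _ _ _ P [set w | D x w <= t]
  ([set w | D x w <= t] `&` [set w | x <= Y t w]))//; last 2 first.
- exact: measurableI.
- apply: filterS ne => w new /=; split; last by case.
  by move=> h; split=> //; apply: (@first_passage_ge _ (D ^~ w)) => //; exact: Dnd.
by apply: le_measure; rewrite ?inE//; exact: measurableI.
Qed.

Let Y_tail (t : R) : 0 < t -> forall x, 0 <= x ->
  P [set w | (x < Y t w)%R] = P [set w | (x < t `^ alpha * Y 1 w)%R].
Proof.
move=> t0; have ta : 0 < t `^ alpha by exact: powR_gt0.
have sub (Z : T -> R) p q : measurable_fun setT Z -> p < q ->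
    (P [set w | (q <= Z w)%R] <= P [set w | (p < Z w)%R])%E.
  move=> mZ pq; apply: le_measure; rewrite ?inE; [exact: measurable_ge|exact: measurable_gt|].
  by move=> w /=; exact: lt_le_trans.
have scale (q : R) w : (q <= t `^ alpha * Y 1 w) = (q / t `^ alpha <= Y 1 w).
  by rewrite ler_pdivrMr// mulrC.
have scale' (q : R) w : (q < t `^ alpha * Y 1 w) = (q / t `^ alpha < Y 1 w).
  by rewrite ltr_pdivrMr// mulrC.
apply: tail_eq => //; first exact: measurable_funM.
  move=> p q p0 pq; have q0 : 0 <= q by rewrite (le_trans p0)// ltW.
  apply: (le_trans (Y_gt t q0)); rewrite stable_scaling//.
  have qt : 0 <= q / t `^ alpha by rewrite divr_ge0// ltW.
  apply: (le_trans (Y_ge 1 qt)).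
  rewrite (_ : [set w | q / t `^ alpha <= Y 1 w] = [set w | q <= t `^ alpha * Y 1 w]).
    by apply: sub => //; exact: measurable_funM.
  by apply/seteqP; split => w /=; rewrite scale.
move=> p q p0 pq; have q0 : 0 <= q by rewrite (le_trans p0)// ltW.
have qt : 0 <= q / t `^ alpha by rewrite divr_ge0// ltW.
rewrite (_ : [set w | q < t `^ alpha * Y 1 w] = [set w | q / t `^ alpha < Y 1 w]); last first.
  by apply/seteqP; split => w /=; rewrite scale'.
apply: (le_trans (Y_gt 1 qt)); rewrite -stable_scaling//.
apply: (le_trans (Y_ge t q0)); exact: sub.
Qed.

Let q := E (Y 1).
Let c := E (fun w => Y 1 w ^+ 2).

Let Yi t : Int (Y t). Proof. exact: inverse_integrable SD f1 t. Qed.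
Let Y2 t : square_integrable P (Y t). Proof. exact: inverse_square_integrable SD f1 t. Qed.

Let mean_gt0 (t : R) : 0 < t -> E (Y t) = q * t `^ alpha.
Proof.
move=> t0; have ta : 0 < t `^ alpha by exact: powR_gt0.
transitivity (E (fun w => t `^ alpha * Y 1 w)); last by rewrite RintegralZl// mulrC.
rewrite /Rintegral; congr fine; apply: ge0_integral_tail_eq => //.
- exact: measurable_funM.
- by move=> w; rewrite mulr_ge0// ltW.
- exact: Y_tail.
Qed.

Let sqr_gt0 (t : R) : 0 < t -> E (fun w => Y t w ^+ 2) = c * t `^ (2 * alpha).
Proof.
move=> t0; have ta : 0 < t `^ alpha by exact: powR_gt0.
transitivity (E (fun w => t `^ (2 * alpha) * Y 1 w ^+ 2)); last first.
  by rewrite RintegralZl// 1?mulrC//; exact: (Y2 1).2.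
have E2 : t `^ (2 * alpha) = (t `^ alpha) ^+ 2.
  by rewrite -powR_mulrn ?powR_ge0// -powRrM mulrC.
rewrite /Rintegral; congr fine.
rewrite (ge0_integral_sqr_tail_eq (mY t) _ _ _ (Y_tail t0))//.
- by apply: eq_integral => w _; rewrite E2 exprMn.
- exact: measurable_funM.
- by move=> w; rewrite mulr_ge0// ltW.
Qed.

Let q_ge0 : 0 <= q. Proof. exact: Rintegral_ge0. Qed.

Let mean0 : E (Y 0) = 0.
Proof.
apply/eqP; rewrite eq_le Rintegral_ge0// andbT leNgt; apply/negP => e0.
set e := E (Y 0) in e0.
have q1 : 0 < q + 1 by rewrite ltr_wpDl.
(* Scaling says nothing at time 0. At this positive t the mean of Y_t is q e / (q + 1) < e, whereas
   Y_0 <= Y_t almost surely would give e <= E Y_t. *)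
pose t := (e / (q + 1)) `^ alpha^-1.
have t0 : 0 < t by rewrite powR_gt0 ?divr_gt0.
have ta : t `^ alpha = e / (q + 1).
  by rewrite /t -powRrM mulVf ?gt_eqF// powRr1// divr_ge0// ltW.
have le : e <= E (Y t).
  have mm : measurable_fun setT (fun w => Num.min (Y 0 w) (Y t w)) by exact: measurable_minr.
  rewrite /e (@Rintegral_ae_eq _ _ _ P (Y 0) (fun w => Num.min (Y 0 w) (Y t w)))//.
    apply: le_Rintegral => //; first apply: (integrable_dominated mm (Yi t)).
      by move=> w; rewrite ger0_norm ?ge_min ?lexx ?orbT// le_min !Y0.
    by move=> w _; rewrite ge_min lexx orbT.
  apply: filterS ne => w new; rewrite min_l//.
  by apply: (@first_passage_le_mono _ (D ^~ w)); [exact: new|exact: ltW].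
move: le; rewrite mean_gt0// ta mulrCA -{1}[e]mulr1 ler_pM2l//.
by rewrite ler_pdivlMr// mul1r; lra.
Qed.

Let bounds u r : u <= r ->
  E (Y u) * E (Y (r - u)) <= E (fun w => Y u w * Y r w) - E (fun w => Y u w ^+ 2) / 2
  <= E (Y u) * E (Y r).
Proof. exact: inverse_moment_bounds SD f1 u r. Qed.

Let sqr_le t : E (fun w => Y t w ^+ 2) <= 2 * E (Y t) ^+ 2.
Proof.
have /andP[_] := bounds (lexx t).
have -> : E (fun w => Y t w * Y t w) = E (fun w => Y t w ^+ 2).
  by apply: eq_Rintegral => w _; rewrite expr2.
rewrite -expr2; lra.
Qed.

(** If Y_1 were constant, equal to q, then D_x > 1 almost surely for x = q + 1, so that exp (- x
    s^alpha) <= exp (- s), that is s <= x s^alpha, for every s > 0. As alpha < 1, this fails at the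
    s with s^(1 - alpha) = x + 1. *)
Let variance_gt0 : q ^+ 2 < c.
Proof.
rewrite lt_neqAle (ler_Rintegral_sqr (Y2 1)) andbT; apply/eqP => cq.
have Yq : {ae P, forall w, Y 1 w = q} by apply: ae_eq_Rintegral (Y2 1) _; exact: esym.
pose x := q + 1; have x0 : 0 < x by rewrite ltr_wpDl.
have mx := mD (ltW x0).
have D1 : {ae P, forall w, 1 < D x w}.
  apply: filterS2 ne Yq => w new Yw; rewrite ltNge; apply/negP => Dx.
  have : x <= Y 1 w by apply: (@first_passage_ge _ (D ^~ w)) => //; [exact: Dnd|exact: ltW].
  by rewrite Yw /x; lra.
have sx (s : R) : 0 < s -> s <= x * s `^ alpha.
  move=> s0; rewrite -lerN2 -ler_expR -(subordinator_laplaceR SD s0 (ltW x0)).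
  have me : measurable_fun setT (fun w => expR (- (s * D x w))).
    by apply: measurableT_comp => //; apply: measurableT_comp => //; exact: measurable_funM.
  have mm : measurable_fun setT (fun w => Num.min (expR (- (s * D x w))) (expR (- s))).
    exact: measurable_minr.
  rewrite (@Rintegral_ae_eq _ _ _ P _ (fun w => Num.min (expR (- (s * D x w))) (expR (- s))))//.
    rewrite -[leRHS](Rintegral_probability_cst P); apply: le_Rintegral => //.
    - apply: (@bounded_integrable _ _ _ _ _ (expR (- s))) => // w.
      by rewrite ger0_norm ?ge_min ?lexx ?orbT// le_min !expR_ge0.
    - exact: integrable_cst.
    - by move=> w _; rewrite ge_min lexx orbT.
  apply: filterS D1 => w Dw; rewrite min_l// ler_expR lerN2 -{1}[s]mulr1.
  by rewrite ler_pM2l// ltW.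
have a1 : 0 < 1 - alpha by have /andP[] := alpha01; lra.
pose s := (x + 1) `^ (1 - alpha)^-1.
have x1 : 0 < x + 1 by lra.
have s0 : 0 < s by exact: powR_gt0.
have := sx s s0.
have {1}-> : s = (x + 1) * s `^ alpha.
  have -> : x + 1 = s `^ (1 - alpha).
    by rewrite /s -powRrM mulVf ?gt_eqF// powRr1// ltW.
  by rewrite -powRD ?subrK ?powRr1 ?ltW// (gt_eqF s0) implybT.
by rewrite ler_pM2r ?powR_gt0//; lra.
Qed.

Lemma inverse_stable_moments : exists q c : R, [/\ 0 < q, q ^+ 2 < c,
  forall t, square_integrable P (Y t),
  (forall t, 0 <= t -> E (Y t) = q * t `^ alpha) /\
  (forall t, 0 <= t -> E (fun w => Y t w ^+ 2) = c * t `^ (2 * alpha)) &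
  forall u r, 0 <= u -> u <= r ->
    c / 2 * u `^ (2 * alpha) + q ^+ 2 * (u `^ alpha * (r - u) `^ alpha)
    <= E (fun w => Y u w * Y r w)
    <= c / 2 * u `^ (2 * alpha) + q ^+ 2 * (u `^ alpha * r `^ alpha)].
Proof.
have mean t : 0 <= t -> E (Y t) = q * t `^ alpha.
  rewrite le_eqVlt => /predU1P[<-|]; last exact: mean_gt0.
  by rewrite mean0 powR0 ?gt_eqF// mulr0.
have sqr t : 0 <= t -> E (fun w => Y t w ^+ 2) = c * t `^ (2 * alpha).
  rewrite le_eqVlt => /predU1P[<-|]; last exact: sqr_gt0.
  rewrite powR0 ?mulr0; last by rewrite gt_eqF// mulr_gt0.
  apply/eqP; rewrite eq_le; apply/andP; split.
    by rewrite (le_trans (sqr_le 0))// mean0 expr0n mulr0.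
  by apply: Rintegral_ge0 => w _; exact: sqr_ge0.
exists q, c; split => //.
  (* q = 0 is impossible because q^2 < c <= 2 q^2, the upper bound being the pair bound at u = r =
     1. *)
  rewrite lt_neqAle q_ge0 andbT; apply/eqP => q0.
  have := lt_le_trans variance_gt0 (sqr_le 1).
  by rewrite -/q -q0 expr0n mulr0 ltxx.
move=> u r u0 ur; have := bounds ur.
have r0 := le_trans u0 ur.
rewrite sqr// !mean// ?subr_ge0//.
move=> /andP[h1 h2]; apply/andP; split.
  apply: le_trans (_ : c * u `^ (2 * alpha) / 2 + q * u `^ alpha * (q * (r - u) `^ alpha) <= _); last by lra.
  by rewrite le_eqVlt; apply/orP; left; apply/eqP; ring.
apply: (@le_trans _ _ (c * u `^ (2 * alpha) / 2 + q * u `^ alpha * (q * r `^ alpha))); first by lra.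
by rewrite le_eqVlt; apply/orP; left; apply/eqP; ring.
Qed.

End inverse_stable.

(** * The fractional Skellam process *)

Section time_change_moments.
Context d (T : measurableType d) (R : realType) (P : probability T R).
Local Notation E f := (\int[P]_w f w)%R.
Local Notation Int f := (P.-integrable setT (EFin \o f)).
Variables X D : R -> T -> R.
Hypothesis X2 : forall t, 0 <= t -> square_integrable P (X t).
Hypothesis cX : forall w t, 0 <= t -> X u w @[u --> t^'+] --> X t w.
Hypothesis mD : forall t, 0 <= t -> measurable_fun setT (D t).
Hypothesis D0 : forall t w, 0 <= t -> 0 <= D t w.
Hypothesis XD : independent_processes P X D.
Hypothesis E2 : forall t, 0 <= t -> Int (fun w => E (fun w' => X (D t w) w' ^+ 2)).

Let mX t : 0 <= t -> measurable_fun setT (X t).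
Proof. by move=> t0; have [] := X2 t0. Qed.

Let Z := time_change X D.

Lemma time_change_square_integrable t : 0 <= t -> square_integrable P (Z t).
Proof.
move=> t0; have mZ : measurable_fun setT (Z t) by exact: measurable_time_change.
split=> //; apply: ge0_integrable; [exact: measurable_funX|by move=> w; exact: sqr_ge0|].
have mh : measurable_fun setT (fun p : R * R => (p.1 ^+ 2)%:E).
  by apply/measurable_EFinP; apply: measurable_funX.
have h0 (p : R * R) : (0 <= (p.1 ^+ 2)%:E)%E by rewrite lee_fin sqr_ge0.
rewrite [X in (X < _)%E](@ge0_integral_time_change _ _ _ P X D mX mD cX D0 XD t t _ t0 t0 mh h0).
have [_] := integrableP _ _ _ (E2 t0).
apply: le_lt_trans; rewrite le_eqVlt; apply/orP; left; apply/eqP.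
apply: eq_integral => w _ /=; rewrite ger0_norm; last first.
  by apply: Rintegral_ge0 => w' _; exact: sqr_ge0.
by rewrite integral_Rintegral//; have [] := X2 (D0 w t0).
Qed.

Lemma Rintegral_time_change t : 0 <= t -> E (Z t) = E (fun w => E (X (D t w))).
Proof.
move=> t0; have Zi := square_integrable_integrable (time_change_square_integrable t0).
have mh : measurable_fun setT (fun p : R * R => p.1) by exact: measurable_fst.
rewrite /Rintegral; congr fine.
rewrite (@integral_time_change _ _ _ P X D mX mD cX D0 XD t t (fun p => p.1) t0 t0 mh Zi).
apply: eq_integral => w _ /=; rewrite integral_Rintegral//.
exact: square_integrable_integrable (X2 (D0 w t0)).
Qed.

Let mh : measurable_fun setT (fun p : R * R => p.1 * p.2).
Proof. exact: measurable_funM. Qed.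

Let secE s t : 0 <= s -> 0 <= t ->
  (fun w2 => \int[P]_w1 (X (D s w2) w1 * X (D t w2) w1)%:E)%E =
  EFin \o (fun w => E (fun w' => X (D s w) w' * X (D t w) w')).
Proof.
move=> s0 t0; apply/funext => w /=; rewrite integral_Rintegral//.
exact: square_integrable_mul (X2 (D0 w s0)) (X2 (D0 w t0)).
Qed.

Lemma measurable_time_change_product s t : 0 <= s -> 0 <= t ->
  measurable_fun setT (fun w => E (fun w' => X (D s w) w' * X (D t w) w')).
Proof.
move=> s0 t0; apply/measurable_EFinP; rewrite -secE//.
exact: (@measurable_time_change_section _ _ _ P X D mX mD cX D0 s t (fun p => p.1 * p.2)).
Qed.

Lemma Rintegral_time_change_product s t : 0 <= s -> 0 <= t ->
  E (fun w => Z s w * Z t w) = E (fun w => E (fun w' => X (D s w) w' * X (D t w) w')).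
Proof.
move=> s0 t0.
have Zi := square_integrable_mul (time_change_square_integrable s0) (time_change_square_integrable t0).
rewrite /Rintegral; congr fine.
rewrite (@integral_time_change _ _ _ P X D mX mD cX D0 XD s t (fun p => p.1 * p.2) s0 t0 mh Zi).
by rewrite /= secE.
Qed.

End time_change_moments.

Section fractional_skellam.
Context d (T : measurableType d) (R : realType) (P : probability T R).
Local Notation E f := (\int[P]_w f w)%R.
Local Notation Int f := (P.-integrable setT (EFin \o f)).

Lemma fractional_skellam_moments (k : nat) (lam mu : 'I_k -> R) (alpha : R)
    (S D X : R -> T -> R) :
  (0 < k)%N -> (forall j, 0 < lam j) -> (forall j, 0 < mu j) -> 0 < alpha < 1 ->
  generalized_skellam_process P lam mu S -> stable_subordinator P alpha D ->
  independent_processes P S (inverse_subordinator D) ->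
  (forall t w, 0 <= t -> X t w = time_change S (inverse_subordinator D) t w) ->
  exists m v q c : R, [/\ 0 < v, 0 < q & q ^+ 2 < c] /\
   [/\ forall t, 0 <= t -> square_integrable P (X t),
     forall w t, 0 <= t -> X u w @[u --> t^'+] --> X t w,
     forall t, 0 <= t -> E (X t) = m * (q * t `^ alpha),
     forall t, 0 <= t -> E (fun w => X t w ^+ 2) =
        v * (q * t `^ alpha) + m ^+ 2 * (c * t `^ (2 * alpha)) &
     forall s t, 0 <= s -> s <= t ->
       v * (q * s `^ alpha) + m ^+ 2 * (c / 2 * s `^ (2 * alpha) +
           q ^+ 2 * (s `^ alpha * (t - s) `^ alpha))
       <= E (fun w => X s w * X t w) <=
       v * (q * s `^ alpha) + m ^+ 2 * (c / 2 * s `^ (2 * alpha) +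
           q ^+ 2 * (s `^ alpha * t `^ alpha))].
Proof.
move=> k0 lam0 mu0 alpha01 GS SD SY XE.
have [m [v [v0 [S2 SE SSE]]]] := skellam_moments k0 lam0 mu0 GS.
have cS := skellam_right_continuous GS.
have [q [c [q0 qc Y2 [YE YYE] YY]]] := inverse_stable_moments alpha01 SD.
set Y := inverse_subordinator D in SY XE Y2 YE YYE YY *.
have f1 : 0 < (fun s : R => s `^ alpha) 1 by rewrite /= powR1.
have ne := subordinator_unbounded SD f1.
have mY t : 0 <= t -> measurable_fun setT (Y t) by move=> _; exact: measurable_inverse SD t.
have Y0 t w : 0 <= t -> 0 <= Y t w by move=> _; exact: inverse_ge0.
have Yi t : Int (Y t) by exact: square_integrable_integrable (Y2 t).
(* Stated for both orders because Y_s <= Y_t holds only on unbounded paths, whereas the conditional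
   moment is an expression at every w. *)
have SSmin a b : 0 <= a -> 0 <= b ->
    E (fun w => S a w * S b w) = v * Num.min a b + m ^+ 2 * (a * b).
  move=> a0 b0; case: (leP a b) => ab; first by rewrite SSE// mulrA.
  transitivity (E (fun w => S b w * S a w)).
    by apply: eq_Rintegral => w _; rewrite mulrC.
  by rewrite SSE// ?ltW//; ring.
have SS a : 0 <= a -> E (fun w => S a w ^+ 2) = v * a + m ^+ 2 * a ^+ 2.
  move=> a0; rewrite -Rintegral_sqr.
  by rewrite SSmin// minxx expr2.
have E2 t : 0 <= t -> Int (fun w => E (fun w' => S (Y t w) w' ^+ 2)).
  move=> t0.
  have := integrable_addr (integrable_mull v (Yi t)) (integrable_mull (m ^+ 2) (Y2 t).2).
  by apply: eq_integrable => //= w _; rewrite SS// Y0.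
have XE' t : 0 <= t -> X t = time_change S Y t.
  by move=> t0; apply/funext => w; exact: XE.
have X2 t : 0 <= t -> square_integrable P (X t).
  by move=> t0; rewrite XE'//; exact: time_change_square_integrable.
have EXX s t : 0 <= s -> s <= t -> E (fun w => X s w * X t w) =
    v * (q * s `^ alpha) + m ^+ 2 * E (fun w => Y s w * Y t w).
  move=> s0 st; have t0 := le_trans s0 st; rewrite !XE'//.
  rewrite (Rintegral_time_change_product S2 cS mY Y0 SY E2 s0 t0).
  transitivity (E (fun w => v * Y s w + m ^+ 2 * (Y s w * Y t w))).
    apply: Rintegral_ae_eq.
    - exact: (measurable_time_change_product S2 cS mY Y0 s0 t0).
    - apply: measurable_funD; apply: measurable_funM => //; first exact: mY.
      by apply: measurable_funM; exact: mY.
    - apply: filterS ne => w new; rewrite SSmin ?Y0// min_l//.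
      exact: (@first_passage_le_mono _ (D ^~ w)).
  have YYi := square_integrable_mul (Y2 s) (Y2 t).
  rewrite RintegralD//; [|exact: integrable_mull|exact: integrable_mull].
  by rewrite !RintegralZl// YE.
exists m, v, q, c; split => //; split => //.
- move=> w t t0; rewrite XE//.
  (* S is continuous from the right only, so composing it with Y requires Y to approach its limit
     from above. If the path never exceeds t, then Y_t is the default 0 and the inequality is
     trivial. *)
  have near_ge : \forall u \near t^'+, Y t w <= Y u w.
    have [en|en] := pselect (exists y, 0 <= y /\ t < D y w).
      have [x [x0 tx]] := en.
      near=> u; apply: (@first_passage_le_mono _ (D ^~ w)).
        by exists x; split=> //; near: u; exact: nbhs_right_lt.
      by near: u; exact: nbhs_right_ge.
    near=> u; rewrite /Y /inverse_subordinator -/(first_passage (D ^~ w) t).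
    by rewrite first_passage_empty//; exact: first_passage_ge0.
  have c1 := cvg_at_right_within (cS w (Y t w) (Y0 t w t0)).
  have c2 : Y u w @[u --> t^'+] --> within (fun u => Y t w <= u) (nbhs (Y t w)).
    move=> A /= HA; have H := @inverse_right_continuous _ _ _ D w t _ HA.
    by apply: filterS2 H near_ge => u; apply.
  apply: (@cvg_trans _ ((fun u => S (Y u w) w) @ t^'+)).
    apply: near_eq_cvg; near=> u; rewrite XE//; apply: (le_trans t0).
    by near: u; exact: nbhs_right_ge.
  exact: cvg_comp c2 c1.
- move=> t t0; rewrite XE'// (Rintegral_time_change S2 cS mY Y0 SY E2 t0).
  transitivity (E (fun w => m * Y t w)).
    by apply: eq_Rintegral => w _; rewrite SE ?Y0.
  by rewrite RintegralZl// YE.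
- move=> t t0; rewrite -Rintegral_sqr.
  rewrite EXX// Rintegral_sqr.
  by rewrite YYE.
- move=> s t s0 st; rewrite EXX//; have /andP[h1 h2] := YY s t s0 st.
  by rewrite !lerD2l !ler_wpM2l ?sqr_ge0.
Unshelve. all: end_near. Qed.

End fractional_skellam.

(** * Covariances and long-range dependence *)

Section power_functions.
Context (R : realType).
Implicit Types a b x alpha r : R.

(** Concavity: on [0, b] the power lies above its chord through 0 and b. *)
Lemma powR_slope x b alpha : 0 <= x -> x <= b -> 0 < b -> alpha < 1 -> 0 < alpha ->
  x * b `^ (alpha - 1) <= x `^ alpha.
Proof.
rewrite le_eqVlt => /predU1P[<-|x0] xb b0 a1 a0; first by rewrite mul0r powR_ge0.
have xb1 : 0 < x / b <= 1 by rewrite divr_gt0//= ler_pdivrMr// mul1r.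
have -> : x `^ alpha = (x / b) `^ alpha * b `^ alpha.
  rewrite -powRM ?divfK ?gt_eqF// ltW//; by case/andP: xb1.
have -> : x * b `^ (alpha - 1) = x / b * b `^ alpha.
  by rewrite -(mulr_powRB1 (ltW b0) a0) mulrA divfK ?gt_eqF.
by rewrite ler_wpM2r ?powR_ge0// ger1_powR// ltW.
Qed.

Lemma powR_increment a b alpha : 0 <= a -> a <= b -> 0 < b -> 0 < alpha < 1 ->
  0 <= b `^ alpha - (b - a) `^ alpha <= a * b `^ (alpha - 1).
Proof.
move=> a0' ab b0 /andP[al0 al1]; apply/andP; split.
  rewrite subr_ge0; apply: ge0_ler_powR; rewrite ?nnegrE ?subr_ge0// ?(ltW al0) ?(ltW b0)//.
  by rewrite gerBl.
have h : b - a <= b by rewrite gerBl.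
have ba : 0 <= b - a by rewrite subr_ge0.
have := powR_slope ba h b0 al1 al0.
by rewrite mulrBl (mulr_powRB1 (ltW b0) al0); lra.
Qed.

Lemma cvg_powR_oppr r : 0 < r -> t `^ (- r) @[t --> +oo] --> (0 : R).
Proof.
move=> r0; apply/cvgrPdist_lt => e e0; near=> t.
have t0 : 0 < t by near: t; exact: nbhs_pinfty_gt.
rewrite sub0r normrN ger0_norm ?powR_ge0// powRN invf_plt ?posrE ?powR_gt0//.
have -> : e^-1 = (e^-1 `^ r^-1) `^ r by rewrite -powRrM mulVf ?gt_eqF// powRr1// invr_ge0 ltW.
apply: gt0_ltr_powR => //; rewrite ?nnegrE ?powR_ge0// ?(ltW t0)//.
Unshelve. all: end_near. Qed.

End power_functions.

Section long_range_dependence.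
Context d (T : measurableType d) (R : realType) (P : probability T R).
Local Notation E f := (\int[P]_w f w)%R.
Local Notation Int f := (P.-integrable setT (EFin \o f)).

Lemma covariance_Rintegral (X Y : T -> R) :
  square_integrable P X -> square_integrable P Y ->
  fine (covariance P X Y) = E (fun w => X w * Y w) - E X * E Y.
Proof.
move=> X2 Y2.
have iX := square_integrable_integrable X2.
have iY := square_integrable_integrable Y2.
have iXY := square_integrable_mul X2 Y2.
rewrite covarianceE; [|exact/Lfun1_integrable..].
by rewrite unlock !integral_Rintegral.
Qed.

Definition cov (Z : R -> T -> R) s t := E (fun w => Z s w * Z t w) - E (Z s) * E (Z t).

Lemma correlation_cov (Z : R -> T -> R) s t :
  square_integrable P (Z s) -> square_integrable P (Z t) ->
  correlation P (Z s) (Z t) = cov Z s t / (Num.sqrt (cov Z s s) * Num.sqrt (cov Z t t)).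
Proof.
by move=> Zs Zt; rewrite /correlation /variance !covariance_Rintegral.
Qed.

(** The standard deviation of Z_t is asymptotic to sqrt V t^gamma and the covariance has a positive
    limit, so the exponent does not depend on s. Stationarity would freeze the variance from time 1
    on and force V = 0. *)
Lemma long_range_dependent_of_cov (Z : R -> T -> R) (gamma V : R) :
  (forall t, 0 <= t -> square_integrable P (Z t)) ->
  0 < gamma < 1 -> 0 < V ->
  cov Z t t / t `^ (2 * gamma) @[t --> +oo] --> V ->
  (forall s, 0 < s -> 0 < cov Z s s) ->
  (forall s, 0 < s -> exists c : R, 0 < c /\ cov Z s t @[t --> +oo] --> c) ->
  long_range_dependent P Z.
Proof.
move=> Z2 g01 V0 cV Zs0 Zc; have [g0 g1] := andP g01; split.
  move=> st.
  have law h (B : set R) : 0 <= h -> measurable B -> P (Z (1 + h) @^-1` B) = P (Z 1 @^-1` B).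
    move=> h0 mB.
    have := st 1%N (fun=> 1) h (fun=> B) (fun=> ler01) h0 (fun=> mB).
    rewrite (_ : \bigcap_i _ = Z (1 + h) @^-1` B); last first.
      by apply/seteqP; split => [w /(_ ord0 I)//|w Bw i _].
    rewrite (_ : \bigcap_i _ = Z 1 @^-1` B)//.
    by apply/seteqP; split => [w /(_ ord0 I)//|w Bw i _].
  have cst t : 1 <= t -> cov Z t t = cov Z 1 1.
    move=> t1; have t0 : 0 <= t by rewrite (le_trans _ t1).
    have [mt it] := Z2 t t0; have [m1 i1] := Z2 1 ler01.
    have lt B : measurable B -> P (Z t @^-1` B) = P (Z 1 @^-1` B).
      by move=> mB; rewrite -(law (t - 1))// ?subr_ge0// subrKC.
    have [_ e1] := @integral_equal_law _ _ _ P (Z t) (Z 1) id mt m1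
      (@measurable_id _ _ setT) lt (square_integrable_integrable (Z2 t t0)).
    have mx2 : measurable_fun setT (fun x : R => x ^+ 2) by exact: measurable_funX.
    have [_ e2] := @integral_equal_law _ _ _ P (Z t) (Z 1) (fun x => x ^+ 2) mt m1
      mx2 lt it.
    rewrite /cov; congr (_ - _ * _); [|exact: e1|exact: e1].
    transitivity (E (fun w => Z t w ^+ 2)); first by apply: eq_Rintegral => w _; rewrite expr2.
    by rewrite [LHS]e2; apply: eq_Rintegral => w _; rewrite /= expr2.
  have : cov Z t t / t `^ (2 * gamma) @[t --> +oo] --> cov Z 1 1 * 0.
    apply: (@cvg_trans _ ((fun t => cov Z 1 1 * t `^ (- (2 * gamma))) @ +oo)).
      apply: near_eq_cvg; by near=> t; rewrite powRN cst//.
    apply: cvgM; first exact: cvg_cst.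
    by apply: cvg_powR_oppr; rewrite mulr_gt0.
  rewrite mulr0 => c0.
  have V00 : V = 0 by apply: (cvg_unique _ cV c0).
  by move: V0; rewrite V00 ltxx.
exists gamma; split => // s s0.
have [c [c0 cc]] := Zc s s0.
have Vs := Zs0 s s0.
have sV : 0 < Num.sqrt V by rewrite sqrtr_gt0.
have sVs : 0 < Num.sqrt (cov Z s s) by rewrite sqrtr_gt0.
exists (c / (Num.sqrt (cov Z s s) * Num.sqrt V)); split.
  by rewrite divr_gt0// mulr_gt0.
rewrite /asymp_equiv.
apply: (@cvg_trans _ ((fun t => (cov Z s t / c) *
   (Num.sqrt V / Num.sqrt (cov Z t t / t `^ (2 * gamma)))) @ +oo)).
  apply: near_eq_cvg; near=> t.
  have t0 : 0 < t by near: t; exact: nbhs_pinfty_gt.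
  have tg : 0 < t `^ gamma by exact: powR_gt0.
  have Vt := Zs0 t t0.
  have sVt : 0 < Num.sqrt (cov Z t t) by rewrite sqrtr_gt0.
  rewrite correlation_cov; [|exact/Z2/ltW|exact/Z2/ltW].
  rewrite sqrtrM ?ltW// sqrtrV ?powR_ge0//.
  have -> : Num.sqrt (t `^ (2 * gamma)) = t `^ gamma.
    have -> : t `^ (2 * gamma) = (t `^ gamma) ^+ 2.
      by rewrite -powR_mulrn ?powR_ge0// -powRrM mulrC.
    by rewrite sqrtr_sqr ger0_norm// ltW.
  rewrite powRN.
  move: (cov Z s t) (Num.sqrt (cov Z s s)) (Num.sqrt (cov Z t t)) (t `^ gamma) (Num.sqrt V)
    sVs sVt tg sV => x a b e f a0 b0 e0 f0.
  by field; rewrite !gt_eqF.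
suff : (cov Z s t / c) * (Num.sqrt V / Num.sqrt (cov Z t t / t `^ (2 * gamma)))
    @[t --> +oo] --> (c / c) * (Num.sqrt V / Num.sqrt V).
  by rewrite !divff ?lt0r_neq0// mulr1.
apply: cvgM; first by apply: cvgM => //; exact: cvg_cst.
apply: cvgM; first exact: cvg_cst.
apply: cvgV; first exact: lt0r_neq0.
apply: continuous_cvg; [exact: sqrt_continuous|exact: cV].
Unshelve. all: end_near. Qed.

End long_range_dependence.

(** * Positivity, linearity of the mean and asymptotic covariances for D_f *)

Section subordinator_moments.
Context d (T : measurableType d) (R : realType) (P : probability T R).
Local Notation E f := (\int[P]_w f w)%R.
Local Notation Int f := (P.-integrable setT (EFin \o f)).
Variables (f : R -> R) (D : R -> T -> R).
Hypothesis SD : levy_subordinator P f D.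
Hypothesis Dmom : forall r t : R, 0 < r -> 0 <= t ->
  ('E_P[fun w => (D t w `^ r)%R] < +oo)%E.

Let LD : levy_process P D. Proof. exact: subordinator_levy SD. Qed.

Let mD (t : R) : 0 <= t -> measurable_fun setT (D t).
Proof. by move=> t0; exact: levy_measurable LD t t0. Qed.

Let D0 (t : R) w : 0 <= t -> 0 <= D t w.
Proof. exact: subordinator_ge0 SD t w. Qed.

Let Dnd w : forall x y : R, 0 <= x -> x <= y -> D x w <= D y w.
Proof. by move=> x y; exact: subordinator_nondecreasing SD x y w. Qed.

Let mDr (r t : R) : 0 <= t -> measurable_fun setT (fun w => D t w `^ r).
Proof. by move=> t0; exact: measurableT_comp (measurable_powR r) (mD t0). Qed.

Lemma subordinator_integrable_powR (r t : R) : 0 < r -> 0 <= t ->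
  Int (fun w => D t w `^ r).
Proof.
move=> r0 t0; apply: ge0_integrable; [exact: mDr|by move=> w; exact: powR_ge0|].
by have := Dmom r0 t0; rewrite unlock.
Qed.

Let Dr := subordinator_integrable_powR.

Let iexp (t : R) : 0 <= t -> Int (fun w => expR (- (1 * D t w))).
Proof.
move=> t0; apply: (@bounded_integrable _ _ _ _ _ 1).
  apply: measurableT_comp => //; apply: measurableT_comp => //.
  by apply: measurable_funM => //; exact: mD.
by move=> w; rewrite ger0_norm ?expR_ge0// -[leRHS]expR0 ler_expR oppr_le0 mul1r D0.
Qed.

Let expR_le1' (t : R) w : 0 <= t -> expR (- (1 * D t w)) <= 1.
Proof. by move=> t0; rewrite -[leRHS]expR0 ler_expR oppr_le0 mul1r D0. Qed.

(** If f 1 <= 0 then E exp (- D_t) >= 1, which forces D_t = 0 almost surely and makes the moment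
    vanish. *)
Lemma subordinator_exponent_gt0 (alpha t : R) : 0 < alpha -> 0 <= t ->
  E (fun w => D t w `^ alpha) != 0 -> 0 < f 1.
Proof.
move=> a0 t0; apply: contraNT; rewrite -leNgt => f1.
have e1 : 1 <= E (fun w => expR (- (1 * D t w))).
  rewrite (subordinator_laplaceR SD)// -[leLHS]expR0 ler_expR oppr_ge0.
  exact: mulr_ge0_le0.
have i1 : Int (fun w => 1 - expR (- (1 * D t w))).
  by apply: integrable_subr; [exact: integrable_cst|exact: iexp].
have z0 w : 0 <= 1 - expR (- (1 * D t w)) by rewrite subr_ge0 expR_le1'.
have E0 : E (fun w => 1 - expR (- (1 * D t w))) = 0.
  apply/eqP; rewrite eq_le Rintegral_ge0// andbT.
  rewrite RintegralB//; [|exact: integrable_cst|exact: iexp].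
  by rewrite Rintegral_probability_cst; lra.
apply/eqP; rewrite -[RHS](Rintegral_probability_cst P); apply: Rintegral_ae_eq => //.
- exact: mDr.
- apply: filterS (ae_eq0_Rintegral i1 z0 E0) => w h.
  have /expR_inj/eqP : expR 0 = expR (- (1 * D t w)).
    by rewrite expR0; apply/eqP; rewrite -subr_eq0 h.
  rewrite eq_sym oppr_eq0 mul1r => /eqP ->.
  by rewrite powR0// gt_eqF.
Qed.

Lemma subordinator_moment_gt0 (alpha t : R) : 0 < f 1 -> 0 < alpha -> 0 < t ->
  0 < E (fun w => D t w `^ alpha).
Proof.
move=> f1 a0 t0; rewrite lt_neqAle Rintegral_ge0 ?andbT; last first.
  by move=> w _; exact: powR_ge0.
apply/eqP => /esym E0.
have D00 := ae_eq0_Rintegral (Dr a0 (ltW t0)) (fun w => powR_ge0 _ _) E0.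
have E1 : E (fun w => expR (- (1 * D t w))) = 1.
  rewrite -[RHS](Rintegral_probability_cst P); apply: Rintegral_ae_eq => //.
    exact: integrable_measurable (iexp (ltW t0)).
  apply: filterS D00 => w /eqP; rewrite powR_eq0 => /andP[/eqP -> _].
  by rewrite mulr0 oppr0 expR0.
have /expR_inj/eqP : expR (- (t * f 1)) = expR 0.
  by rewrite expR0 -(subordinator_laplaceR SD)// ltW.
by rewrite oppr_eq0 mulf_eq0 !gt_eqF.
Qed.

Lemma subordinator_mean_linear (t : R) : 0 <= t ->
  E (fun w => D t w `^ 1) = E (fun w => D 1 w `^ 1) * t.
Proof.
move: t; apply: additive_ge0_linear.
  by move=> t t0; apply: Rintegral_ge0 => w _; exact: powR_ge0.
move=> s h s0 h0.
have sh : 0 <= s + h by exact: addr_ge0.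
pose I w := D (s + h) w - D s w.
have mI : measurable_fun setT I by exact: (levy_measurable_increment LD s0 sh).
have [iI EI] := @integral_equal_law _ _ _ P (D h) I (fun x => x `^ 1) (mD h0) mI
  (measurable_powR 1) (fun B mB => esym (levy_increment_law LD s0 h0 mB)) (Dr ltr01 h0).
transitivity (E (fun w => D s w `^ 1 + I w `^ 1)).
  have sle : s <= s + h by rewrite lerDl.
  apply: eq_Rintegral => w _; rewrite (powRr1 (D0 w sh)) (powRr1 (D0 w s0)).
  by rewrite powRr1 ?subrKC// subr_ge0; exact: Dnd.
rewrite (RintegralD measurableT (Dr ltr01 s0) iI); congr (_ + _); exact: esym EI.
Qed.

Variable alpha : R.
Hypothesis alpha01 : 0 < alpha < 1.
Hypothesis f1 : 0 < f 1.

Let al0 : 0 < alpha. Proof. by have /andP[] := alpha01. Qed.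

Let ne := subordinator_unbounded SD f1.

(** The increment is at most D_s D_t^(alpha - 1), hence at most D_s^alpha: a majorant free of t. The
    case D_t = 0 is separate since a negative power occurs. *)
Let powR_inc_bound (s t : R) w : 0 <= s -> s <= t ->
  0 <= D t w `^ alpha - (D t w - D s w) `^ alpha <= D s w `^ alpha.
Proof.
move=> s0 st; have t0 := le_trans s0 st.
have Ds := D0 w s0; have Dst := Dnd w s0 st.
have := D0 w t0; rewrite le_eqVlt => /predU1P[Dt|Dt].
  have Ds0 : D s w = 0 by apply/eqP; rewrite eq_le Ds Dt Dst.
  by rewrite Ds0 -Dt subr0 subrr lexx powR_ge0.
have /andP[h1 h2] := powR_increment Ds Dst Dt alpha01.
rewrite h1 (le_trans h2)//; apply: powR_slope => //; by have /andP[] := alpha01.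
Qed.

Let powR_inc_cvg (s : R) w : 0 <= s -> (forall t, exists x : R, 0 <= x /\ t < D x w) ->
  D t w `^ alpha - (D t w - D s w) `^ alpha @[t --> +oo] --> 0.
Proof.
move=> s0 new; apply/cvgrPdist_lt => e e0.
have Ds1 : 0 < D s w + 1 by rewrite ltr_wpDl// D0.
have a1 : 0 < 1 - alpha by have /andP[] := alpha01; lra.
(* Once D_t > K, the bound D_s D_t^(alpha - 1) is below e; the added 1 keeps K positive when D_s =
   0. *)
pose K := ((D s w + 1) / e) `^ (1 - alpha)^-1.
have K0 : 0 < K by rewrite powR_gt0 ?divr_gt0.
have [x [x0 Kx]] := new K.
near=> t.
have st : s <= t by near: t; apply: nbhs_pinfty_ge; exact: num_real.
have KD : K < D t w by rewrite (lt_le_trans Kx)// Dnd.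
have Dt0 := lt_trans K0 KD.
have Dst := Dnd w s0 st.
have /andP[h1 h2] := powR_increment (D0 w s0) Dst Dt0 alpha01.
rewrite sub0r normrN ger0_norm//; apply: (le_lt_trans h2).
have -> : alpha - 1 = - (1 - alpha) by ring.
rewrite powRN ltr_pdivrMr ?powR_gt0//.
have Ka : K `^ (1 - alpha) = (D s w + 1) / e.
  by rewrite /K -powRrM mulVf ?gt_eqF// powRr1// divr_ge0// ltW.
have : K `^ (1 - alpha) < D t w `^ (1 - alpha).
  by apply: gt0_ltr_powR => //; rewrite nnegrE ltW.
rewrite Ka ltr_pdivrMr// [_ * e]mulrC => h.
by apply: lt_trans h; rewrite ltrDl.
Unshelve. all: end_near. Qed.

Let increment_powR_cvg (s : R) (g : T -> R) : 0 <= s -> measurable_fun setT g ->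
  (forall w, 0 <= g w) -> Int (fun w => g w * D s w `^ alpha) ->
  E (fun w => g w * (D t w `^ alpha - (D t w - D s w) `^ alpha)) @[t --> +oo] --> 0.
Proof.
move=> s0 mg g0 gi.
(* Replacing t by max s t changes nothing near +oo and makes the domination hold for every t. *)
pose F t w := g w * (D (Num.max s t) w `^ alpha - (D (Num.max s t) w - D s w) `^ alpha).
have smax t : s <= Num.max s t by rewrite le_max lexx.
have max0 t : 0 <= Num.max s t := le_trans s0 (smax t).
have mF t : measurable_fun setT (F t).
  apply: measurable_funM => //; apply: measurable_funB; first exact: mDr.
  apply: (measurableT_comp (measurable_powR alpha)).
  by apply: measurable_funB; exact: mD.
rewrite -[X in _ --> X](Rintegral_probability_cst P 0).
apply: (@cvg_trans _ ((fun t => E (F t)) @ +oo)).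
  by apply: near_eq_cvg; near=> t; rewrite /F max_r.
apply: (dominated_cvg_pinfty mF _ _ gi).
- exact: measurable_cst.
- apply: filterS ne => w new.
  rewrite -[X in _ --> X](mulr0 (g w)); apply: cvgM; first exact: cvg_cst.
  apply: cvg_trans (powR_inc_cvg s0 new); apply: near_eq_cvg; near=> t.
  by rewrite max_r.
- move=> t w; have /andP[h1 h2] := powR_inc_bound w s0 (smax t).
  by rewrite ger0_norm ?mulr_ge0// ler_wpM2l.
Unshelve. all: end_near. Qed.

Let A t := E (fun w => D t w `^ alpha).
Let B t := E (fun w => D t w `^ (2 * alpha)).

Let powR2 (x : R) : x `^ (2 * alpha) = (x `^ alpha) ^+ 2.
Proof. by rewrite -powR_mulrn ?powR_ge0// -powRrM mulrC. Qed.

Lemma subordinator_square_integrable_powR (t : R) : 0 <= t ->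
  square_integrable P (fun w => D t w `^ alpha).
Proof.
move=> t0; split; first exact: mDr.
have := Dr (mulr_gt0 (ltr0Sn R 1) al0) t0.
by apply: eq_integrable => //= w _; rewrite powR2.
Qed.

Let Da2 := subordinator_square_integrable_powR.

Lemma subordinator_moment_le (t : R) : 0 <= t -> A t ^+ 2 <= B t.
Proof.
move=> t0; have -> : B t = E (fun w => (D t w `^ alpha) ^+ 2).
  by apply: eq_Rintegral => w _; rewrite powR2.
exact: ler_Rintegral_sqr (Da2 t0).
Qed.

(** By independence of increments, E (D_s^alpha (D_t - D_s)^alpha) = A_s (A_t - e0 t), and the other
    expectation exceeds it by e1 t. The errors e0 and e1 are the vanishing increments with weights 1
    and D_s^alpha. *)
Lemma subordinator_covariance_cvg (s : R) : 0 < s ->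
  E (fun w => D s w `^ alpha * D t w `^ alpha) - A s * A t @[t --> +oo] --> 0 /\
  E (fun w => D s w `^ alpha * (D t w - D s w) `^ alpha) - A s * A t @[t --> +oo] --> 0.
Proof.
move=> s0; have s0' := ltW s0.
have Ds2 := Da2 s0'.
have Dsi := square_integrable_integrable Ds2.
have c0 : E (fun w => 1 * (D t w `^ alpha - (D t w - D s w) `^ alpha)) @[t --> +oo] --> 0.
  apply: increment_powR_cvg => //.
  by apply: eq_integrable Dsi => //= w _; rewrite mul1r.
have c1 : E (fun w => D s w `^ alpha * (D t w `^ alpha - (D t w - D s w) `^ alpha))
    @[t --> +oo] --> 0.
  apply: increment_powR_cvg => //; first exact: mDr.
    by move=> w; exact: powR_ge0.
  exact: square_integrable_mul.
pose e0 t := E (fun w => 1 * (D t w `^ alpha - (D t w - D s w) `^ alpha)).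
pose e1 t := E (fun w => D s w `^ alpha * (D t w `^ alpha - (D t w - D s w) `^ alpha)).
have H t : s <= t ->
    E (fun w => D s w `^ alpha * (D t w - D s w) `^ alpha) = A s * (A t - e0 t) /\
    E (fun w => D s w `^ alpha * D t w `^ alpha) = A s * (A t - e0 t) + e1 t.
  move=> st; have t0 := le_trans s0' st.
  have h0 : 0 <= t - s by rewrite subr_ge0.
  pose I w := D t w - D s w.
  have mI : measurable_fun setT I by apply: measurable_funB; exact: mD.
  have Dt2 := Da2 t0; have Dti := square_integrable_integrable Dt2.
  have mIa : measurable_fun setT (fun w => I w `^ alpha).
    exact: measurableT_comp (measurable_powR alpha) mI.
  have Ia w : `|I w `^ alpha| <= D t w `^ alpha.
    rewrite ger0_norm ?powR_ge0//.
    by have /andP[] := powR_inc_bound w s0' st; rewrite subr_ge0.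
  have Ii : Int (fun w => I w `^ alpha) by exact: integrable_dominated Dti Ia.
  have [mul_i mulE] : Int (fun w => D s w `^ alpha * I w `^ alpha) /\
     E (fun w => D s w `^ alpha * I w `^ alpha) = A s * E (fun w => I w `^ alpha).
    apply: integral_independent_mul => // A' B' mA' mB'.
    have := @levy_increment_independent _ _ _ _ _ LD s (t - s)
      (((@powR R)^~ alpha) @^-1` A') (((@powR R)^~ alpha) @^-1` B') s0' h0.
    rewrite subrKC; apply.
      by rewrite -[X in measurable X]setTI; exact: measurable_powR.
    by rewrite -[X in measurable X]setTI; exact: measurable_powR.
  have IE : E (fun w => I w `^ alpha) = A t - e0 t.
    rewrite /e0 /A -RintegralB//.
      by apply: eq_Rintegral => w _; rewrite /I; ring.
    have := integrable_subr Dti Ii.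
    by apply: eq_integrable => //= w _; rewrite mul1r.
  split; first by rewrite -IE -mulE.
  rewrite -IE -mulE /e1 -RintegralD//.
    by apply: eq_Rintegral => w _; rewrite /I; ring.
  have := integrable_subr (square_integrable_mul Ds2 Dt2) mul_i.
  by apply: eq_integrable => //= w _; rewrite mulrBr.
split.
  apply: (@cvg_trans _ ((fun t => e1 t - A s * e0 t) @ +oo)).
    apply: near_eq_cvg; near=> t.
    have st : s <= t by near: t; apply: nbhs_pinfty_ge; exact: num_real.
    have [_ ->] := H t st; move: (A s) (A t) (e0 t) (e1 t) => a b e e'; ring.
  have : e1 t - A s * e0 t @[t --> +oo] --> 0 - A s * 0.
    by apply: cvgB => //; apply: cvgM => //; exact: cvg_cst.
  by rewrite mulr0 subr0.
apply: (@cvg_trans _ ((fun t => - (A s * e0 t)) @ +oo)).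
  apply: near_eq_cvg; near=> t.
  have st : s <= t by near: t; apply: nbhs_pinfty_ge; exact: num_real.
  have [-> _] := H t st; move: (A s) (A t) (e0 t) => a b e; ring.
have : - (A s * e0 t) @[t --> +oo] --> - (A s * 0).
  by apply: cvgN; apply: cvgM => //; exact: cvg_cst.
by rewrite mulr0 oppr0.
Unshelve. all: end_near. Qed.

End subordinator_moments.

Section asymptotics.
Context (R : realType).

(** Replacing t by 2 t multiplies the quotient by 2 / 2^rho without changing its limit 1, so 2^rho =
    2. *)
Lemma linear_not_asymp_power (K k1 rho : R) : 0 < k1 -> rho < 1 ->
  ~ asymp_equiv (fun t => K * t) (fun t => k1 * t `^ rho).
Proof.
move=> k10 rho1 c; rewrite /asymp_equiv in c.
have two : 2 * t @[t --> +oo] --> (+oo : set_system R).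
  apply/cvgryPge => M; near=> t.
  have : M / 2 <= t by near: t; apply: nbhs_pinfty_ge; exact: num_real.
  lra.
have c2 : K * (2 * t) / (k1 * (2 * t) `^ rho) @[t --> +oo] --> (1 : R).
  exact: cvg_comp two c.
have c3 : K * t / (k1 * t `^ rho) * (2 / 2 `^ rho) @[t --> +oo] --> 1 * (2 / 2 `^ rho).
  by apply: cvgM => //; exact: cvg_cst.
have c4 : K * t / (k1 * t `^ rho) * (2 / 2 `^ rho) @[t --> +oo] --> (1 : R).
  apply: cvg_trans c2; apply: near_eq_cvg; near=> t.
  rewrite /= powRM ?ltW//.
  have : 0 < 2 `^ rho :> R by exact: powR_gt0.
  have : 0 < t `^ rho by exact: powR_gt0.
  move: (2 `^ rho) (t `^ rho) => a b b0 a0.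
  by field; rewrite !gt_eqF.
have e : 1 * (2 / 2 `^ rho) = 1 :> R by apply: (cvg_unique _ c3 c4).
have p0 : 0 < 2 `^ rho :> R by exact: powR_gt0.
have : 2 `^ rho = 2 :> R.
  by rewrite mul1r in e; rewrite -[RHS](divfK (lt0r_neq0 p0)) e mul1r.
move=> /(congr1 (@ln R)); rewrite ln_powR => h.
have l2 : 0 < ln 2 :> R by rewrite ln_gt0// ltr1n.
have r1 : rho = 1 by apply: (mulIf (lt0r_neq0 l2)); rewrite mul1r.
by move: rho1; rewrite r1 ltxx.
Unshelve. all: end_near. Qed.

End asymptotics.

Section main.
Context d (T : measurableType d) (R : realType) (P : probability T R).
Local Notation E f := (\int[P]_w f w)%R.
Local Notation Int f := (P.-integrable setT (EFin \o f)).
Variables (X D : R -> T -> R) (f : R -> R) (alpha m v q c : R).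
Hypothesis alpha01 : 0 < alpha < 1.
Hypotheses (v0 : 0 < v) (q0 : 0 < q) (qc : q ^+ 2 < c).
Hypothesis X2 : forall t, 0 <= t -> square_integrable P (X t).
Hypothesis cX : forall w t, 0 <= t -> X u w @[u --> t^'+] --> X t w.
Hypothesis XE : forall t, 0 <= t -> E (X t) = m * (q * t `^ alpha).
Hypothesis XXE : forall t, 0 <= t -> E (fun w => X t w ^+ 2) =
  v * (q * t `^ alpha) + m ^+ 2 * (c * t `^ (2 * alpha)).
Hypothesis Xbounds : forall s t, 0 <= s -> s <= t ->
  v * (q * s `^ alpha) + m ^+ 2 * (c / 2 * s `^ (2 * alpha) +
    q ^+ 2 * (s `^ alpha * (t - s) `^ alpha))
  <= E (fun w => X s w * X t w) <=
  v * (q * s `^ alpha) + m ^+ 2 * (c / 2 * s `^ (2 * alpha) +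
    q ^+ 2 * (s `^ alpha * t `^ alpha)).
Hypothesis SD : levy_subordinator P f D.
Hypothesis XD : independent_processes P X D.
Hypothesis Dmom : forall r t : R, 0 < r -> 0 <= t ->
  ('E_P[fun w => (D t w `^ r)%R] < +oo)%E.
Hypothesis f1 : 0 < f 1.

Let al0 : 0 < alpha. Proof. by have /andP[] := alpha01. Qed.

Let al2 : 0 < 2 * alpha. Proof. exact: mulr_gt0. Qed.

Let mD (t : R) : 0 <= t -> measurable_fun setT (D t).
Proof. by move=> t0; exact: levy_measurable (subordinator_levy SD) t t0. Qed.

Let D0 (t : R) w : 0 <= t -> 0 <= D t w.
Proof. exact: subordinator_ge0 SD t w. Qed.

Let Dnd w : forall x y : R, 0 <= x -> x <= y -> D x w <= D y w.
Proof. by move=> x y; exact: subordinator_nondecreasing SD x y w. Qed.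

Let Z := time_change X D.
Let A t := E (fun w => D t w `^ alpha).
Let B t := E (fun w => D t w `^ (2 * alpha)).

Let Da (t : R) : 0 <= t -> Int (fun w => D t w `^ alpha).
Proof. exact: subordinator_integrable_powR SD Dmom alpha t al0. Qed.

Let Db (t : R) : 0 <= t -> Int (fun w => D t w `^ (2 * alpha)).
Proof. exact: subordinator_integrable_powR SD Dmom (2 * alpha) t al2. Qed.

Let Da2 (t : R) : 0 <= t -> square_integrable P (fun w => D t w `^ alpha).
Proof. exact: subordinator_square_integrable_powR SD Dmom alpha alpha01 t. Qed.

Let E2 (t : R) : 0 <= t -> Int (fun w => E (fun w' => X (D t w) w' ^+ 2)).
Proof.
move=> t0.
have := integrable_addr (integrable_mull (v * q) (Da t0)) (integrable_mull (m ^+ 2 * c) (Db t0)).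
by apply: eq_integrable => //= w _; rewrite XXE ?D0// !mulrA.
Qed.

Lemma time_changed_square_integrable (t : R) : 0 <= t -> square_integrable P (Z t).
Proof. by move=> t0; exact: time_change_square_integrable. Qed.

Let ZE (t : R) : 0 <= t -> E (Z t) = m * q * A t.
Proof.
move=> t0; rewrite (Rintegral_time_change X2 cX mD D0 XD E2 t0).
transitivity (E (fun w => (m * q) * D t w `^ alpha)).
  by apply: eq_Rintegral => w _; rewrite XE ?D0// mulrA.
by rewrite RintegralZl//; exact: Da.
Qed.

Lemma time_changed_variance (t : R) : 0 <= t ->
  cov P Z t t = v * q * A t + m ^+ 2 * (c * B t - q ^+ 2 * A t ^+ 2).
Proof.
move=> t0; rewrite /cov (Rintegral_time_change_product X2 cX mD D0 XD E2 t0 t0).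
rewrite ZE//.
have -> : E (fun w => E (fun w' => X (D t w) w' * X (D t w) w')) =
    E (fun w => (v * q) * D t w `^ alpha + (m ^+ 2 * c) * D t w `^ (2 * alpha)).
  apply: eq_Rintegral => w _; rewrite Rintegral_sqr.
  by rewrite XXE ?D0// !mulrA.
rewrite RintegralD//; [|exact/integrable_mull/Da|exact/integrable_mull/Db].
rewrite !RintegralZl//; [|exact: Db|exact: Da].
by rewrite -/(A t) -/(B t); ring.
Qed.

(** The term v q A_t is already positive; the bracket is nonnegative as c B_t >= c A_t^2 >= q^2
    A_t^2. *)
Lemma time_changed_variance_gt0 (t : R) : 0 < t -> 0 < cov P Z t t.
Proof.
move=> t0; rewrite time_changed_variance ?ltW//.
have A0 : 0 < A t by exact: (subordinator_moment_gt0 SD Dmom).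
have AB : A t ^+ 2 <= B t by exact: (subordinator_moment_le SD Dmom alpha01 (ltW t0)).
rewrite ltr_pwDl ?mulr_gt0// mulr_ge0 ?sqr_ge0// subr_ge0.
have c0 : 0 <= c by rewrite (le_trans _ (ltW qc))// sqr_ge0.
apply: (@le_trans _ _ (c * A t ^+ 2)); first by rewrite ler_wpM2r ?sqr_ge0// ltW.
by rewrite ler_wpM2l.
Qed.

Lemma time_changed_covariance_cvg (s : R) : 0 < s ->
  cov P Z s t @[t --> +oo] --> v * q * A s + m ^+ 2 * (c / 2 * B s).
Proof.
move=> s0; have s0' := ltW s0.
have [c1 c2] := subordinator_covariance_cvg SD Dmom alpha01 f1 s0.
set c0 := v * q * A s + _.
pose up t := E (fun w => D s w `^ alpha * D t w `^ alpha) - A s * A t.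
pose lo t := E (fun w => D s w `^ alpha * (D t w - D s w) `^ alpha) - A s * A t.
have lim u : u t @[t --> +oo] --> 0 -> c0 + m ^+ 2 * q ^+ 2 * u t @[t --> +oo] --> c0.
  move=> cu; have : c0 + m ^+ 2 * q ^+ 2 * u t @[t --> +oo] --> c0 + m ^+ 2 * q ^+ 2 * 0.
    by apply: cvgD; [exact: cvg_cst|apply: cvgM => //; exact: cvg_cst].
  by rewrite mulr0 addr0.
apply: (@squeeze_cvgr _ _ _ _ (fun t => c0 + m ^+ 2 * q ^+ 2 * lo t)
  (fun t => c0 + m ^+ 2 * q ^+ 2 * up t)); [|exact: lim c2|exact: lim c1].
near=> t.
have st : s <= t by near: t; apply: nbhs_pinfty_ge; exact: num_real.
have t0 := le_trans s0' st.
have mI : measurable_fun setT (fun w => (D t w - D s w) `^ alpha).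
  apply: (measurableT_comp (measurable_powR alpha)).
  by apply: measurable_funB; exact: mD.
have mDa (r : R) : 0 <= r -> measurable_fun setT (fun w => D r w `^ alpha).
  by move=> r0; have [] := Da2 r0.
have iup : Int (fun w => D s w `^ alpha * D t w `^ alpha).
  exact: square_integrable_mul (Da2 s0') (Da2 t0).
have ilo : Int (fun w => D s w `^ alpha * (D t w - D s w) `^ alpha).
  apply: (integrable_dominated _ iup).
    by apply: measurable_funM => //; exact: mDa.
  move=> w; have Dst : D s w <= D t w by exact: Dnd.
  rewrite ger0_norm ?mulr_ge0 ?powR_ge0// ler_wpM2l ?powR_ge0//.
  apply: ge0_ler_powR; rewrite ?nnegrE ?D0 ?subr_ge0 ?(ltW al0)//.
  by rewrite gerBl D0.
have comb g : Int g ->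
    Int (fun w => (v * q) * D s w `^ alpha + (m ^+ 2 * (c / 2)) * D s w `^ (2 * alpha)
      + (m ^+ 2 * q ^+ 2) * g w) /\
    E (fun w => (v * q) * D s w `^ alpha + (m ^+ 2 * (c / 2)) * D s w `^ (2 * alpha)
      + (m ^+ 2 * q ^+ 2) * g w) = c0 + m ^+ 2 * q ^+ 2 * E g.
  move=> gi.
  have j1 := integrable_mull (v * q) (Da s0').
  have j2 := integrable_mull (m ^+ 2 * (c / 2)) (Db s0').
  have j3 := integrable_mull (m ^+ 2 * q ^+ 2) gi.
  split; first by apply: integrable_addr => //; exact: integrable_addr.
  rewrite RintegralD//; last exact: integrable_addr.
  rewrite RintegralD// !RintegralZl//; [|exact: Db|exact: Da].
  by rewrite /c0 -/(A s) -/(B s); ring.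
have [i1 e1] := comb _ iup; have [i2 e2] := comb _ ilo.
pose J w := E (fun w' => X (D s w) w' * X (D t w) w').
have mJ : measurable_fun setT J.
  exact: (measurable_time_change_product X2 cX mD D0 s0' t0).
have Jb w := Xbounds (D0 w s0') (Dnd w s0' st).
have Jlo w : (v * q) * D s w `^ alpha + (m ^+ 2 * (c / 2)) * D s w `^ (2 * alpha)
      + (m ^+ 2 * q ^+ 2) * (D s w `^ alpha * (D t w - D s w) `^ alpha) <= J w.
  have /andP[h _] := Jb w; apply: le_trans h.
  by rewrite le_eqVlt; apply/orP; left; apply/eqP; ring.
have Jup w : J w <= (v * q) * D s w `^ alpha + (m ^+ 2 * (c / 2)) * D s w `^ (2 * alpha)
      + (m ^+ 2 * q ^+ 2) * (D s w `^ alpha * D t w `^ alpha).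
  have /andP[_ h] := Jb w; apply: (le_trans h).
  by rewrite le_eqVlt; apply/orP; left; apply/eqP; ring.
have c_ge0 : 0 <= c by rewrite (le_trans _ (ltW qc))// sqr_ge0.
(* Nonnegativity, read off the lower bound, lets the upper bound alone dominate J and gives its
   integrability. *)
have J0 w : 0 <= J w.
  apply: le_trans (Jlo w).
  have m0 := sqr_ge0 m; have p0 := @powR_ge0 R.
  apply: addr_ge0; [apply: addr_ge0|].
  - by apply: mulr_ge0 => //; rewrite ltW// mulr_gt0.
  - by apply: mulr_ge0 => //; apply: mulr_ge0 => //; rewrite divr_ge0.
  - by apply: mulr_ge0; [rewrite mulr_ge0// sqr_ge0|rewrite mulr_ge0].
have iJ : Int J.
  by apply: (integrable_dominated mJ i1) => w; rewrite ger0_norm.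
have -> : cov P Z s t = E J - m ^+ 2 * q ^+ 2 * (A s * A t).
  rewrite /cov (Rintegral_time_change_product X2 cX mD D0 XD E2 s0' t0) !ZE//.
  by congr (_ - _); move: (A s) (A t) => a b; ring.
have l1 : c0 + m ^+ 2 * q ^+ 2 * E (fun w => D s w `^ alpha * (D t w - D s w) `^ alpha) <= E J.
  by rewrite -e2; apply: le_Rintegral.
have l2 : E J <= c0 + m ^+ 2 * q ^+ 2 * E (fun w => D s w `^ alpha * D t w `^ alpha).
  by rewrite -e1; apply: le_Rintegral.
have distr x a : c0 + m ^+ 2 * q ^+ 2 * (x - a) =
    c0 + m ^+ 2 * q ^+ 2 * x - m ^+ 2 * q ^+ 2 * a by rewrite mulrBr addrA.
by rewrite /lo /up !distr !lerD2r l1 l2.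
Unshelve. all: end_near. Qed.

Lemma time_changed_long_range_dependent (rho k1 k2 : R) :
  0 < rho < 1 -> 0 < k1 -> k1 ^+ 2 <= k2 ->
  asymp_equiv A (fun t => k1 * t `^ rho) ->
  asymp_equiv B (fun t => k2 * t `^ (2 * rho)) ->
  long_range_dependent P Z.
Proof.
move=> /andP[rho0 rho1] k10 k2k1 cA cB.
have k20 : 0 < k2 by rewrite (lt_le_trans _ k2k1)// exprn_gt0.
have c0 : 0 < c by rewrite (le_lt_trans _ qc)// sqr_ge0.
have covs (s : R) : 0 < s -> exists c' : R, 0 < c' /\ cov P Z s t @[t --> +oo] --> c'.
  move=> s0; exists (v * q * A s + m ^+ 2 * (c / 2 * B s)).
  split; last exact: time_changed_covariance_cvg.
  have A0 : 0 < A s by exact: (subordinator_moment_gt0 SD Dmom).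
  have B0 : 0 <= B s by apply: Rintegral_ge0 => w _; exact: powR_ge0.
  by rewrite ltr_pwDl ?mulr_gt0// mulr_ge0 ?sqr_ge0// mulr_ge0// divr_ge0// ltW.
have lrd (gamma V : R) := @long_range_dependent_of_cov _ _ _ P Z gamma V
  time_changed_square_integrable.
have [m0|m0] := eqVneq m 0.
  apply: (lrd (rho / 2) (v * q * k1)) => //; last exact: time_changed_variance_gt0.
  - by rewrite divr_gt0//= ltr_pdivrMr//; lra.
  - by rewrite !mulr_gt0.
  apply: (@cvg_trans _ ((fun t => v * q * k1 * (A t / (k1 * t `^ rho))) @ +oo)).
    apply: near_eq_cvg; near=> t.
    have t0 : 0 < t by near: t; exact: nbhs_pinfty_gt.
    rewrite time_changed_variance ?ltW// m0 expr0n mul0r addr0.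
    have -> : 2 * (rho / 2) = rho by field.
    have : 0 < t `^ rho by exact: powR_gt0.
    by move: (t `^ rho) => a a0; field; rewrite !gt_eqF.
  have : v * q * k1 * (A t / (k1 * t `^ rho)) @[t --> +oo] --> v * q * k1 * 1.
    by apply: cvgM => //; exact: cvg_cst.
  by rewrite mulr1.
(* The coefficient of t^(2 rho) in the variance. Its positivity combines q^2 < c with k1^2 <= k2;
   the contribution v q A_t is of the lower order t^rho. *)
apply: (lrd rho (m ^+ 2 * (c * k2 - q ^+ 2 * k1 ^+ 2))) => //.
- by rewrite rho0.
- rewrite mulr_gt0// ?exprn_even_gt0// subr_gt0.
  apply: (@lt_le_trans _ _ (c * k1 ^+ 2)); last by rewrite ler_pM2l.
  by rewrite ltr_pM2r// exprn_gt0.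
- apply: (@cvg_trans _ ((fun t => v * q * k1 * (A t / (k1 * t `^ rho)) * t `^ (- rho) +
     m ^+ 2 * (c * k2 * (B t / (k2 * t `^ (2 * rho))) -
               q ^+ 2 * k1 ^+ 2 * (A t / (k1 * t `^ rho)) ^+ 2)) @ +oo)).
    apply: near_eq_cvg; near=> t.
    have t0 : 0 < t by near: t; exact: nbhs_pinfty_gt.
    rewrite time_changed_variance ?ltW// powRN.
    have -> : t `^ (2 * rho) = (t `^ rho) ^+ 2.
      by rewrite -powR_mulrn ?powR_ge0// -powRrM mulrC.
    have : 0 < t `^ rho by exact: powR_gt0.
    by move: (t `^ rho) => a a0; field; rewrite !gt_eqF.
  have : v * q * k1 * (A t / (k1 * t `^ rho)) * t `^ (- rho) +
     m ^+ 2 * (c * k2 * (B t / (k2 * t `^ (2 * rho))) -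
               q ^+ 2 * k1 ^+ 2 * (A t / (k1 * t `^ rho)) ^+ 2) @[t --> +oo] -->
     v * q * k1 * 1 * 0 + m ^+ 2 * (c * k2 * 1 - q ^+ 2 * k1 ^+ 2 * 1 ^+ 2).
    apply: cvgD; apply: cvgM.
    + by apply: cvgM => //; exact: cvg_cst.
    + exact: cvg_powR_oppr.
    + exact: cvg_cst.
    + apply: cvgB; apply: cvgM; try exact: cvg_cst; first exact: cB.
      by rewrite !expr2; under eq_fun do rewrite expr2; exact: cvgM.
  by rewrite mulr0 add0r mulr1 expr1n mulr1.
- exact: time_changed_variance_gt0.
Unshelve. all: end_near. Qed.

End main.

Theorem theorem3p3 (R : realType) (d : measure_display) (T : measurableType d)
  (P : probability T R)
  (k : nat) (lam mu : 'I_k -> R) (alpha : R) (f : R -> R)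
  (Salpha Df : R -> T -> R) (rho k1 k2 : R)
  (k_ge1 : (1 <= k)%N)
  (lam_gt0 : forall j, 0 < lam j) (mu_gt0 : forall j, 0 < mu j)
  (alpha_range : 0 < alpha <= 1)
  (Salpha_gfsp : generalized_fractional_skellam_process P lam mu alpha Salpha)
  (Df_subordinator : levy_subordinator P f Df)
  (Salpha_Df_independent : independent_processes P Salpha Df)
  (Df_moments : forall r t : R, 0 < r -> 0 <= t ->
    ('E_P[fun w => (Df t w `^ r)%R] < +oo)%E)
  (rho_range : 0 < rho < 1) (k1_gt0 : 0 < k1) (k2_ge : k1 ^+ 2 <= k2)
  (moment1 : asymp_equiv (fun t => fine 'E_P[fun w => (Df t w `^ alpha)%R]%E)
                         (fun t => k1 * t `^ rho))
  (moment2 : asymp_equiv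
                         (fun t => fine 'E_P[fun w => (Df t w `^ (2 * alpha))%R]%E)
                         (fun t => k2 * t `^ (2 * rho))) :
  long_range_dependent P (time_change Salpha Df).
Proof.
have [rho0 rho1] := andP rho_range.
have toR (r : R) : (fun t => fine 'E_P[fun w => (Df t w `^ r)%R]%E) =
    (fun t => \int[P]_w (Df t w `^ r)).
  by apply/funext => t; rewrite unlock.
rewrite !toR in moment1 moment2.
case: Salpha_gfsp => [[alpha1 _]|[alpha01 [S [D [GS SD SY SalphaE]]]]].
  exfalso; rewrite alpha1 in moment1.
  apply: (@linear_not_asymp_power _ (\int[P]_w (Df 1 w `^ 1)) k1 rho) => //.
  apply: cvg_trans moment1; apply: near_eq_cvg; near=> t.
  by rewrite (subordinator_mean_linear Df_subordinator Df_moments)//.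
have [m [v [q [c [[v0 q0 qc] [X2 cX XE XXE Xb]]]]]] :=
  fractional_skellam_moments k_ge1 lam_gt0 mu_gt0 alpha01 GS SD SY SalphaE.
have al0 : 0 < alpha by have /andP[] := alpha01.
(* The quotient in [moment1] tends to 1, so at some t >= 0 the moment is nonzero and D_f is not
   degenerate. *)
have f1 : 0 < f 1.
  have := moment1; rewrite /asymp_equiv => /cvgr_gt /(_ 0 ltr01) H.
  have /filter_ex [t [t0 Ht]] : \forall t \near +oo, 0 <= t /\
      0 < \int[P]_w (Df t w `^ alpha) / (k1 * t `^ rho).
    near=> t; split; first by near: t; apply: nbhs_pinfty_ge; exact: num_real.
    by near: t.
  apply: (subordinator_exponent_gt0 Df_subordinator al0 t0).
  by apply: contraTneq Ht => ->; rewrite mul0r ltxx.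
exact: (time_changed_long_range_dependent alpha01 v0 q0 qc X2 cX XE XXE Xb
  Df_subordinator Salpha_Df_independent Df_moments f1 rho_range k1_gt0 k2_ge moment1 moment2).
Unshelve. all: end_near. Qed.
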